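(* Let $n\ge2$ and $N=2n$. Put $\xi=r^{-n-1}s^{n+1}$ and define, for a variable $z$, the operator on $V\otimes V$, $V=\mathbb K^{N}$, $$\begin{aligned}\hat R(z)={}&(z-r^{-1}s)(z-\xi)\sum_{i=1}^{2n}E_{ii}\otimes E_{ii}+\sum_{1\le i,j\le 2n,\ j\ne i,i'}a_{ij}(z)E_{ij}\otimes E_{ji}\\&+(1-r^{-1}s)(z-\xi)\sum_{i>j,\ j\ne i'}E_{ii}\otimes E_{jj}+(1-r^{-1}s)z(z-\xi)\sum_{i<j,\ j\ne i'}E_{ii}\otimes E_{jj}+\sum_{i,j=1}^{2n}b_{ij}(z)E_{i'j}\otimes E_{ij'},\end{aligned}$$ where, for $j\ne i,i'$, $a_{ij}(z)=r^{-1/2}s^{1/2}(z-1)(z-\xi)(rs)^{-\frac12\sigma_i\sigma_j}$ if ($i<j$ and $i<j'$) or ($i>j$ and $i>j'$), $a_{ij}(z)=r^{-1/2}s^{1/2}(z-1)(z-\xi)(rs)^{\frac12\sigma_i\sigma_j}$ if $j<i<j'$ or $j'<i<j$; and $$b_{ij}(z)=\begin{cases}(r^{-1}sz-\xi)(z-1)&i=j,\\ (r^{-1}s-1)\bigl(\xi t_it_j^{-1}(z-1)-\delta_{i,j'}(z-\xi)\bigr)&i<j,\\ (r^{-1}s-1)z\bigl(t_it_j^{-1}(z-1)-\delta_{i,j'}(z-\xi)\bigr)&i>j.\end{cases}$$ Here $\sigma_i=1$ for $i\le n$, $\sigma_i=-1$ for $i>n$; $t_i=s^{i-n-1}$ for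 $i\le n$, $t_i=-r^{n-i}$ for $i>n$. (a) For the $U_{r,s}(\widehat{\mathfrak{sp}}_{2n})$-modules $\rho_u^{a,b}$, $\rho_v^{a,b}$ of the context with $ab=(rs)^{-1}$, one has, with $z=u/v$, $$\hat R(u/v)\circ(\rho_u^{a,b}\otimes\rho_v^{a,b})(x)=(\rho_v^{a,b}\otimes\rho_u^{a,b})(x)\circ\hat R(u/v)\quad\text{for all }x\in U_{r,s}(\widehat{\mathfrak{sp}}_{2n}).$$ (b) The operator $R(z)=\hat R(z)\circ\tau$, $\tau(x\otimes y)=y\otimes x$, satisfies the Yang–Baxter equation with spectral parameter $$R_{12}(v/w)R_{13}(u/w)R_{23}(u/v)=R_{23}(u/v)R_{13}(u/w)R_{12}(v/w)\quad\text{on }V\otimes V\otimes V.$$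
   Context: $\mathbb K$ is an algebraically closed field containing $\mathbb C(r,s)$ with $r,s$ indeterminates; square roots $r^{1/2},s^{1/2}\in\mathbb K$ are fixed and $(rs)^{1/2}=r^{1/2}s^{1/2}$. $i'=N+1-i$; $E_{ij}$ are matrix units, $E_{ij}v_k=\delta_{jk}v_i$, for the standard basis $v_1,\dots,v_N$ of $V$; indices in sums run over $1,\dots,N$. $R_{12}(z)=R(z)\otimes\mathrm{Id}$, $R_{23}(z)=\mathrm{Id}\otimes R(z)$, $R_{13}(z)=(\mathrm{Id}\otimes\tau)R_{12}(z)(\mathrm{Id}\otimes\tau)$. **Root data (type $C_n$).** $\varepsilon_1,\dots,\varepsilon_n$ is an orthonormal basis of $\mathbb R^n$; $\alpha_i=\varepsilon_i-\varepsilon_{i+1}$ ($1\le i<n$), $\alpha_n=2\varepsilon_n$, highest root $\theta=2\varepsilon_1$; in the formulas below put $\alpha_0:=-\theta$. $\langle\cdot,\cdot\rangle$ is the bilinear form on $\bigoplus\mathbb Z\varepsilon_i$ with $\langle\varepsilon_i,\varepsilon_i\rangle=\frac12$, $\langle\varepsilon_i,\varepsilon_j\rangle=-\frac12$ for $i<j$ and $\frac12$ for $i>j$. For $0\le i,j\le n$: $c_{ij}=2(\alpha_i,\alpha_j)/(\alpha_i,\alpha_i)$, $r_i=r^{(\alpha_i,\alpha_i)/2}$, $s_i=s^{(\alpha_i,\alpha_i)/2}$, $\Omega_{ij}=r^{\langle\alpha_i,\alpha_j\rangle}s^{-\langle\alpha_j,\alpha_i\rangle}$. **Algebra.** $[m]_{r,s}=\frac{r^m-s^m}{r-s}$,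 $[m]_{r,s}!=[m]_{r,s}\cdots[1]_{r,s}$, $\genfrac{[}{]}{0pt}{}{m}{k}_{r,s}=\frac{[m]_{r,s}!}{[m-k]_{r,s}![k]_{r,s}!}$. $U_{r,s}(\widehat{\mathfrak g})$, $\mathfrak g=\mathfrak{sp}_{2n}$, is the associative $\mathbb K$-algebra generated by $e_i,f_i,\omega_i^{\pm1},(\omega_i')^{\pm1}$ ($0\le i\le n$), $\gamma^{\pm1},(\gamma')^{\pm1},D^{\pm1},(D')^{\pm1}$ with relations (for all $0\le i,j\le n$): $D,D',\omega_i,\omega'_j$ are invertible with the indicated inverses and pairwise commute; $De_iD^{-1}=r_i^{\delta_{0i}}e_i$, $Df_iD^{-1}=r_i^{-\delta_{0i}}f_i$, $D'e_i(D')^{-1}=s_i^{\delta_{0i}}e_i$, $D'f_i(D')^{-1}=s_i^{-\delta_{0i}}f_i$; $\gamma=\omega_0\omega_\theta$ and $\gamma'=\omega_0'\omega'_\theta$ are central (where $\omega_\theta=\prod\omega_i^{m_i}$, $\omega_\theta'=\prod(\omega_i')^{m_i}$ for $\theta=\sum_{i\ge1}m_i\alpha_i$); $\omega_ie_j=\Omega_{ji}e_j\omega_i$, $\omega_if_j=\Omega_{ji}^{-1}f_j\omega_i$, $\omega'_ie_j=\Omega_{ij}^{-1}e_j\omega'_i$, $\omega'_if_j=\Omega_{ij}f_j\omega_i'$; $e_if_j-f_je_i=\delta_{ij}\frac{\omega_i-\omega'_i}{r_i-s_i}$; and for $i\neq j$, $\sum_{k=0}^{1-c_{ij}}(-1)^k\genfrac{[}{]}{0pt}{}{1-c_{ij}}{k}_{r_i,s_i}(r_is_i)^{k(k-1)/2}\Omega_{ji}^ks_i^{kc_{ij}}e_i^{1-c_{ij}-k}e_je_i^k=0$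 and the same with $e_i^{1-c_{ij}-k}e_je_i^k$ replaced by $f_i^kf_jf_i^{1-c_{ij}-k}$. Coproduct: $\omega_i,\omega_i',\gamma,\gamma',D,D'$ group-like, $\Delta(e_i)=e_i\otimes1+\omega_i\otimes e_i$, $\Delta(f_i)=1\otimes f_i+f_i\otimes\omega'_i$. **Modules.** For nonzero $a,b$, put $c=rs\cdot ab$ (so $c=1$ when $ab=(rs)^{-1}$). For an indeterminate $u$, $\rho_u^{a,b}$ is the action on $V(u)=V\otimes_{\mathbb C}\mathbb C[u,u^{-1}]$ given by: $e_i=E_{i,i+1}-E_{(i+1)',i'}$, $f_i=E_{i+1,i}-(rs)^{-1}E_{i',(i+1)'}$ ($1\le i<n$); $e_n=E_{nn'}$, $f_n=(rs)^{-1}E_{n'n}$; $e_0=au\,E_{1'1}$, $f_0=bu^{-1}E_{11'}$; with $\varepsilon_{k'}:=-\varepsilon_k$ ($k\le n$), $\omega_iv_k=\kappa_i\,r^{\langle\varepsilon_k,\alpha_i\rangle}s^{-\langle\alpha_i,\varepsilon_k\rangle}v_k$ and $\omega_i'v_k=\kappa_i\,r^{-\langle\alpha_i,\varepsilon_k\rangle}s^{\langle\varepsilon_k,\alpha_i\rangle}v_k$ (all exponents are integers), where $\kappa_0=c$ and $\kappa_i=1$ for $i\ge1$; $\gamma=\gamma'=c\,\mathrm{Id}$; $D(x\otimes u^k)=r_0^k\,x\otimes u^k$, $D'(x\otimes u^k)=s_0^k\,x\otimes u^k$. $\rho^{a,b}_v$ is the same with an independent indeterminate $v$; $V(u)\otimes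 V(v)$ and $V(v)\otimes V(u)$ are both identified with $V\otimes V\otimes\mathbb C[u^{\pm1},v^{\pm1}]$, so that $\hat R(u/v)$ maps the former to the latter. *)

(* Defs.v *)
From HB Require Import structures.
From mathcomp Require Import all_boot all_order all_algebra fraction.
From mathcomp Require Import boolp reals complex mxtens finmap monalg.

Set Implicit Arguments.
Unset Strict Implicit.
Unset Printing Implicit Defensive.

Import Order.TTheory GRing.Theory Num.Theory.
Local Open Scope ring_scope.
Local Open Scope quotient_scope.

(** * Associative algebras given by generators and relations *)

Definition freeAlg (K : fieldType) (G : choiceType) : Type :=
  {malg K[{fmonom G}]}.
HB.instance Definition _ (K : fieldType) (G : choiceType) :=
  GRing.Lalgebra.on (freeAlg K G).

Definition freeGen (K : fieldType) (G : choiceType) (g : G) : freeAlg K G :=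
  << fmu g >>.

Section Presented.

Context {K : fieldType} {G : choiceType}.
Variable rel : freeAlg K G -> freeAlg K G -> Prop.

(* two-sided ideal generated by the differences x - y with rel x y *)
Inductive relIdeal : freeAlg K G -> Prop :=
| relIdeal_gen x y of rel x y : relIdeal (x - y)
| relIdeal0 : relIdeal 0
| relIdealD x y of relIdeal x & relIdeal y : relIdeal (x + y)
| relIdealM a x b of relIdeal x : relIdeal (a * x * b).

Lemma relIdealN x : relIdeal x -> relIdeal (- x).
Proof. by move=> /(relIdealM (-1) 1); rewrite mulN1r mulr1. Qed.

Lemma relIdealZ c x : relIdeal x -> relIdeal (c *: x).
Proof. by move=> /(relIdealM (c%:A) 1); rewrite mulr1 mulr_algl. Qed.

Definition presEq (x y : freeAlg K G) : bool := `[< relIdeal (x - y) >].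

Lemma presEq_equiv : equiv_class_of presEq.
Proof.
split=> [x|x y|y x z].
- by apply/asboolP; rewrite subrr; exact: relIdeal0.
- by apply/asboolP/asboolP => /relIdealN; rewrite opprB.
- move=> /asboolP xy /asboolP yz; apply/asboolP.
  by rewrite -[x](subrK y) -addrA; exact: relIdealD.
Qed.

Canonical presEq_equivRel := EquivRelPack presEq_equiv.

Definition presAlg : Type := {eq_quot presEq_equivRel}.

HB.instance Definition _ := Choice.on presAlg.

Definition presPi (x : freeAlg K G) : presAlg := \pi_({eq_quot presEq_equivRel}) x.
Definition presRepr (x : presAlg) : freeAlg K G :=
  repr (x : {eq_quot presEq_equivRel}).

Lemma presReprK : cancel presRepr presPi.
Proof. exact: reprK. Qed.

Lemma presPiP x y : presPi x = presPi y <-> relIdeal (x - y).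
Proof.
split=> [/eqP|xy]; first by rewrite eqmodE => /asboolP.
by apply/eqP; rewrite eqmodE; apply/asboolP.
Qed.

Lemma presPiK x : relIdeal (presRepr (presPi x) - x).
Proof. by apply/presPiP; rewrite presReprK. Qed.

Definition presZero : presAlg := presPi 0.
Definition presOne : presAlg := presPi 1.
Definition presOpp (x : presAlg) : presAlg := presPi (- presRepr x).
Definition presAdd (x y : presAlg) : presAlg :=
  presPi (presRepr x + presRepr y).
Definition presMul (x y : presAlg) : presAlg :=
  presPi (presRepr x * presRepr y).
Definition presScale (c : K) (x : presAlg) : presAlg :=
  presPi (c *: presRepr x).

Lemma presPiN x : presOpp (presPi x) = presPi (- x).
Proof. by apply/presPiP; rewrite -opprD; exact/relIdealN/presPiK. Qed.

Lemma presPiD x y : presAdd (presPi x) (presPi y) = presPi (x + y).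
Proof.
by apply/presPiP; rewrite opprD addrACA; apply: relIdealD; exact: presPiK.
Qed.

Lemma presPiM x y : presMul (presPi x) (presPi y) = presPi (x * y).
Proof.
apply/presPiP; set x' := presRepr _; set y' := presRepr _.
have -> : x' * y' - x * y = 1 * (x' - x) * y' + x * (y' - y) * 1.
  by rewrite mul1r mulr1 mulrBl mulrBr addrA subrK.
by apply: relIdealD; apply: relIdealM; exact: presPiK.
Qed.

Lemma presPiZ c x : presScale c (presPi x) = presPi (c *: x).
Proof. by apply/presPiP; rewrite -scalerBr; exact/relIdealZ/presPiK. Qed.

Lemma presInd (P : presAlg -> Prop) :
  (forall x, P (presPi x)) -> forall x, P x.
Proof. by move=> HP x; rewrite -[x]presReprK. Qed.

Fact presAddA : associative presAdd.
Proof.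
by elim/presInd => x; elim/presInd => y; elim/presInd => z; rewrite !presPiD addrA.
Qed.
Fact presAddC : commutative presAdd.
Proof. by elim/presInd => x; elim/presInd => y; rewrite !presPiD addrC. Qed.
Fact presAdd0 : left_id presZero presAdd.
Proof. by elim/presInd => x; rewrite presPiD add0r. Qed.
Fact presAddN : left_inverse presZero presOpp presAdd.
Proof. by elim/presInd => x; rewrite presPiN presPiD addNr. Qed.

HB.instance Definition _ :=
  GRing.isZmodule.Build presAlg presAddA presAddC presAdd0 presAddN.

Fact presMulA : associative presMul.
Proof.
by elim/presInd => x; elim/presInd => y; elim/presInd => z; rewrite !presPiM mulrA.
Qed.
Fact presMul1 : left_id presOne presMul.
Proof. by elim/presInd => x; rewrite presPiM mul1r. Qed.
Fact presMulr1 : right_id presOne presMul.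
Proof. by elim/presInd => x; rewrite presPiM mulr1. Qed.
Fact presMulDl : left_distributive presMul presAdd.
Proof.
by elim/presInd => x; elim/presInd => y; elim/presInd => z;
  rewrite !(presPiM, presPiD) mulrDl.
Qed.
Fact presMulDr : right_distributive presMul presAdd.
Proof.
by elim/presInd => x; elim/presInd => y; elim/presInd => z;
  rewrite !(presPiM, presPiD) mulrDr.
Qed.

HB.instance Definition _ := GRing.Zmodule_isPzRing.Build presAlg
  presMulA presMul1 presMulr1 presMulDl presMulDr.

Fact presScaleA a b x : presScale a (presScale b x) = presScale (a * b) x.
Proof. by elim/presInd: x => x; rewrite !presPiZ scalerA. Qed.
Fact presScale1 : left_id 1 presScale.
Proof. by elim/presInd => x; rewrite presPiZ scale1r. Qed.
Fact presScaleDr : right_distributive presScale +%R.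
Proof.
by move=> c; elim/presInd => x; elim/presInd => y;
  rewrite /GRing.add /= !(presPiZ, presPiD) scalerDr.
Qed.
Fact presScaleDl x : {morph presScale^~ x : a b / a + b}.
Proof.
by move=> a b; elim/presInd: x => x;
  rewrite /(@GRing.add presAlg) /= !(presPiZ, presPiD) scalerDl.
Qed.

HB.instance Definition _ := GRing.Zmodule_isLmodule.Build K presAlg
  presScaleA presScale1 presScaleDr presScaleDl.

End Presented.

(** * Linear extension and actions *)

Definition linext (K : fieldType) (X : choiceType) (W : lmodType K)
    (f : X -> W) (x : {malg K[X]}) : W :=
  \sum_(k <- msupp x) x@_k *: f k.

Definition tens (K : fieldType) (X Y Z : choiceType) (h : X -> Y -> Z)
    (x : {malg K[X]}) (y : {malg K[Y]}) : {malg K[Z]} :=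
  linext (fun p => linext (fun q => << h p q >>) y) x.

Section PresAction.

Context {K : fieldType} {G : choiceType} (rel : freeAlg K G -> freeAlg K G -> Prop).
Context {W : lmodType K} (T : G -> W -> W).

Definition freeAct (x : freeAlg K G) (w : W) : W :=
  linext (fun m : {fmonom G} => foldr T w m) x.

(* Independent of the representative when the operators T g satisfy the
   relations: see presActP *)
Definition presAct (x : presAlg rel) (w : W) : W := freeAct (presRepr x) w.

End PresAction.

(** * Root data of type C_n, with one-based indices *)

Section RootData.

Variable n : nat.

Definition eps (k : nat) : 'rV[int]_n := \row_(j < n) (j.+1 == k)%:R.

Definition alpha (i : nat) : 'rV[int]_n :=
  if i == 0%N then - (eps 1 *+ 2)
  else if i == n then eps n *+ 2
  else eps i - eps i.+1.

Definition theta_mult (i : nat) : nat := if i == n then 1 else 2.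

Definition ip (x y : 'rV[int]_n) : int := \sum_(j < n) x 0 j * y 0 j.

(* 2 <x, y>; thus r^<x,y> is rh ^ dbr x y, where rh is the square root of r *)
Definition dbr (x y : 'rV[int]_n) : int :=
  \sum_(i < n) \sum_(j < n) (if (j <= i)%N then 1 else -1) * x 0 i * y 0 j.

(* the quotient is exact *)
Definition cartan (i j : nat) : int :=
  (2 * ip (alpha i) (alpha j) %/ ip (alpha i) (alpha i))%Z.

Definition primed (i : nat) : nat := ((2 * n).+1 - i)%N.

Definition epsV (k : nat) : 'rV[int]_n :=
  if (k <= n)%N then eps k else - eps (primed k).

End RootData.

(** * The algebra U_{r,s} of the affine algebra of sp_2n *)

Definition qint (K : fieldType) (r s : K) (m : nat) : K :=
  (r ^+ m - s ^+ m) / (r - s).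
Definition qfact (K : fieldType) (r s : K) (m : nat) : K :=
  \prod_(1 <= k < m.+1) qint r s k.
Definition qbinom (K : fieldType) (r s : K) (m k : nat) : K :=
  qfact r s m / (qfact r s (m - k) * qfact r s k).

Inductive torusGen (n : nat) : Type :=
| t_w of 'I_n.+1
| t_w' of 'I_n.+1
| t_g
| t_g'
| t_D
| t_D'.

Inductive Ugen (n : nat) : Type :=
| gen_e of 'I_n.+1
| gen_f of 'I_n.+1
| gen_t of torusGen n
| gen_tV of torusGen n.

Arguments t_g {n}.
Arguments t_g' {n}.
Arguments t_D {n}.
Arguments t_D' {n}.

HB.instance Definition _ n := gen_eqMixin (Ugen n).
HB.instance Definition _ n := gen_choiceMixin (Ugen n).

Section QuantumAffine.

(* rh and sh stand for r^(1/2) and s^(1/2) *)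
Context {K : fieldType} (n : nat) (rh sh : K).

Definition rr (i : nat) : K := rh ^ ip (alpha n i) (alpha n i).
Definition ss (i : nat) : K := sh ^ ip (alpha n i) (alpha n i).

Definition Om (i j : nat) : K :=
  rh ^ dbr (alpha n i) (alpha n j) * sh ^ (- dbr (alpha n j) (alpha n i)).

Definition serreDeg (i j : nat) : nat := `|1 - cartan n i j|%N.

Definition serreCoef (i j k : nat) : K :=
  (-1) ^+ k * qbinom (rr i) (ss i) (serreDeg i j) k
  * (rr i * ss i) ^+ 'C(k, 2) * Om j i ^+ k * ss i ^ (k%:Z * cartan n i j).

Local Notation F := (freeAlg K (Ugen n)).
Let e (i : 'I_n.+1) : F := freeGen K (gen_e i).
Let f (i : 'I_n.+1) : F := freeGen K (gen_f i).
Let t (x : torusGen n) : F := freeGen K (gen_t x).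
Let tV (x : torusGen n) : F := freeGen K (gen_tV x).
Let w (i : 'I_n.+1) : F := t (t_w i).
Let w' (i : 'I_n.+1) : F := t (t_w' i).
Let D : F := t t_D.
Let DV : F := tV t_D.
Let D' : F := t t_D'.
Let D'V : F := tV t_D'.

Inductive Urel : F -> F -> Prop :=
| Urel_invr x : Urel (t x * tV x) 1
| Urel_invl x : Urel (tV x * t x) 1
| Urel_comm x y : Urel (t x * t y) (t y * t x)
| Urel_De i : Urel (D * e i * DV) (rr i ^+ (i == ord0) *: e i)
| Urel_Df i : Urel (D * f i * DV) (rr i ^- (i == ord0) *: f i)
| Urel_D'e i : Urel (D' * e i * D'V) (ss i ^+ (i == ord0) *: e i)
| Urel_D'f i : Urel (D' * f i * D'V) (ss i ^- (i == ord0) *: f i)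
| Urel_g : Urel (t t_g)
    (w ord0 * \prod_(i < n.+1 | i != ord0) w i ^+ theta_mult n i)
| Urel_g' : Urel (t t_g')
    (w' ord0 * \prod_(i < n.+1 | i != ord0) w' i ^+ theta_mult n i)
| Urel_gC x : Urel (t t_g * freeGen K x) (freeGen K x * t t_g)
| Urel_g'C x : Urel (t t_g' * freeGen K x) (freeGen K x * t t_g')
| Urel_we i j : Urel (w i * e j) (Om j i *: (e j * w i))
| Urel_wf i j : Urel (w i * f j) ((Om j i)^-1 *: (f j * w i))
| Urel_w'e i j : Urel (w' i * e j) ((Om i j)^-1 *: (e j * w' i))
| Urel_w'f i j : Urel (w' i * f j) (Om i j *: (f j * w' i))
| Urel_ef (i j : 'I_n.+1) : Urel (e i * f j - f j * e i)
    ((i == j)%:R *: ((rr i - ss i)^-1 *: (w i - w' i)))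
| Urel_serre_e (i j : 'I_n.+1) of i != j : Urel
    (\sum_(k < (serreDeg i j).+1)
       serreCoef i j k *: (e i ^+ (serreDeg i j - k) * e j * e i ^+ k)) 0
| Urel_serre_f (i j : 'I_n.+1) of i != j : Urel
    (\sum_(k < (serreDeg i j).+1)
       serreCoef i j k *: (f i ^+ k * f j * f i ^+ (serreDeg i j - k))) 0.

Definition Urs : Type := presAlg Urel.
HB.instance Definition _ := GRing.PzRing.on Urs.
HB.instance Definition _ := GRing.Lmodule.on Urs.

Definition Ugenerator (x : Ugen n) : Urs := presPi Urel (freeGen K x).

Definition coproductGen (x : Ugen n) : seq (Urs * Urs) :=
  let X := Ugenerator x in
  match x with
  | gen_e i => [:: (X, 1); (Ugenerator (gen_t (t_w i)), X)]
  | gen_f i => [:: (1, X); (X, Ugenerator (gen_t (t_w' i)))]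
  | gen_t _ | gen_tV _ => [:: (X, X)]
  end.

(* coproduct x l: the formal sum of the y.1 (x) y.2, for y in l, represents the
   image of x under the algebra morphism Delta : U -> U (x) U; see
   coproduct_total *)
Inductive coproduct : Urs -> seq (Urs * Urs) -> Prop :=
| coproduct_gen x : coproduct (Ugenerator x) (coproductGen x)
| coproduct1 : coproduct 1 [:: (1, 1)]
| coproductZ c x l of coproduct x l :
    coproduct (c *: x) [seq (c *: y.1, y.2) | y <- l]
| coproductD x x' l l' of coproduct x l & coproduct x' l' :
    coproduct (x + x') (l ++ l')
| coproductM x x' l l' of coproduct x l & coproduct x' l' :
    coproduct (x * x') [seq (y.1 * y'.1, y.2 * y'.2) | y <- l, y' <- l'].

(** * The modules V(u) *)

(* V(u) has the basis v_i u^k, encoded as (i - 1, k); one-based indices are used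
   everywhere else *)
Definition Vaff : lmodType K := {malg K['I_(2 * n) * int : Type]}.

(* the matrix unit E_ij *)
Definition E (R : pzRingType) (i j : nat) : 'M[R]_(2 * n) :=
  \matrix_(a, b) ((a.+1 == i) && (b.+1 == j))%:R.

(* the operator M u^d *)
Definition mxop (M : 'M[K]_(2 * n)) (d : int) : Vaff -> Vaff :=
  linext (fun p => \sum_i << M i p.1 *g (i, p.2 + d) >>).

(* x u^k |-> q^k x u^k *)
Definition degop (q : K) : Vaff -> Vaff :=
  linext (fun p => << q ^ p.2 *g p >>).

(* V (x) V (x) K[u^(+-1), v^(+-1)], with the basis v_i (x) v_j u^k v^l encoded as
   ((i - 1, j - 1), (k, l)) *)
Definition V2aff : lmodType K :=
  {malg K[('I_(2 * n) * 'I_(2 * n)) * (int * int) : Type]}.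

(* A (x) B on V(u) (x) V(v) *)
Definition tensUV (A B : Vaff -> Vaff) : V2aff -> V2aff :=
  linext (fun p : ('I_(2 * n) * 'I_(2 * n)) * (int * int) =>
    tens (fun x y => ((x.1, y.1), (x.2, y.2)))
      (A << (p.1.1, p.2.1) >>) (B << (p.1.2, p.2.2) >>)).

(* A (x) B on V(v) (x) V(u): the first factor carries the powers of v *)
Definition tensVU (A B : Vaff -> Vaff) : V2aff -> V2aff :=
  linext (fun p : ('I_(2 * n) * 'I_(2 * n)) * (int * int) =>
    tens (fun x y => ((x.1, y.1), (y.2, x.2)))
      (A << (p.1.1, p.2.2) >>) (B << (p.1.2, p.2.1) >>)).

Section Rho.

Variables a b : K.

Let cc : K := rh ^+ 2 * sh ^+ 2 * (a * b).
Let kappa (i : nat) : K := if i == 0%N then cc else 1.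

Definition mx_e (i : nat) : 'M[K]_(2 * n) :=
  if i == 0%N then a *: E K (primed n 1) 1
  else if i == n then E K n (primed n n)
  else E K i i.+1 - E K (primed n i.+1) (primed n i).

Definition mx_f (i : nat) : 'M[K]_(2 * n) :=
  if i == 0%N then b *: E K 1 (primed n 1)
  else if i == n then (rh ^+ 2 * sh ^+ 2)^-1 *: E K (primed n n) n
  else E K i.+1 i
       - (rh ^+ 2 * sh ^+ 2)^-1 *: E K (primed n i) (primed n i.+1).

Definition val_w (i k : nat) : K :=
  kappa i * rh ^ dbr (epsV n k) (alpha n i)
  * sh ^ (- dbr (alpha n i) (epsV n k)).

Definition val_w' (i k : nat) : K :=
  kappa i * rh ^ (- dbr (alpha n i) (epsV n k))
  * sh ^ dbr (epsV n k) (alpha n i).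

Definition torusop (x : torusGen n) : Vaff -> Vaff :=
  match x with
  | t_w i => mxop (diag_mx (\row_k val_w i k.+1)) 0
  | t_w' i => mxop (diag_mx (\row_k val_w' i k.+1)) 0
  | t_g | t_g' => mxop cc%:M 0
  | t_D => degop (rr 0)
  | t_D' => degop (ss 0)
  end.

Definition torusopV (x : torusGen n) : Vaff -> Vaff :=
  match x with
  | t_w i => mxop (diag_mx (\row_k (val_w i k.+1)^-1)) 0
  | t_w' i => mxop (diag_mx (\row_k (val_w' i k.+1)^-1)) 0
  | t_g | t_g' => mxop cc^-1%:M 0
  | t_D => degop (rr 0)^-1
  | t_D' => degop (ss 0)^-1
  end.

Definition genop (x : Ugen n) : Vaff -> Vaff :=
  match x with
  | gen_e i => mxop (mx_e i) (i == ord0)%:R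
  | gen_f i => mxop (mx_f i) (- (i == ord0)%:R)
  | gen_t y => torusop y
  | gen_tV y => torusopV y
  end.

Definition rho (x : Urs) : Vaff -> Vaff := presAct genop x.

End Rho.

(* (rho_u (x) rho_v)(x) and (rho_v (x) rho_u)(x), where l represents Delta(x) *)
Definition rhoUV (a b : K) (l : seq (Urs * Urs)) (m : V2aff) : V2aff :=
  \sum_(y <- l) tensUV (rho a b y.1) (rho a b y.2) m.
Definition rhoVU (a b : K) (l : seq (Urs * Urs)) (m : V2aff) : V2aff :=
  \sum_(y <- l) tensVU (rho a b y.1) (rho a b y.2) m.

(** * The R-matrix *)

Definition sigma (i : nat) : int := if (i <= n)%N then 1 else -1.

Definition tt_ (i : nat) : K :=
  if (i <= n)%N then sh ^ (2 * (i%:Z - n%:Z - 1))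
  else - rh ^ (2 * (n%:Z - i%:Z)).

Definition xi : K := rh ^ (- 2 * (n%:Z + 1)) * sh ^ (2 * (n%:Z + 1)).

(* r^-1 s *)
Definition qq : K := rh ^- 2 * sh ^+ 2.

Notation z := ('X : {poly K}).

(* for j <> i, i' the second branch is the case j < i < j' or j' < i < j *)
Definition acoef (i j : nat) : {poly K} :=
  (rh^-1 * sh
   * (rh * sh) ^ (if ((i < j) && (i < primed n j))%N
                     || ((j < i) && (primed n j < i))%N
                  then - (sigma i * sigma j) else sigma i * sigma j))
  *: ((z - 1) * (z - xi%:P)).

Definition bcoef (i j : nat) : {poly K} :=
  let dl : {poly K} := (i == primed n j)%:R in
  if i == j then (qq *: z - xi%:P) * (z - 1)
  else if (i < j)%N then
    (qq - 1) *: ((xi * tt_ i / tt_ j) *: (z - 1) - dl * (z - xi%:P))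
  else
    (qq - 1) *: (z * ((tt_ i / tt_ j) *: (z - 1) - dl * (z - xi%:P))).

Local Notation N := (2 * n)%N.
Local Notation EP := (E {poly K}).

Definition Rhat : 'M[{poly K}]_(N * N) :=
  ((z - qq%:P) * (z - xi%:P)) *: (\sum_(1 <= i < N.+1) EP i i *t EP i i)
  + \sum_(1 <= i < N.+1) \sum_(1 <= j < N.+1 | (j != i) && (j != primed n i))
      acoef i j *: (EP i j *t EP j i)
  + ((1 - qq) *: (z - xi%:P)) *:
      (\sum_(1 <= i < N.+1) \sum_(1 <= j < N.+1 | (j < i)%N && (j != primed n i))
         EP i i *t EP j j)
  + ((1 - qq) *: (z * (z - xi%:P))) *:
      (\sum_(1 <= i < N.+1) \sum_(1 <= j < N.+1 | (i < j)%N && (j != primed n i))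
         EP i i *t EP j j)
  + \sum_(1 <= i < N.+1) \sum_(1 <= j < N.+1)
      bcoef i j *: (EP (primed n i) j *t EP i (primed n j)).

(* R^(u/v) on V (x) V (x) K[u^(+-1), v^(+-1)] *)
Definition RhatUV : V2aff -> V2aff :=
  linext (fun p => \sum_i \sum_j
    let c := Rhat (mxtens_index (i, j)) (mxtens_index p.1) in
    \sum_(d < size c) << c`_d *g ((i, j), (p.2.1 + d%:Z, p.2.2 - d%:Z)) >>).

Section Spectral.

Context {L : comNzRingType} (phi : K -> L).

Definition RhatAt (x : L) : 'M[L]_(N * N) :=
  map_mx (fun p : {poly K} => (map_poly phi p).[x]) Rhat.

Definition flip : 'M[L]_(N * N) :=
  \matrix_(p, q)
    (mxtens_unindex p == ((mxtens_unindex q).2, (mxtens_unindex q).1))%:R.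

Definition Rmx (x : L) : 'M[L]_(N * N) := RhatAt x *m flip.

Definition on12 (M : 'M[L]_(N * N)) : 'M[L]_(N * N * N) := M *t (1%:M : 'M_N).
Definition on23 (M : 'M[L]_(N * N)) : 'M[L]_(N * N * N) :=
  castmx (mulnA N N N, mulnA N N N) ((1%:M : 'M_N) *t M).

Definition R12 (x : L) := on12 (Rmx x).
Definition R23 (x : L) := on23 (Rmx x).
Definition R13 (x : L) := on23 flip *m R12 x *m on23 flip.

End Spectral.

End QuantumAffine.

(* Main.v *)
(** Each generator e_i (resp. f_i) sends v_k to a multiple of its neighbour on the
    single cycle v_2n -> v_(2n-1) -> ... -> v_1 -> v_2n (resp. the reversed cycle),
    so the defining relations reduce to scalar identities on basis vectors. In the
    Serre relations every monomial acts by zero on its own: the labels i met along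
    the cycle form a walk back and forth through the affine Dynkin diagram, which
    turns round only at its two ends.

    The R-matrix is made homogeneous in (u, v) and acts on row covectors, i.e. on
    functions of pairs of indices. That it intertwines e_i is checked entry by
    entry; f_i follows from e_i by the symmetry (r, s) -> (s^-1, r^-1) combined
    with the reversal v_k -> v_k' and the exchange of the two tensor factors.

    For the Yang-Baxter equation, let D be the difference of the two sides in braid
    form. D intertwines the action on triple tensor products. The coefficients of D
    at w^m v^l are treated by induction on (m, l): modulo the previous ones, e_0 only
    moves the first factor, and D vanishes on v_1 v_1 v_1, v_1 v_2 v_1 and
    v_2 v_1 v_1, where it involves only a six-vertex block; from there the
    intertwining relations for the e_i and f_i spread the vanishing to all basis
    vectors. *)
Require Import Defs.
From mathcomp Require Import all_boot all_order all_algebra fraction.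
From mathcomp Require Import reals complex.
From mathcomp Require Import boolp mxtens finmap monalg.
From mathcomp Require Import zify ring lra.

Set Implicit Arguments.
Unset Strict Implicit.
Unset Printing Implicit Defensive.

Import GRing.Theory.
Local Open Scope ring_scope.

(** * The R-matrix on row vectors *)

(** Irreducibility of the triple tensor product is never invoked; the coefficient induction takes
    its place. That [D f a b c] is zero for every functional [f] says that [D] kills v_a v_b v_c.
    Since [f] is arbitrary, the source side of an intertwining relation, which only replaces [f] by
    another functional, vanishes along with it, and a linear relation between the values of [D f] at
    neighbouring basis vectors remains. To read off coefficients, v and w must be polynomial
    variables and u a nonzero constant; the homogeneous form keeps R free of denominators in them,
    and other parameters follow by specialisation.

    The base vectors are chosen because of the third factor v_1. Among the f_i with i > 0 only f_1
    moves it, and the label 1 sits on two edges of the path v_1, ..., v_2n, the first and the last.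
    Spreading along the second factor is blocked there. So v_1 v_2 v_1 is put in for the first edge,
    while v_2 v_1 v_1, used in the e_0 relation one degree higher in v, yields v_2 v_2n v_1 for the
    last. *)

(* e_i v_k is a multiple of v_(e_idx k), and f_i v_k one of v_(f_idx k), whatever i. *)
Definition e_idx (n k : nat) : nat := if k == 1%N then (2 * n)%N else k.-1.
Definition f_idx (n k : nat) : nat := if k == (2 * n)%N then 1%N else k.+1.
Definition in_range (n k : nat) := ((1 <= k) && (k <= 2 * n))%N.

Section Rrow.
Context {K : fieldType} (n : nat) (rh sh : K).

Definition a_scal (i j : nat) : K :=
  rh^-1 * sh * (rh * sh) ^ (if ((i < j) && (i < primed n j))%N
                     || ((j < i) && (primed n j < i))%N
                  then - (sigma n i * sigma n j) else sigma n i * sigma n j).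

Context {A : comNzRingType} (phi : K -> A) (x y : A).

(* y^2 b_ij(x/y) *)
Definition b_hom (i j : nat) : A :=
  if i == j then (phi (qq rh sh) * x - phi (xi n rh sh) * y) * (x - y)
  else if (i < j)%N then
    phi (qq rh sh - 1) * (y * (phi (xi n rh sh * tt_ n rh sh i / tt_ n rh sh j) * (x - y)
        - (i == primed n j)%:R * (x - phi (xi n rh sh) * y)))
  else
    phi (qq rh sh - 1) * (x * (phi (tt_ n rh sh i / tt_ n rh sh j) * (x - y)
        - (i == primed n j)%:R * (x - phi (xi n rh sh) * y))).

(* y^2 R^(x/y) acting on the row vector lam, whose entries are indexed by pairs in
   1..2n; the values outside this range are junk. The map phi embeds the scalars. *)
Definition Rrow (lam : nat -> nat -> A) (k l : nat) : A :=
  if l == primed n k then \sum_(1 <= i < (2 * n).+1) b_hom i k * lam (primed n i) i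
  else if k == l then
    (x - phi (qq rh sh) * y) * (x - phi (xi n rh sh) * y) * lam k k
  else phi (1 - qq rh sh) * ((if (l < k)%N then y else x)
       * (x - phi (xi n rh sh) * y)) * lam k l
     + phi (a_scal l k) * ((x - y) * (x - phi (xi n rh sh) * y)) * lam l k.

End Rrow.

Section Gens.
Context {K : fieldType} (n : nat) (rh sh : K).

(* e_i v_k = e_coef i k v_(e_idx k), up to the factor a u of e_0; likewise f_coef, up
   to the factors b u^-1 of f_0 and (rs)^-1 of f_n. *)
Definition e_coef (i k : nat) : K :=
  if i == 0%N then (k == 1%N)%:R
  else if i == n then (k == n.+1)%:R
  else (k == i.+1)%:R - (k == primed n i)%:R.

Definition w_wt (i k : nat) : K :=
  rh ^ dbr (epsV n k) (alpha n i) * sh ^ (- dbr (alpha n i) (epsV n k)).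
Definition w'_wt (i k : nat) : K :=
  rh ^ (- dbr (alpha n i) (epsV n k)) * sh ^ dbr (epsV n k) (alpha n i).

Definition f_coef (i k : nat) : K :=
  if i == 0%N then (k == (2 * n)%N)%:R
  else if i == n then (k == n)%:R
  else (k == i)%:R - (rh ^+ 2 * sh ^+ 2)^-1 * (k == primed n i.+1)%:R.

Context {A : comNzRingType} (phi : K -> A).

(* The power of the spectral parameter carried by e_i. *)
Definition spec (i : nat) (x : A) : A := if i == 0%N then x else 1.

(* Delta(e_i) on row vectors, the two factors carrying x and y. In Frow they carry y
   and x, and the operator of f_0 is multiplied by x y. *)
Definition Erow (i : nat) (x y : A) (lam : nat -> nat -> A) (k l : nat) : A :=
  spec i x * phi (e_coef i k) * lam (e_idx n k) l
  + spec i y * phi (w_wt i k) * phi (e_coef i l) * lam k (e_idx n l).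

Definition Frow (i : nat) (x y : A) (lam : nat -> nat -> A) (k l : nat) : A :=
  spec i x * phi (f_coef i k) * phi (w'_wt i l) * lam (f_idx n k) l
  + spec i y * phi (f_coef i l) * lam k (f_idx n l).
End Gens.

(** * Weights of the basis vectors and ratios of the t_i *)

Section Weights.
Variable n : nat.
Implicit Types x y z : 'rV[int]_n.

Lemma dbrDl x y z : dbr (x + y) z = dbr x z + dbr y z.
Proof.
rewrite /dbr -big_split; apply: eq_bigr => i _; rewrite -big_split.
by apply: eq_bigr => j _; rewrite mxE mulrDr mulrDl.
Qed.
Lemma dbrDr x y z : dbr x (y + z) = dbr x y + dbr x z.
Proof.
rewrite /dbr -big_split; apply: eq_bigr => i _; rewrite -big_split.
by apply: eq_bigr => j _; rewrite mxE mulrDr.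
Qed.
Lemma dbrNl x z : dbr (- x) z = - dbr x z.
Proof.
rewrite /dbr -sumrN; apply: eq_bigr => i _; rewrite -sumrN.
by apply: eq_bigr => j _; rewrite mxE mulrN mulNr.
Qed.
Lemma dbrNr x z : dbr x (- z) = - dbr x z.
Proof.
rewrite /dbr -sumrN; apply: eq_bigr => i _; rewrite -sumrN.
by apply: eq_bigr => j _; rewrite mxE mulrN.
Qed.

Lemma dbr0l x : dbr 0 x = 0.
Proof. by apply: (addrI (dbr 0 x)); rewrite -dbrDl !addr0. Qed.
Lemma dbr0r x : dbr x 0 = 0.
Proof. by apply: (addrI (dbr x 0)); rewrite -dbrDr !addr0. Qed.

Lemma dbr_eps a b : (1 <= a <= n)%N -> (1 <= b <= n)%N ->
  dbr (eps n a) (eps n b) = if (b <= a)%N then 1 else -1.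
Proof.
move=> /andP[a1 an] /andP[b1 bn].
have ha : (a.-1 < n)%N by lia.
have hb : (b.-1 < n)%N by lia.
rewrite /dbr (bigD1 (Ordinal ha)) //= [X in _ + X]big1 => [|i /eqP hi].
  rewrite addr0 (bigD1 (Ordinal hb)) //= [X in _ + X]big1 => [|j /eqP hj].
    rewrite !mxE /= !prednK // !eqxx !mulr1 addr0.
    by have -> : (b.-1 <= a.-1)%N = (b <= a)%N by lia.
  rewrite [X in _ * X]mxE.
  have -> : (j.+1 == b) = false.
    by apply/eqP => hjb; apply: hj; apply/val_inj => /=; lia.
  by rewrite mulr0.
rewrite big1 // => j _; rewrite !mxE.
have -> : (i.+1 == a) = false.
  by apply/eqP => hia; apply: hi; apply/val_inj => /=; lia.
by rewrite mulr0 mul0r.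
Qed.
End Weights.

Lemma primedK n k : in_range n k -> primed n (primed n k) = k.
Proof. rewrite /in_range /primed; lia. Qed.

Lemma epsV_primed n k : in_range n k -> epsV n (primed n k) = - epsV n k.
Proof.
move=> hk; rewrite /epsV primedK //.
have -> : (primed n k <= n)%N = ~~ (k <= n)%N by move: hk; rewrite /in_range /primed; lia.
by case: (k <= n)%N => //=; rewrite opprK.
Qed.

Section WeightValues.
Context {K : fieldType} (n : nat) (rh sh : K).
Hypotheses (rh0 : rh != 0) (sh0 : sh != 0).
Local Notation wv := (w_wt n rh sh).
Local Notation wv' := (w'_wt n rh sh).

(** v_k' has the weight opposite to that of v_k. This cuts each table of values below down to k at
    most n. *)
Lemma w_wt_primed i k : in_range n k -> wv i (primed n k) = (wv i k)^-1.
Proof.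
move=> hk; rewrite /wv epsV_primed // dbrNl dbrNr.
by rewrite invfM !invr_expz.
Qed.

Lemma w'_wt_primed i k : in_range n k -> wv' i (primed n k) = (wv' i k)^-1.
Proof.
move=> hk; rewrite /wv' epsV_primed // dbrNl dbrNr.
by rewrite invfM !invr_expz.
Qed.

Lemma w_wt_neq0 i k : wv i k != 0.
Proof. by rewrite /wv mulf_neq0 // expfz_neq0. Qed.
Lemma w'_wt_neq0 i k : wv' i k != 0.
Proof. by rewrite /wv' mulf_neq0 // expfz_neq0. Qed.

Lemma w_wt_mid_le i k : (1 <= i < n)%N -> (1 <= k <= n)%N ->
  wv i k = if k == i then rh ^+ 2 else if k == i.+1 then sh ^+ 2 else 1.
Proof.
move=> /andP[i1 iltn] /andP[k1 kn]; rewrite /wv /epsV kn /alpha.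
have -> : (i == 0)%N = false by lia.
have -> : (i == n)%N = false by lia.
rewrite dbrDr dbrDl dbrNr dbrNl !dbr_eps; try lia.
by case: (leqP i k) => ?; case: (leqP i.+1 k) => ?; case: (leqP k i) => ?;
   case: (leqP k i.+1) => ?; case: (k =P i) => ?; case: (k =P i.+1) => ?;
   try lia; rewrite ?subrr ?oppr0 ?expr0z ?mulr1 ?mul1r.
Qed.

Lemma w_wt_last_le k : (1 <= k <= n)%N ->
  wv n k = if k == n then rh ^+ 2 * sh ^- 2 else rh ^- 2 * sh ^- 2.
Proof.
move=> /andP[k1 kn]; rewrite /wv /epsV kn /alpha.
have -> : (n == 0)%N = false by lia.
rewrite eqxx mulr2n dbrDr dbrDl !dbr_eps; try lia.
rewrite kn; case: (k =P n) => [->|ne]; first by rewrite leqnn.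
by have -> : (n <= k)%N = false by lia.
Qed.

Lemma w_wt_0_le k : (1 <= k <= n)%N ->
  wv 0 k = if k == 1%N then rh ^- 2 * sh ^+ 2 else rh ^- 2 * sh ^- 2.
Proof.
move=> /andP[k1 kn]; rewrite /wv /epsV kn /alpha /=.
rewrite mulr2n dbrNr dbrNl dbrDr dbrDl !dbr_eps; try lia.
rewrite k1; case: (k =P 1%N) => [->|ne]; first by rewrite leqnn.
by have -> : (k <= 1)%N = false by lia.
Qed.

Lemma w_wt_mid i k : (1 <= i < n)%N -> in_range n k ->
  wv i k = if k == i then rh ^+ 2 else if k == i.+1 then sh ^+ 2
    else if k == primed n i.+1 then sh ^- 2
    else if k == primed n i then rh ^- 2 else 1.
Proof.
move=> hi hk; case: (leqP k n) => kn.
  rewrite w_wt_mid_le //; last by move: hk; rewrite /in_range; lia.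
  case: eqP => // _; case: eqP => // _.
  have -> : (k == primed n i) = false by apply/eqP; rewrite /primed; lia.
  by have -> : (k == primed n i.+1) = false by apply/eqP; rewrite /primed; lia.
rewrite -{1}(primedK hk) w_wt_primed; last by move: hk; rewrite /in_range /primed; lia.
rewrite w_wt_mid_le //; last by move: hk; rewrite /in_range /primed; lia.
have -> : (k == i) = false by lia.
have -> : (k == i.+1) = false by lia.
have -> : (primed n k == i) = (k == primed n i).
  by apply/eqP/eqP; move: hk; rewrite /in_range /primed; lia.
have -> : (primed n k == i.+1) = (k == primed n i.+1).
  by apply/eqP/eqP; move: hk; rewrite /in_range /primed; lia.
case: eqP => [->|_].
  by case: eqP => //; rewrite /primed; lia.
by case: eqP => // _; rewrite invr1.
Qed.

Lemma w_wt_last k : in_range n k ->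
  wv n k = if k == n then rh ^+ 2 * sh ^- 2 else if k == n.+1 then rh ^- 2 * sh ^+ 2
    else if (k <= n)%N then rh ^- 2 * sh ^- 2 else rh ^+ 2 * sh ^+ 2.
Proof.
move=> hk; case: (leqP k n) => kn.
  rewrite w_wt_last_le //; last by move: hk; rewrite /in_range; lia.
  by have -> : (k == n.+1) = false by lia.
rewrite -{1}(primedK hk) w_wt_primed; last by move: hk; rewrite /in_range /primed; lia.
rewrite w_wt_last_le //; last by move: hk; rewrite /in_range /primed; lia.
have -> : (k == n) = false by lia.
have -> : (primed n k == n) = (k == n.+1).
  by apply/eqP/eqP; move: hk; rewrite /in_range /primed; lia.
by case: eqP => _; field; rewrite ?rh0 ?sh0 ?oner_eq0.
Qed.

Lemma w_wt_0 k : in_range n k ->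
  wv 0 k = if k == 1%N then rh ^- 2 * sh ^+ 2 else if k == (2 * n)%N then rh ^+ 2 * sh ^- 2
    else if (k <= n)%N then rh ^- 2 * sh ^- 2 else rh ^+ 2 * sh ^+ 2.
Proof.
move=> hk; case: (leqP k n) => kn.
  rewrite w_wt_0_le //; last by move: hk; rewrite /in_range; lia.
  by have -> : (k == 2 * n)%N = false by move: hk; rewrite /in_range; lia.
rewrite -{1}(primedK hk) w_wt_primed; last by move: hk; rewrite /in_range /primed; lia.
rewrite w_wt_0_le //; last by move: hk; rewrite /in_range /primed; lia.
have -> : (k == 1)%N = false by move: hk; rewrite /in_range; lia.
have -> : (primed n k == 1)%N = (k == 2 * n)%N.
  by apply/eqP/eqP; move: hk; rewrite /in_range /primed; lia.
by case: eqP => _; field; rewrite ?rh0 ?sh0 ?oner_eq0.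
Qed.

Local Notation t := (tt_ n rh sh).
Lemma tt_neq0 i : t i != 0.
Proof.
by rewrite /tt_; case: ifP => _; rewrite ?oppr_eq0 expfz_neq0.
Qed.
(** R involves the t_i through quotients only, so the checks for the e_i rest on consecutive ratios:
    s in the first half, r^-1 in the second, -r^-1 s in the middle, and the closing ratio of
    [tt_ends]. *)
Lemma tt_lt i : (i < n)%N -> t i.+1 = sh ^+ 2 * t i.
Proof.
move=> hi; rewrite /tt_ hi (ltnW hi).
rewrite -[sh ^+ 2]/(sh ^ 2%:Z) -expfzDr //; congr (_ ^ _); lia.
Qed.
Lemma tt_gt i : (n < i)%N -> t i.+1 = rh ^- 2 * t i.
Proof.
move=> hi; rewrite /tt_; have -> : (i < n)%N = false by lia.
have -> : (i <= n)%N = false by lia.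
rewrite mulrN -[rh ^- 2]/(rh ^ (- 2%:Z)) -expfzDr //; congr (- (_ ^ _)); lia.
Qed.
Lemma tt_n : t n = sh ^- 2.
Proof.
by rewrite /tt_ leqnn -[sh ^- 2]/(sh ^ (- 2%:Z)); congr (_ ^ _); lia.
Qed.
Lemma tt_n1 : t n.+1 = - rh ^- 2.
Proof.
by rewrite /tt_ ltnn -[rh ^- 2]/(rh ^ (- 2%:Z)); congr (- (_ ^ _)); lia.
Qed.
(** This closes the cycle, and it is how the value of [xi] enters the check for e_0: between v_1 and
    v_2n the factor [xi y] of [b_hom] for [i < j] is traded against the factor [x] for [i > j]. *)
Lemma tt_ends : (1 <= n)%N -> t (2 * n)%N = - rh ^+ 2 * sh ^- 2 * xi n rh sh * t 1%N.
Proof.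
move=> hn; rewrite /tt_ hn /xi; have -> : (2 * n <= n)%N = false by lia.
rewrite -[rh ^+ 2]/(rh ^ 2%:Z) -[sh ^- 2]/(sh ^ (- 2%:Z)).
transitivity (- (rh ^ (2%:Z) * rh ^ (-2 * (n%:Z + 1))) * (sh ^ (-2%:Z) * sh ^ (2 * (n%:Z + 1)) * sh ^ (2 * (1%:Z - n%:Z - 1)))); last by ring.
rewrite -!expfzDr //.
have -> : - 2%:Z + 2 * (n%:Z + 1) + 2 * (1%:Z - n%:Z - 1) = 0 by lia.
rewrite expr0z mulr1; congr (- (_ ^ _)); lia.
Qed.
End WeightValues.

(** The contexts of the entry checks hold many equations between field elements. These and the
    quantified hypotheses are cleared so that [lia] works on natural numbers, and equations between
    field elements are refused at once. *)
Ltac nat_lia := first [assumption|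
  lazymatch goal with
  | |- @eq nat _ _ => idtac | |- @eq bool _ _ => idtac
  | |- @eq _ _ _ => fail | |- _ => idtac end;
  repeat match goal with
  | H : prod _ _ |- _ => clear H
  | H : @eq ?T _ _ |- _ => lazymatch T with nat => fail | _ => clear H end
  | H : is_true (in_range _ _) |- _ => clear H
  | H : is_true (negb (@eq_op (GRing.Field.Exports.GRing_Field__to__eqtype_Equality _) _ _)) |- _ => clear H
  | H : forall _, _ |- _ => clear H
  end; lia].
Ltac decide_nat := repeat match goal with
  | |- context [@eq_op _ ?a ?b] =>
     first [ have -> : (a == b) = false by nat_lia | have -> : (a == b) = true by nat_lia ]
  | |- context [leq ?a ?b] =>
     first [ have -> : (leq a b) = false by nat_lia | have -> : (leq a b) = true by nat_lia ]
  end.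

Ltac nonzero := repeat (apply/andP; split); rewrite ?oppr_eq0 ?oner_eq0 //;
  repeat first [assumption | apply: mulf_neq0 | apply: expf_neq0].

(** * Intertwining of the middle generators e_i, 0 < i < n *)

Section CoreE.
Context {K : fieldType} (n : nat) (rh sh x y : K).
Hypotheses (rh0 : rh != 0) (sh0 : sh != 0) (n2 : (2 <= n)%N).
Local Notation q := (qq rh sh).
Local Notation xi := (xi n rh sh).
Local Notation t := (tt_ n rh sh).
Local Notation asc := (a_scal n rh sh).
Local Notation b := (b_hom n rh sh id x y).
Local Notation R := (Rrow n rh sh id x y).
Local Notation pr := (primed n).
Local Notation E i := (Erow n rh sh id i).

(* The condition under which the coefficient a_ij carries s rather than r^-1. *)
Definition a_scal_cond (i j : nat) : bool :=
  ((((i < j) && (i < pr j)) || ((j < i) && (pr j < i))) != ((i <= n) == (j <= n)))%N.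

Lemma a_scalE i j : asc i j = if a_scal_cond i j then sh ^+ 2 else rh ^- 2.
Proof.
rewrite /asc /a_scal_cond /sigma.
by case: (_ || _); case: (i <= n)%N; case: (j <= n)%N;
  rewrite /= ?mulr1 ?mulrN1 ?opprK ?expr1z -?invr_expz ?expr1z; field; rewrite rh0.
Qed.

Lemma Rrow_id_diag lam k : in_range n k ->
  R lam k k = (x - q * y) * (x - xi * y) * lam k k.
Proof.
move=> hk; rewrite /Rrow eqxx ifN //; apply/eqP; move: hk; rewrite /in_range /primed; lia.
Qed.

Lemma Rrow_id_gt lam k l : (l < k)%N -> l != pr k ->
  R lam k l = (1 - q) * (y * (x - xi * y)) * lam k l
    + asc l k * ((x - y) * (x - xi * y)) * lam l k.
Proof. by move=> lk /negbTE ne; rewrite /Rrow ne lk gtn_eqF. Qed.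

Lemma Rrow_id_lt lam k l : (k < l)%N -> l != pr k ->
  R lam k l = (1 - q) * (x * (x - xi * y)) * lam k l
    + asc l k * ((x - y) * (x - xi * y)) * lam l k.
Proof.
by move=> lk /negbTE ne; rewrite /Rrow ne ltnNge (ltnW lk) ltn_eqF.
Qed.

Lemma Rrow_id_dual lam k : R lam k (pr k) = \sum_(1 <= i < (2 * n).+1) b i k * lam (pr i) i.
Proof. by rewrite /Rrow eqxx. Qed.

Lemma sum_delta (a : nat) (c : nat -> K) : in_range n a ->
  \sum_(1 <= j < (2 * n).+1) c j * (j == a)%:R = c a.
Proof.
move=> /andP[a1 a2]; rewrite (big_nat_widenl 1 0) //= big_mkcond /=.
rewrite (bigD1_seq a) ?mem_index_iota ?iota_uniq //=.
rewrite a1 eqxx mulr1 big1 ?addr0 // => j /negbTE ->.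
by rewrite mulr0 if_same.
Qed.

Section Mid.
Variable i : nat.
Hypothesis hi : (1 <= i < n)%N.

Lemma tt_mid : t i.+1 = sh ^+ 2 * t i.
Proof. by rewrite tt_lt //; lia. Qed.
Lemma tt_mid_primed : t (pr i) = rh ^- 2 * t (pr i.+1).
Proof.
have -> : pr i = (pr i.+1).+1 by rewrite /primed; lia.
by rewrite tt_gt // /primed; lia.
Qed.

(** A dual row sums over all zero-weight vectors v_j' v_j. Of these e_i moves only the four with j
    among i, i+1, i', (i+1)', and it moves them onto v_i v_(i+1)' and v_(i+1)' v_i. *)
Lemma Rrow_Erow_mid lam k : in_range n k ->
  R (E i y x lam) k (pr k) =
    (b (pr i.+1) k - rh ^+ 2 * b (pr i) k) * lam i (pr i.+1)
    + (sh ^- 2 * b i.+1 k - b i k) * lam (pr i.+1) i.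
Proof.
move=> hk; rewrite Rrow_id_dual.
transitivity (\sum_(1 <= j < (2 * n).+1)
   ((b j k * lam i (pr i.+1)) * (j == pr i.+1)%:R
    + (- (b j k * lam (pr i.+1) i)) * (j == i)%:R
    + (sh ^- 2 * (b j k * lam (pr i.+1) i)) * (j == i.+1)%:R
    + (- (rh ^+ 2 * (b j k * lam i (pr i.+1)))) * (j == pr i)%:R)).
  apply: eq_big_nat => j hj; rewrite /Erow /spec /e_coef.
  have -> : (i == 0)%N = false by lia.
  have -> : (i == n)%N = false by lia.
  rewrite w_wt_mid //; last by rewrite /in_range /primed; lia.
  have -> : (pr j == i.+1) = (j == pr i.+1) by apply/eqP/eqP; rewrite /primed; lia.
  have -> : (pr j == pr i) = (j == i) by apply/eqP/eqP; rewrite /primed; lia.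
  have -> : (pr j == i) = (j == pr i) by apply/eqP/eqP; rewrite /primed; lia.
  have -> : (pr j == pr i.+1) = (j == i.+1) by apply/eqP/eqP; rewrite /primed; lia.
  have e1 : (pr i.+1 == i) = false by apply/eqP; rewrite /primed; lia.
  have e2 : (pr i.+1 == i.+1) = false by apply/eqP; rewrite /primed; lia.
  have e3 : (pr i.+1 == pr i) = false by apply/eqP; rewrite /primed; lia.
  have e4 : (i == pr i) = false by apply/eqP; rewrite /primed; lia.
  have e5 : (i.+1 == pr i) = false by apply/eqP; rewrite /primed; lia.
  have e6 : e_idx n (pr i) = pr i.+1.
    by rewrite /e_idx ifN; [rewrite /primed; lia|apply/eqP; rewrite /primed; lia].
  have e7 : (i == i.+1) = false by lia.
  have e8 : e_idx n i.+1 = i by rewrite /e_idx /=; case: eqP; lia.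
  case: (j =P pr i.+1) => [->|h1].
    rewrite e1 e2 e3 primedK; last by rewrite /in_range; lia.
    by rewrite e8 /=; ring.
  case: (j =P i) => [->|h2]; first by rewrite e7 e4 e6 /=; ring.
  case: (j =P i.+1) => [->|h3]; first by rewrite e5 e8 /=; ring.
  case: (j =P pr i) => [->|h4] /=; last by ring.
  rewrite primedK; last by rewrite /in_range; lia.
  by rewrite e6; ring.
rewrite !big_split /= !sum_delta; try (rewrite /in_range /primed; lia).
by ring.
Qed.

(** The combination comes from e_i applied to v_(i+1) v_i'. Since t_(i+1) = s t_i, the terms in t_m
    cancel for m different from i and i+1; what survives is of six-vertex type, with the common
    factor x - xi y. *)
Lemma tgt1_mid m : in_range n m ->
  b m i - sh ^+ 2 * b m i.+1 = (x - xi * y) *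
   ((1 - q) * x * ((m == pr i)%:R - sh ^+ 2 * (m == pr i.+1)%:R)
    + (x - y) * (q * (m == i)%:R - sh ^+ 2 * (m == i.+1)%:R)).
Proof.
move=> hm; rewrite /b_hom tt_mid.
have t0 := tt_neq0 n rh0 sh0 i.
case: (ltngtP m i) => h1.
- have -> : (m < i.+1)%N by lia.
  have -> : (m == i.+1) = false by lia.
  have -> : (m == pr i) = false by apply/eqP; move: hm; rewrite /in_range /primed; lia.
  have -> : (m == pr i.+1) = false by apply/eqP; move: hm; rewrite /in_range /primed; lia.
  by rewrite /qq /=; field; rewrite ?t0 ?rh0 ?sh0 ?oner_eq0.
- case: (ltngtP m i.+1) => h2; first by lia.
    case: (m =P pr i) => [e1|h3].
      have -> : (m == pr i.+1) = false by apply/eqP; move: e1; rewrite /in_range /primed; lia.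
      by rewrite /qq /=; field; rewrite ?t0 ?rh0 ?sh0 ?oner_eq0.
    case: (m =P pr i.+1) => [e1|h4].
      by rewrite /qq /=; field; rewrite ?t0 ?rh0 ?sh0 ?oner_eq0.
    by rewrite /qq /=; field; rewrite ?t0 ?rh0 ?sh0 ?oner_eq0.
  rewrite -h2.
  have -> : (m == pr i) = false by apply/eqP; move: hm; rewrite /in_range /primed; lia.
  have -> : (m == pr m) = false by apply/eqP; move: hm; rewrite /in_range /primed; lia.
  by rewrite h2 tt_mid /qq /=; field; rewrite ?t0 ?rh0 ?sh0 ?oner_eq0.
- rewrite h1 ltnSn.
  have -> : (i == i.+1) = false by lia.
  have -> : (i == pr i) = false by apply/eqP; move: hm; rewrite /in_range /primed; lia.
  have -> : (i == pr i.+1) = false by apply/eqP; move: hm; rewrite /in_range /primed; lia.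
  by rewrite /qq /=; field; rewrite ?t0 ?rh0 ?sh0 ?oner_eq0.
Qed.

(** Companion of [tgt1_mid] for e_i applied to v_i' v_(i+1); the cancellation now comes from t_i' =
    r^-1 t_(i+1)'. *)
Lemma tgt2_mid m : in_range n m ->
  rh ^- 2 * b m (pr i) - b m (pr i.+1) = (x - xi * y) *
   ((1 - q) * y * (rh ^- 2 * (m == i)%:R - (m == i.+1)%:R)
    + (x - y) * rh ^- 2 * ((m == pr i)%:R - sh ^+ 2 * (m == pr i.+1)%:R)).
Proof.
move=> hm; rewrite /b_hom tt_mid_primed !primedK; try (rewrite /in_range; lia).
have t0 := tt_neq0 n rh0 sh0 (pr i.+1).
have e : pr i = (pr i.+1).+1 by rewrite /primed; lia.
case: (ltngtP m (pr i.+1)) => h1.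
- have -> : (m < pr i)%N by lia.
  have -> : (m == pr i) = false by lia.
  case: (m =P i) => [e1|h3].
    have -> : (m == i.+1) = false by lia.
    by rewrite /qq /=; field; rewrite ?t0 ?rh0 ?sh0 ?oner_eq0.
  case: (m =P i.+1) => [e1|h4].
    by rewrite /qq /=; field; rewrite ?t0 ?rh0 ?sh0 ?oner_eq0.
  by rewrite /qq /=; field; rewrite ?t0 ?rh0 ?sh0 ?oner_eq0.
- have -> : (m == i) = false by apply/eqP; move: h1; rewrite /in_range /primed; lia.
  have -> : (m == i.+1) = false by apply/eqP; move: h1; rewrite /in_range /primed; lia.
  case: (ltngtP m (pr i)) => h2; first by lia.
    by rewrite /qq /=; field; rewrite ?t0 ?rh0 ?sh0 ?oner_eq0.
  by rewrite h2 tt_mid_primed /qq /=; field; rewrite ?t0 ?rh0 ?sh0 ?oner_eq0.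
- have -> : (m == i) = false by apply/eqP; move: h1; rewrite /in_range /primed; lia.
  have -> : (m == i.+1) = false by apply/eqP; move: h1; rewrite /in_range /primed; lia.
  rewrite h1.
  have -> : (pr i.+1 < pr i)%N by lia.
  have -> : (pr i.+1 == pr i)%N = false by lia.
  by rewrite /qq /=; field; rewrite ?t0 ?rh0 ?sh0 ?oner_eq0.
Qed.

Lemma tgt1_sum lam :
  R lam i (pr i) - sh ^+ 2 * R lam i.+1 (pr i.+1) = (x - xi * y) *
   ((1 - q) * x * (lam i (pr i) - sh ^+ 2 * lam i.+1 (pr i.+1))
    + (x - y) * (q * lam (pr i) i - sh ^+ 2 * lam (pr i.+1) i.+1)).
Proof.
rewrite !Rrow_id_dual mulr_sumr -sumrB.
pose L m := (x - xi * y) * lam (pr m) m.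
transitivity (\sum_(1 <= m < (2 * n).+1)
  (((1 - q) * x * L m) * (m == pr i)%:R
   - ((1 - q) * x * sh ^+ 2 * L m) * (m == pr i.+1)%:R
   + ((x - y) * q * L m) * (m == i)%:R
   - ((x - y) * sh ^+ 2 * L m) * (m == i.+1)%:R)).
  apply: eq_big_nat => m hm; rewrite mulrA -mulrBl tgt1_mid //.
  by rewrite /L; ring.
rewrite sumrB big_split /= sumrB !sum_delta; try (rewrite /in_range /primed; lia).
by rewrite /L !primedK; try (rewrite /in_range; lia); ring.
Qed.

Lemma tgt2_sum lam :
  rh ^- 2 * R lam (pr i) i - R lam (pr i.+1) i.+1 = (x - xi * y) *
   ((1 - q) * y * (rh ^- 2 * lam (pr i) i - lam (pr i.+1) i.+1)
    + (x - y) * rh ^- 2 * (lam i (pr i) - sh ^+ 2 * lam i.+1 (pr i.+1))).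
Proof.
have := Rrow_id_dual lam (pr i); rewrite primedK ?/in_range; last by lia.
have := Rrow_id_dual lam (pr i.+1); rewrite primedK ?/in_range; last by lia.
move=> -> ->; rewrite mulr_sumr -sumrB.
pose L m := (x - xi * y) * lam (pr m) m.
transitivity (\sum_(1 <= m < (2 * n).+1)
  (((1 - q) * y * rh ^- 2 * L m) * (m == i)%:R
   - ((1 - q) * y * L m) * (m == i.+1)%:R
   + ((x - y) * rh ^- 2 * L m) * (m == pr i)%:R
   - ((x - y) * rh ^- 2 * sh ^+ 2 * L m) * (m == pr i.+1)%:R)).
  apply: eq_big_nat => m hm; rewrite mulrA -mulrBl tgt2_mid //.
  by rewrite /L; ring.
rewrite sumrB big_split /= sumrB !sum_delta; try (rewrite /in_range /primed; lia).
by rewrite /L !primedK; try (rewrite /in_range; lia); ring.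
Qed.

(** An index m other than these four separates neither i from i+1 nor i' from (i+1)', and both
    members of each pair lie on the same side of n. Hence the comparisons that choose between s and
    r^-1 have the same outcome. The next three lemmas hold for the same reason. *)
Lemma a_scal_eq_l m : in_range n m -> m <> i -> m <> i.+1 -> m <> pr i -> m <> pr i.+1 ->
  asc m i = asc m i.+1.
Proof.
move=> hm h1 h2 h3 h4.
have Ei : (pr i + i = (2 * n).+1)%N by rewrite /primed; lia.
have EJ : (pr i.+1 + i.+1 = (2 * n).+1)%N by rewrite /primed; lia.
have prI' : pr (pr i) = i by rewrite primedK // /in_range; lia.
have prJ' : pr (pr i.+1) = i.+1 by rewrite primedK // /in_range; lia.
have Em : (pr m + m = (2 * n).+1)%N by move: hm; rewrite /in_range /primed; lia.
suff h : a_scal_cond m i = a_scal_cond m i.+1 by rewrite !a_scalE h.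
by move: hm; rewrite /in_range /a_scal_cond => hm; apply/idP/idP; lia.
Qed.

Lemma a_scal_eq_l' m : in_range n m -> m <> i -> m <> i.+1 -> m <> pr i -> m <> pr i.+1 ->
  asc m (pr i) = asc m (pr i.+1).
Proof.
move=> hm h1 h2 h3 h4.
have Ei : (pr i + i = (2 * n).+1)%N by rewrite /primed; lia.
have EJ : (pr i.+1 + i.+1 = (2 * n).+1)%N by rewrite /primed; lia.
have prI' : pr (pr i) = i by rewrite primedK // /in_range; lia.
have prJ' : pr (pr i.+1) = i.+1 by rewrite primedK // /in_range; lia.
have Em : (pr m + m = (2 * n).+1)%N by move: hm; rewrite /in_range /primed; lia.
suff h : a_scal_cond m (pr i) = a_scal_cond m (pr i.+1) by rewrite !a_scalE h.
by move: hm; rewrite /in_range /a_scal_cond => hm; apply/idP/idP; lia.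
Qed.

Lemma a_scal_eq_r m : in_range n m -> m <> i -> m <> i.+1 -> m <> pr i -> m <> pr i.+1 ->
  asc i m = asc i.+1 m.
Proof.
move=> hm h1 h2 h3 h4.
have Ei : (pr i + i = (2 * n).+1)%N by rewrite /primed; lia.
have EJ : (pr i.+1 + i.+1 = (2 * n).+1)%N by rewrite /primed; lia.
have prI' : pr (pr i) = i by rewrite primedK // /in_range; lia.
have prJ' : pr (pr i.+1) = i.+1 by rewrite primedK // /in_range; lia.
have Em : (pr m + m = (2 * n).+1)%N by move: hm; rewrite /in_range /primed; lia.
suff h : a_scal_cond i m = a_scal_cond i.+1 m by rewrite !a_scalE h.
by move: hm; rewrite /in_range /a_scal_cond => hm; apply/idP/idP; lia.
Qed.

Lemma a_scal_eq_r' m : in_range n m -> m <> i -> m <> i.+1 -> m <> pr i -> m <> pr i.+1 ->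
  asc (pr i) m = asc (pr i.+1) m.
Proof.
move=> hm h1 h2 h3 h4.
have Ei : (pr i + i = (2 * n).+1)%N by rewrite /primed; lia.
have EJ : (pr i.+1 + i.+1 = (2 * n).+1)%N by rewrite /primed; lia.
have prI' : pr (pr i) = i by rewrite primedK // /in_range; lia.
have prJ' : pr (pr i.+1) = i.+1 by rewrite primedK // /in_range; lia.
have Em : (pr m + m = (2 * n).+1)%N by move: hm; rewrite /in_range /primed; lia.
suff h : a_scal_cond (pr i) m = a_scal_cond (pr i.+1) m by rewrite !a_scalE h.
by move: hm; rewrite /in_range /a_scal_cond => hm; apply/idP/idP; lia.
Qed.

End Mid.
End CoreE.

Section CoreMid.
Context {K : fieldType} (n : nat) (rh sh x y : K).
Hypotheses (rh0 : rh != 0) (sh0 : sh != 0) (n2 : (2 <= n)%N).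
Local Notation wv := (w_wt n rh sh).
Local Notation asc := (a_scal n rh sh).
Local Notation b := (b_hom n rh sh id x y).
Local Notation R := (Rrow n rh sh id x y).
Local Notation pr := (primed n).
Local Notation E i := (Erow n rh sh id i).

Local Notation asc_cond := (a_scal_cond n).
Variable i : nat.
Hypothesis hi : (1 <= i < n)%N.

Lemma Rrow_Erow_mid_node lam k l : in_range n k -> in_range n l ->
  R (E i y x lam) k l = E i x y (R lam) k l.
Proof.
move=> hk hl.
have Ei : (pr i + i = (2 * n).+1)%N by rewrite /primed; nat_lia.
have EJ : (pr i.+1 + i.+1 = (2 * n).+1)%N by rewrite /primed; nat_lia.
have Ek : (pr k + k = (2 * n).+1)%N by move: hk; rewrite /in_range /primed; nat_lia.
have El : (pr l + l = (2 * n).+1)%N by move: hl; rewrite /in_range /primed; nat_lia.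
have prI' : pr (pr i) = i by rewrite primedK // /in_range; nat_lia.
have prJ' : pr (pr i.+1) = i.+1 by rewrite primedK // /in_range; nat_lia.
have hI : in_range n i by rewrite /in_range; nat_lia.
have hJ : in_range n i.+1 by rewrite /in_range; nat_lia.
have hI' : in_range n (pr i) by rewrite /in_range; nat_lia.
have hJ' : in_range n (pr i.+1) by rewrite /in_range; nat_lia.
move: hk hl; rewrite /in_range => hk hl.
have i0 : (i == 0)%N = false by nat_lia.
have iN : (i == n)%N = false by nat_lia.
have pJ : e_idx n i.+1 = i by rewrite /e_idx; case: eqP; nat_lia.
have pI' : e_idx n (pr i) = pr i.+1 by rewrite /e_idx; case: eqP; nat_lia.
have xJ : e_coef n i i.+1 = 1 :> K.
  by rewrite /e_coef i0 iN eqxx (_ : (_ == pr i) = false) ?subr0 //; nat_lia.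
have xI' : e_coef n i (pr i) = -1 :> K.
  by rewrite /e_coef i0 iN eqxx (_ : (_ == i.+1) = false) ?sub0r //; nat_lia.
have xo m : m <> i.+1 -> m <> pr i -> e_coef n i m = 0 :> K.
  by move=> /eqP/negbTE h1 /eqP/negbTE h2; rewrite /e_coef i0 iN h1 h2 subrr.
have wI : wv i i = rh ^+ 2 by rewrite w_wt_mid // eqxx.
have wJ : wv i i.+1 = sh ^+ 2.
  by rewrite w_wt_mid // eqxx (_ : (_ == i) = false) //; nat_lia.
have wI' : wv i (pr i) = rh ^- 2 by rewrite w_wt_primed // wI.
have wJ' : wv i (pr i.+1) = sh ^- 2 by rewrite w_wt_primed // wJ.
have wo m : in_range n m -> m <> i -> m <> i.+1 -> m <> pr i -> m <> pr i.+1 -> wv i m = 1.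
  move=> hm /eqP/negbTE h1 /eqP/negbTE h2 /eqP/negbTE h3 /eqP/negbTE h4.
  by rewrite w_wt_mid // h1 h2 h3 h4.
have ascL := @a_scal_eq_l K n rh sh rh0 sh0 n2 i hi.
have ascL' := @a_scal_eq_l' K n rh sh rh0 sh0 n2 i hi.
have ascR := @a_scal_eq_r K n rh sh rh0 sh0 n2 i hi.
have ascR' := @a_scal_eq_r' K n rh sh rh0 sh0 n2 i hi.
have ascT a c : asc_cond a c -> asc a c = sh ^+ 2 by rewrite (a_scalE n rh0 sh0) => ->.
have ascF a c : ~~ asc_cond a c -> asc a c = rh ^- 2 by rewrite (a_scalE n rh0 sh0) => /negbTE ->.
have Emid lam' a c : E i y x lam' a c
    = e_coef n i a * lam' (e_idx n a) c + wv i a * e_coef n i c * lam' a (e_idx n c).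
  by rewrite /Erow /spec i0 !mul1r.
have Emid' lam' a c : E i x y lam' a c
    = e_coef n i a * lam' (e_idx n a) c + wv i a * e_coef n i c * lam' a (e_idx n c).
  by rewrite /Erow /spec i0 !mul1r.
rewrite Emid'.
have t0 := tt_neq0 n rh0 sh0 i.
have t0' := tt_neq0 n rh0 sh0 (pr i.+1).
have D := (xJ, xI', pJ, pI', wI, wJ, wI', wJ').
have src_mid' m : in_range n m -> R (E i y x lam) (pr m) m =
    (b (pr i.+1) (pr m) - rh ^+ 2 * b (pr i) (pr m)) * lam i (pr i.+1)
    + (sh ^- 2 * b i.+1 (pr m) - b i (pr m)) * lam (pr i.+1) i.
  move=> hm; rewrite -Rrow_Erow_mid // ?primedK //.
  by move: hm; rewrite /in_range /primed; lia.
have xI : e_coef n i i = 0 :> K by apply: xo; nat_lia.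
have xJ' : e_coef n i (pr i.+1) = 0 :> K by apply: xo; nat_lia.
(* Nine cases: e_i moves v_(i+1) and v_i' only, so k and l are each one of these or neither. In the
   mixed cases the other index may still be i or (i+1)', which produces a diagonal entry or a dual
   row. *)
case: (k =P i.+1) => [?|kJ]; [subst k|case: (k =P pr i) => [?|kI']; [subst k|]];
 (case: (l =P i.+1) => [?|lJ]; [subst l|case: (l =P pr i) => [?|lI']; [subst l|]]).
-
  rewrite Rrow_id_diag // ?Emid ?D Rrow_id_lt ?Rrow_id_gt; try nat_lia.
  rewrite (ascF i i.+1) ?(ascT i.+1 i); try by rewrite /asc_cond; nat_lia.
  by rewrite /qq /=; field; rewrite ?rh0 ?sh0 ?oner_eq0 ?t0 ?t0'.
-
  rewrite Rrow_id_lt ?Emid ?D ?prI'; try nat_lia.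
  rewrite (ascT (pr i) i.+1); last by rewrite /asc_cond; nat_lia.
  transitivity (R lam i (pr i) - sh ^+ 2 * R lam i.+1 (pr i.+1)); last by ring.
  by rewrite tgt1_sum //; rewrite /qq /=; field; rewrite ?rh0 ?sh0 ?oner_eq0 ?t0 ?t0'.
-
  rewrite (xo l) // !D mulr0 mul0r addr0 mul1r.
  case: (l =P pr i.+1) => [->|lJ'].
    rewrite Rrow_Erow_mid // Rrow_id_lt; try nat_lia.
    rewrite (ascF (pr i.+1) i); last by rewrite /asc_cond; nat_lia.
    by rewrite /b_hom ?prI' ?prJ'; decide_nat; rewrite ?(tt_mid rh0 sh0 n2 hi) ?(tt_mid_primed rh0 sh0 n2 hi); rewrite /qq /=; field; rewrite ?rh0 ?sh0 ?oner_eq0 ?t0 ?t0'.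
  case: (l =P i) => [->|lI].
    rewrite Rrow_id_gt ?Rrow_id_diag ?Emid ?D ?xI; try nat_lia.
    rewrite (ascF i i.+1); last by rewrite /asc_cond; nat_lia.
    by rewrite /qq /=; field; rewrite ?rh0 ?sh0 ?oner_eq0 ?t0 ?t0'.
  case: (ltngtP l i.+1) => h; last by exfalso; nat_lia.
    rewrite !Rrow_id_gt ?Emid ?D ?(xo l) ?(wo l) -?(ascL l) //; try nat_lia.
    by ring.
  rewrite !Rrow_id_lt ?Emid ?D ?(xo l) ?(wo l) -?(ascL l) //; try nat_lia.
  by ring.
-
  rewrite Rrow_id_gt ?Emid ?D ?prI'; try nat_lia.
  rewrite (ascF i.+1 (pr i)); last by rewrite /asc_cond; nat_lia.
  transitivity (rh ^- 2 * R lam (pr i) i - R lam (pr i.+1) i.+1); last by ring.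
  by rewrite tgt2_sum //; rewrite /qq /=; field; rewrite ?rh0 ?sh0 ?oner_eq0 ?t0 ?t0'.
-
  rewrite Rrow_id_diag // ?Emid ?D Rrow_id_lt ?Rrow_id_gt; try nat_lia.
  rewrite (ascF (pr i) (pr i.+1)) ?(ascT (pr i.+1) (pr i)); try by rewrite /asc_cond; nat_lia.
  by rewrite /qq /=; field; rewrite ?rh0 ?sh0 ?oner_eq0 ?t0 ?t0'.
-
  rewrite (xo l) // !D mulr0 mul0r addr0.
  case: (l =P i) => [->|lI].
    rewrite src_mid' // Rrow_id_gt; try nat_lia.
    rewrite (ascT i (pr i.+1)); last by rewrite /asc_cond; nat_lia.
    by rewrite /b_hom ?prI' ?prJ'; decide_nat; rewrite ?(tt_mid rh0 sh0 n2 hi) ?(tt_mid_primed rh0 sh0 n2 hi); rewrite /qq /=; field; rewrite ?rh0 ?sh0 ?oner_eq0 ?t0 ?t0'.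
  case: (l =P pr i.+1) => [->|lJ'].
    rewrite Rrow_id_gt ?Rrow_id_diag ?Emid ?D ?xJ'; try nat_lia.
    rewrite (ascT (pr i.+1) (pr i)); last by rewrite /asc_cond; nat_lia.
    by rewrite /qq /=; field; rewrite ?rh0 ?sh0 ?oner_eq0 ?t0 ?t0'.
  case: (ltngtP l (pr i)) => h; last by exfalso; nat_lia.
    rewrite !Rrow_id_gt ?Emid ?D ?(xo l) ?(wo l) -?(ascL' l) //; try nat_lia.
    by ring.
  rewrite !Rrow_id_lt ?Emid ?D ?(xo l) ?(wo l) -?(ascL' l) //; try nat_lia.
  by ring.
-
  rewrite (xo k) // !D mul0r add0r mulr1.
  case: (k =P i) => [->|kI].
    rewrite Rrow_id_lt ?Rrow_id_diag ?Emid ?D ?xI; try nat_lia.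
    rewrite (ascT i.+1 i); last by rewrite /asc_cond; nat_lia.
    by rewrite /qq /=; field; rewrite ?rh0 ?sh0 ?oner_eq0 ?t0 ?t0'.
  case: (k =P pr i.+1) => [->|kJ'].
    rewrite src_mid' // Rrow_id_gt ?D; try nat_lia.
    rewrite (ascT i (pr i.+1)); last by rewrite /asc_cond; nat_lia.
    by rewrite /b_hom ?prI' ?prJ'; decide_nat; rewrite ?(tt_mid rh0 sh0 n2 hi) ?(tt_mid_primed rh0 sh0 n2 hi); rewrite /qq /=; field; rewrite ?rh0 ?sh0 ?oner_eq0 ?t0 ?t0'.
  rewrite wo // mul1r.
  case: (ltngtP k i.+1) => h; last by exfalso; nat_lia.
    rewrite !Rrow_id_lt ?Emid ?D ?(xo k) ?(wo k) ?(ascR k) //; try nat_lia.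
    by ring.
  rewrite !Rrow_id_gt ?Emid ?D ?(xo k) ?(wo k) ?(ascR k) //; try nat_lia.
  by ring.
-
  rewrite (xo k) // !D mul0r add0r.
  case: (k =P i) => [->|kI].
    rewrite Rrow_Erow_mid // Rrow_id_lt ?D; try nat_lia.
    rewrite (ascF (pr i.+1) i); last by rewrite /asc_cond; nat_lia.
    by rewrite /b_hom ?prI' ?prJ'; decide_nat; rewrite ?(tt_mid rh0 sh0 n2 hi) ?(tt_mid_primed rh0 sh0 n2 hi); rewrite /qq /=; field; rewrite ?rh0 ?sh0 ?oner_eq0 ?t0 ?t0'.
  case: (k =P pr i.+1) => [->|kJ'].
    rewrite Rrow_id_lt ?Rrow_id_diag ?Emid ?D ?xJ'; try nat_lia.
    rewrite (ascF (pr i) (pr i.+1)); last by rewrite /asc_cond; nat_lia.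
    by rewrite /qq /=; field; rewrite ?rh0 ?sh0 ?oner_eq0 ?t0 ?t0'.
  rewrite wo // mul1r.
  case: (ltngtP k (pr i)) => h; last by exfalso; nat_lia.
    rewrite !Rrow_id_lt ?Emid ?D ?(xo k) ?(wo k) ?(ascR' k) //; try nat_lia.
    by ring.
  rewrite !Rrow_id_gt ?Emid ?D ?(xo k) ?(wo k) ?(ascR' k) //; try nat_lia.
  by ring.
-
  rewrite (xo k) // (xo l) // mulr0 !mul0r addr0.
  (* The right side is now zero. On a dual row the left side vanishes because, on each side of k,
     the b_mk met here are proportional to t_m, so both brackets of [Rrow_Erow_mid] are zero. *)
  case: (l =P pr k) => [e|lk].
    have t1 := tt_neq0 n rh0 sh0 k.
    rewrite e Rrow_Erow_mid //.
    have -> : b (pr i.+1) k - rh ^+ 2 * b (pr i) k = 0.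
      case: (ltnP k (pr i.+1)) => h.
        by rewrite /b_hom ?prI' ?prJ'; decide_nat; rewrite ?(tt_mid rh0 sh0 n2 hi) ?(tt_mid_primed rh0 sh0 n2 hi); rewrite /qq /=; field; rewrite ?rh0 ?sh0 ?oner_eq0 ?t0 ?t0' ?t1.
      by rewrite /b_hom ?prI' ?prJ'; decide_nat; rewrite ?(tt_mid rh0 sh0 n2 hi) ?(tt_mid_primed rh0 sh0 n2 hi); rewrite /qq /=; field; rewrite ?rh0 ?sh0 ?oner_eq0 ?t0 ?t0' ?t1.
    have -> : sh ^- 2 * b i.+1 k - b i k = 0.
      case: (ltnP k i) => h.
        by rewrite /b_hom ?prI' ?prJ'; decide_nat; rewrite ?(tt_mid rh0 sh0 n2 hi) ?(tt_mid_primed rh0 sh0 n2 hi); rewrite /qq /=; field; rewrite ?rh0 ?sh0 ?oner_eq0 ?t0 ?t0' ?t1.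
      by rewrite /b_hom ?prI' ?prJ'; decide_nat; rewrite ?(tt_mid rh0 sh0 n2 hi) ?(tt_mid_primed rh0 sh0 n2 hi); rewrite /qq /=; field; rewrite ?rh0 ?sh0 ?oner_eq0 ?t0 ?t0' ?t1.
    by rewrite !mul0r addr0.
  case: (ltngtP k l) => h; last by rewrite h Rrow_id_diag ?Emid ?(xo l) //; ring.
    by rewrite Rrow_id_lt ?Emid ?(xo l) ?(xo k) //; [ring|nat_lia].
  by rewrite Rrow_id_gt ?Emid ?(xo l) ?(xo k) //; [ring|nat_lia].
Qed.
End CoreMid.

(** * Intertwining of the end generators e_n and e_0 *)

Section CoreEnds.
Context {K : fieldType} (n : nat) (rh sh x y : K).
Hypotheses (rh0 : rh != 0) (sh0 : sh != 0) (n2 : (2 <= n)%N).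
Local Notation q := (qq rh sh).
Local Notation xi := (xi n rh sh).
Local Notation t := (tt_ n rh sh).
Local Notation wv := (w_wt n rh sh).
Local Notation asc := (a_scal n rh sh).
Local Notation b := (b_hom n rh sh id x y).
Local Notation R := (Rrow n rh sh id x y).
Local Notation pr := (primed n).
Local Notation E i := (Erow n rh sh id i).

Local Notation asc_cond := (a_scal_cond n).

Section Last.
Let En lam' a c : E n y x lam' a c = (a == n.+1)%:R * lam' n c
   + wv n a * (c == n.+1)%:R * lam' a n.
Proof.
rewrite /Erow /spec /e_coef /e_idx (_ : (n == 0)%N = false) ?eqxx ?mul1r; last by lia.
by case: (a =P n.+1) => [->|_]; case: (c =P n.+1) => [->|_];
  rewrite ?mul0r ?mulr0 ?mul0r // (_ : (n.+1 == 1)%N = false) //; lia.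
Qed.
Let En' lam' a c : E n x y lam' a c = (a == n.+1)%:R * lam' n c
   + wv n a * (c == n.+1)%:R * lam' a n.
Proof.
by rewrite -En /Erow /spec (_ : (n == 0)%N = false) //; lia.
Qed.

Let prn : pr n = n.+1. Proof. by rewrite /primed; lia. Qed.
Let prn1 : pr n.+1 = n. Proof. by rewrite /primed; lia. Qed.
Let wn : wv n n = rh ^+ 2 * sh ^- 2.
Proof. by rewrite w_wt_last ?eqxx // /in_range; lia. Qed.
Let hn : in_range n n. Proof. by rewrite /in_range; lia. Qed.
Let hn1 : in_range n n.+1. Proof. by rewrite /in_range; lia. Qed.
Let wn1 : wv n n.+1 = rh ^- 2 * sh ^+ 2.
Proof.
have h : (n.+1 == n) = false by lia.
by rewrite (w_wt_last rh0 sh0 hn1) h eqxx.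
Qed.
Let tn1 : t n.+1 = - rh ^- 2 * sh ^+ 2 * t n.
Proof. by rewrite tt_n1 // tt_n //; field; rewrite ?rh0 ?sh0. Qed.

Let src_last lam k : in_range n k ->
  R (E n y x lam) k (pr k) =
    (b n k + rh ^+ 2 * sh ^- 2 * b n.+1 k) * lam n n.
Proof.
move=> hk; rewrite Rrow_id_dual.
transitivity (\sum_(1 <= j < (2 * n).+1)
   ((b j k * lam n n) * (j == n)%:R
    + (rh ^+ 2 * sh ^- 2 * b j k * lam n n) * (j == n.+1)%:R)).
  apply: eq_big_nat => j hj; rewrite En.
  have -> : (pr j == n.+1) = (j == n) by apply/eqP/eqP; rewrite /primed; lia.
  case: (j =P n) => [->|h1].
    by rewrite (_ : (n == n.+1) = false) /=; [ring|lia].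
  case: (j =P n.+1) => [->|h2] /=; last by ring.
  by rewrite prn1 wn; ring.
by rewrite big_split /= !sum_delta //; ring.
Qed.

(** e_n takes v_(n+1) v_(n+1) to v_n v_(n+1) + r^-1 s v_(n+1) v_n, on which R has to act by the same
    scalar. In this combination of two columns the ratio t_(n+1) = -r^-1 s t_n cancels every term
    off these two vectors. *)
Let tgt_last lam :
  R lam n n.+1 + rh ^- 2 * sh ^+ 2 * R lam n.+1 n =
  (x - q * y) * (x - xi * y) * (lam n n.+1 + rh ^- 2 * sh ^+ 2 * lam n.+1 n).
Proof.
have := @Rrow_id_dual K n rh sh x y lam n; rewrite prn => ->.
have := @Rrow_id_dual K n rh sh x y lam n.+1; rewrite prn1 => ->.
rewrite mulr_sumr -big_split /=.
pose L m := (x - q * y) * (x - xi * y) * lam (pr m) m.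
transitivity (\sum_(1 <= m < (2 * n).+1)
  (L m * (m == n.+1)%:R + (rh ^- 2 * sh ^+ 2 * L m) * (m == n)%:R)).
  apply: eq_big_nat => m hm; rewrite mulrA -mulrDl.
  have -> : b m n + rh ^- 2 * sh ^+ 2 * b m n.+1 =
     (x - q * y) * (x - xi * y) * ((m == n.+1)%:R + rh ^- 2 * sh ^+ 2 * (m == n)%:R).
    have t0 := tt_neq0 n rh0 sh0 n.
    rewrite /b_hom prn prn1 tn1.
    case: (ltngtP m n) => h.
    - by decide_nat; rewrite /qq /=; field; nonzero.
    - case: (ltngtP m n.+1) => h'; first by exfalso; nat_lia.
        by decide_nat; rewrite /qq /=; field; nonzero.
      by rewrite h' tn1; rewrite /qq /=; field; nonzero.
    - by rewrite h; decide_nat; rewrite /qq /=; field; nonzero.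
  by rewrite /L; ring.
rewrite big_split /= !sum_delta //.
by rewrite /L prn prn1; ring.
Qed.

Lemma Rrow_Erow_last lam k l : in_range n k -> in_range n l ->
  R (E n y x lam) k l = E n x y (R lam) k l.
Proof.
move=> hk hl; rewrite En'.
have Ek : (pr k + k = (2 * n).+1)%N by move: hk; rewrite /in_range /primed; lia.
have El : (pr l + l = (2 * n).+1)%N by move: hl; rewrite /in_range /primed; lia.
have hk' := hk; have hl' := hl.
move: hk hl; rewrite /in_range => hk hl.
have ascT a c : asc_cond a c -> asc a c = sh ^+ 2 by rewrite (a_scalE n rh0 sh0) => ->.
have ascF a c : ~~ asc_cond a c -> asc a c = rh ^- 2 by rewrite (a_scalE n rh0 sh0) => /negbTE ->.
have src_last' m : in_range n m -> R (E n y x lam) (pr m) m =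
    (b n (pr m) + rh ^+ 2 * sh ^- 2 * b n.+1 (pr m)) * lam n n.
  move=> hm; rewrite -src_last // ?primedK //.
  by move: hm; rewrite /in_range /primed => hm; nat_lia.
have t0 := tt_neq0 n rh0 sh0 n.
have wlo m : in_range n m -> (m < n)%N -> wv n m = rh ^- 2 * sh ^- 2.
  by move=> hm h; rewrite w_wt_last //; decide_nat.
have whi m : in_range n m -> (n.+1 < m)%N -> wv n m = rh ^+ 2 * sh ^+ 2.
  by move=> hm h; rewrite w_wt_last //; decide_nat.
case: (k =P n.+1) => [?|kJ]; [subst k|]; (case: (l =P n.+1) => [?|lJ]; [subst l|]).
- rewrite Rrow_id_diag // En eqxx !mul1r mulr1 wn1.
  by rewrite tgt_last.
- rewrite mulr0 !mul0r addr0 mul1r.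
  case: (ltngtP l n) => h.
  + rewrite !Rrow_id_gt ?prn ?prn1 ?En ?eqxx; try nat_lia.
    rewrite (ascT l n.+1) ?(ascF l n) ?(wlo l) //; try by rewrite /asc_cond ?prn ?prn1; nat_lia.
    decide_nat. by rewrite /qq /=; field; nonzero.
  + rewrite !Rrow_id_lt ?prn ?prn1 ?En ?eqxx; try nat_lia.
    rewrite (ascF l n.+1) ?(ascT l n) ?(whi l) //; try by rewrite /asc_cond ?prn ?prn1; nat_lia.
    decide_nat. by rewrite /qq /=; field; nonzero.
  + rewrite h; have := src_last' n hn; rewrite prn => ->.
    rewrite Rrow_id_diag // /b_hom tn1; decide_nat.
    by rewrite /qq /=; field; nonzero.
- rewrite mul0r add0r mulr1.
  case: (ltngtP k n) => h.
  + rewrite !Rrow_id_lt ?prn ?prn1 ?En ?eqxx; try nat_lia.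
    rewrite (ascF n.+1 k) ?(ascT n k) ?(wlo k) //; try by rewrite /asc_cond ?prn ?prn1; nat_lia.
    decide_nat. by rewrite /qq /=; field; nonzero.
  + rewrite !Rrow_id_gt ?prn ?prn1 ?En ?eqxx; try nat_lia.
    rewrite (ascT n.+1 k) ?(ascF n k) ?(whi k) //; try by rewrite /asc_cond ?prn ?prn1; nat_lia.
    decide_nat. by rewrite /qq /=; field; nonzero.
  + rewrite h; have := src_last lam hn; rewrite prn => ->.
    rewrite Rrow_id_diag // wn /b_hom tn1; decide_nat.
    by rewrite /qq /=; field; nonzero.
- rewrite mulr0 !mul0r addr0.
  case: (l =P pr k) => [e|lk].
    rewrite e src_last //.
    have t1 := tt_neq0 n rh0 sh0 k.
    case: (ltngtP k n) => h.
    + by rewrite /b_hom tn1; decide_nat; rewrite /qq /=; field; nonzero.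
    + by rewrite /b_hom tn1; decide_nat; rewrite /qq /=; field; nonzero.
    + by exfalso; nat_lia.
  have Ekl : E n y x lam k l = 0 by rewrite En; decide_nat; rewrite mulr0 !mul0r addr0.
  have Elk : E n y x lam l k = 0 by rewrite En; decide_nat; rewrite mulr0 !mul0r addr0.
  case: (ltngtP k l) => h; last by subst l; rewrite Rrow_id_diag // Ekl mulr0.
    by rewrite Rrow_id_lt ?Ekl ?Elk ?mulr0 ?addr0 //; nat_lia.
  by rewrite Rrow_id_gt ?Ekl ?Elk ?mulr0 ?addr0 //; nat_lia.
Qed.
End Last.

Section First.
Local Notation N := (2 * n)%N.
Let En x1 y1 lam' a c : E 0 x1 y1 lam' a c = x1 * (a == 1%N)%:R * lam' N c
   + y1 * wv 0 a * (c == 1%N)%:R * lam' a N.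
Proof.
rewrite /Erow /spec /e_coef /e_idx /=.
by case: (a =P 1%N) => [->|_]; case: (c =P 1%N) => [->|_] //=;
  rewrite ?mulr0 ?mul0r.
Qed.

Let prN : pr N = 1%N. Proof. by rewrite /primed; lia. Qed.
Let pr1 : pr 1 = N. Proof. by rewrite /primed; lia. Qed.
Let hN : in_range n N. Proof. by rewrite /in_range; lia. Qed.
Let h1 : in_range n 1. Proof. by rewrite /in_range; lia. Qed.
Let w1 : wv 0 1 = rh ^- 2 * sh ^+ 2.
Proof. by rewrite w_wt_0 ?eqxx. Qed.
Let wN : wv 0 N = rh ^+ 2 * sh ^- 2.
Proof. by rewrite -pr1 w_wt_primed // w1; field; rewrite rh0 sh0. Qed.
Let tN : t N = - (rh ^+ 2 * sh ^- 2 * xi * t 1%N).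
Proof. by rewrite tt_ends ?mulNr //; lia. Qed.
Let xi0 : xi != 0.
Proof. by rewrite /Defs.xi mulf_neq0 // expfz_neq0. Qed.

Let src_first lam k : in_range n k ->
  R (E 0 y x lam) k (pr k) =
    (y * b N k + x * rh ^+ 2 * sh ^- 2 * b 1%N k) * lam N N.
Proof.
move=> hk; rewrite Rrow_id_dual.
transitivity (\sum_(1 <= j < (2 * n).+1)
   ((y * b j k * lam N N) * (j == N)%:R
    + (x * rh ^+ 2 * sh ^- 2 * b j k * lam N N) * (j == 1%N)%:R)).
  apply: eq_big_nat => j hj; rewrite En.
  have -> : (pr j == 1%N) = (j == N) by apply/eqP/eqP; rewrite /primed; lia.
  case: (j =P N) => [->|h2].
    by rewrite (_ : (N == 1%N) = false) /=; [ring|lia].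
  case: (j =P 1%N) => [->|h3] /=; last by ring.
  by rewrite pr1 wN; ring.
by rewrite big_split /= !sum_delta //; ring.
Qed.

(** Counterpart of [tgt_last] with v_1 in the role of v_(n+1) and v_2n in that of v_n. For 1 < m <
    2n the coefficient b_(m,2n) carries [xi y] and b_(m,1) carries [x]; the parameters brought in by
    e_0 even out x and y, and [tN] absorbs [xi]. *)
Let tgt_first lam :
  x * R lam N 1%N + y * rh ^- 2 * sh ^+ 2 * R lam 1%N N =
  (x - q * y) * (x - xi * y) *
    (y * lam N 1%N + x * rh ^- 2 * sh ^+ 2 * lam 1%N N).
Proof.
have := @Rrow_id_dual K n rh sh x y lam N; rewrite prN => ->.
have := @Rrow_id_dual K n rh sh x y lam 1; rewrite pr1 => ->.
rewrite !mulr_sumr -big_split /=.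
pose L m := (x - q * y) * (x - xi * y) * lam (pr m) m.
transitivity (\sum_(1 <= m < (2 * n).+1)
  (y * L m * (m == 1%N)%:R + (x * rh ^- 2 * sh ^+ 2 * L m) * (m == N)%:R)).
  apply: eq_big_nat => m hm; rewrite mulrA [X in _ + X]mulrA -mulrDl.
  have -> : x * b m N + y * rh ^- 2 * sh ^+ 2 * b m 1%N =
     (x - q * y) * (x - xi * y) * (y * (m == 1%N)%:R + x * rh ^- 2 * sh ^+ 2 * (m == N)%:R).
    have t0 := tt_neq0 n rh0 sh0 1%N.
    rewrite /b_hom prN pr1 tN.
    case: (m =P 1%N) => [->|h].
      by decide_nat; rewrite /qq /=; field; nonzero.
    case: (m =P N) => [->|h'].
      by rewrite tN; decide_nat; rewrite /qq /=; field; nonzero.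
    by decide_nat; rewrite /qq /=; field; nonzero.
  by rewrite /L; ring.
rewrite big_split /= !sum_delta //.
by rewrite /L prN pr1; ring.
Qed.

Lemma Rrow_Erow_first lam k l : in_range n k -> in_range n l ->
  R (E 0 y x lam) k l = E 0 x y (R lam) k l.
Proof.
move=> hk hl; rewrite (En x y).
have Ek : (pr k + k = (2 * n).+1)%N by move: hk; rewrite /in_range /primed; lia.
have El : (pr l + l = (2 * n).+1)%N by move: hl; rewrite /in_range /primed; lia.
have hk' := hk; have hl' := hl.
move: hk hl; rewrite /in_range => hk hl.
have ascT a c : asc_cond a c -> asc a c = sh ^+ 2 by rewrite (a_scalE n rh0 sh0) => ->.
have ascF a c : ~~ asc_cond a c -> asc a c = rh ^- 2 by rewrite (a_scalE n rh0 sh0) => /negbTE ->.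
have src_first' m : in_range n m -> R (E 0 y x lam) (pr m) m =
    (y * b N (pr m) + x * rh ^+ 2 * sh ^- 2 * b 1%N (pr m)) * lam N N.
  move=> hm; rewrite -src_first // ?primedK //.
  by move: hm; rewrite /in_range /primed => hm; nat_lia.
have t0 := tt_neq0 n rh0 sh0 1.
have wlo m : in_range n m -> m <> 1%N -> (m <= n)%N -> wv 0 m = rh ^- 2 * sh ^- 2.
  by move=> hm h h'; rewrite w_wt_0 //; decide_nat.
have whi m : in_range n m -> m <> N -> (n < m)%N -> wv 0 m = rh ^+ 2 * sh ^+ 2.
  by move=> hm h h'; rewrite w_wt_0 //; decide_nat.
case: (k =P 1%N) => [?|kJ]; [subst k|]; (case: (l =P 1%N) => [?|lJ]; [subst l|]).
- rewrite Rrow_id_diag // En eqxx !mulr1 w1.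
  by rewrite !(mulrA _ (rh ^- 2)) tgt_first.
- rewrite mulr0 !mul0r addr0 mulr1.
  case: (l =P N) => [->|lN].
    have := src_first lam h1; rewrite pr1 => ->.
    by rewrite Rrow_id_diag // /b_hom tN ?prN ?pr1; decide_nat; rewrite /qq /=; field; nonzero.
  case: (leqP l n) => h.
  + rewrite Rrow_id_lt ?Rrow_id_gt ?prN ?pr1 ?En ?eqxx; try nat_lia.
    rewrite (ascT l 1%N) ?(ascF l N) ?(wlo l) //; try by rewrite /asc_cond ?prN ?pr1; nat_lia.
    decide_nat. by rewrite /qq /=; field; nonzero.
  + rewrite Rrow_id_lt ?Rrow_id_gt ?prN ?pr1 ?En ?eqxx; try nat_lia.
    rewrite (ascF l 1%N) ?(ascT l N) ?(whi l) //; try by rewrite /asc_cond ?prN ?pr1; nat_lia.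
    decide_nat. by rewrite /qq /=; field; nonzero.
- rewrite mulr0 mul0r add0r mulr1.
  case: (k =P N) => [->|kN].
    have := src_first lam hN; rewrite prN => ->.
    by rewrite wN Rrow_id_diag // /b_hom tN ?prN ?pr1; decide_nat; rewrite /qq /=; field; nonzero.
  case: (leqP k n) => h.
  + rewrite Rrow_id_gt ?Rrow_id_lt ?prN ?pr1 ?En ?eqxx; try nat_lia.
    rewrite (ascF 1%N k) ?(ascT N k) ?(wlo k) //; try by rewrite /asc_cond ?prN ?pr1; nat_lia.
    decide_nat. by rewrite /qq /=; field; nonzero.
  + rewrite Rrow_id_gt ?Rrow_id_lt ?prN ?pr1 ?En ?eqxx; try nat_lia.
    rewrite (ascT 1%N k) ?(ascF N k) ?(whi k) //; try by rewrite /asc_cond ?prN ?pr1; nat_lia.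
    decide_nat. by rewrite /qq /=; field; nonzero.
- rewrite !mulr0 !mul0r addr0.
  case: (l =P pr k) => [e|lk].
    rewrite e src_first //.
    have t1 := tt_neq0 n rh0 sh0 k.
    have kN : k <> N by move=> kN; apply: lJ; rewrite e kN prN.
    by rewrite /b_hom tN; decide_nat; rewrite /qq /=; field; nonzero.
  have Ekl : E 0 y x lam k l = 0 by rewrite En; decide_nat; rewrite !mulr0 !mul0r addr0.
  have Elk : E 0 y x lam l k = 0 by rewrite En; decide_nat; rewrite !mulr0 !mul0r addr0.
  case: (ltngtP k l) => h; last by subst l; rewrite Rrow_id_diag // Ekl mulr0.
    by rewrite Rrow_id_lt ?Ekl ?Elk ?mulr0 ?addr0 //; nat_lia.
  by rewrite Rrow_id_gt ?Ekl ?Elk ?mulr0 ?addr0 //; nat_lia.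
Qed.
End First.
End CoreEnds.

Section Ext.
Context {K : fieldType} (n : nat) (rh sh : K) {A : comNzRingType} (phi : K -> A).

Lemma e_idx_in_range k : in_range n k -> in_range n (e_idx n k).
Proof. by rewrite /in_range /e_idx; case: eqP; lia. Qed.
Lemma f_idx_in_range k : in_range n k -> in_range n (f_idx n k).
Proof. by rewrite /in_range /f_idx; case: eqP; lia. Qed.
Lemma primed_in_range k : in_range n k -> in_range n (primed n k).
Proof. by rewrite /in_range /primed; lia. Qed.

Lemma eq_Rrow x y lam mu k l :
  (forall a b, in_range n a -> in_range n b -> lam a b = mu a b) ->
  in_range n k -> in_range n l ->
  Rrow n rh sh phi x y lam k l = Rrow n rh sh phi x y mu k l.
Proof.
move=> e hk hl; rewrite /Rrow !e //; case: ifP => // _.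
by apply: eq_big_nat => i hi; rewrite e // primed_in_range.
Qed.
Lemma Rrow_scale x y a lam k l :
  Rrow n rh sh phi x y (fun p q => a * lam p q) k l = a * Rrow n rh sh phi x y lam k l.
Proof.
rewrite /Rrow; case: ifP => _; first by rewrite mulr_sumr; apply: eq_bigr => *; ring.
by case: ifP => _; ring.
Qed.
Lemma eq_Erow i x y lam mu k l :
  (forall a b, in_range n a -> in_range n b -> lam a b = mu a b) ->
  in_range n k -> in_range n l ->
  Erow n rh sh phi i x y lam k l = Erow n rh sh phi i x y mu k l.
Proof. by move=> e hk hl; rewrite /Erow !e ?e_idx_in_range. Qed.
Lemma eq_Frow i x y lam mu k l :
  (forall a b, in_range n a -> in_range n b -> lam a b = mu a b) ->
  in_range n k -> in_range n l ->
  Frow n rh sh phi i x y lam k l = Frow n rh sh phi i x y mu k l.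
Proof. by move=> e hk hl; rewrite /Frow !e ?f_idx_in_range. Qed.
End Ext.

Lemma Rrow_Erow_field {K : fieldType} n (rh sh x y : K) i lam k l :
  rh != 0 -> sh != 0 -> (2 <= n)%N -> (i <= n)%N -> in_range n k -> in_range n l ->
  Rrow n rh sh id x y (Erow n rh sh id i y x lam) k l
  = Erow n rh sh id i x y (Rrow n rh sh id x y lam) k l.
Proof.
move=> rh0 sh0 n2 hi hk hl; case: (posnP i) => [->|i0]; first exact: Rrow_Erow_first.
case: (ltngtP i n) => h; [|lia|by rewrite h; exact: Rrow_Erow_last].
by apply: Rrow_Erow_mid_node => //; rewrite i0.
Qed.

(** * The symmetry exchanging the f_i with the e_i *)

Lemma w'_wt_sym (K : fieldType) n (rh sh : K) i k :
  rh != 0 -> sh != 0 -> in_range n k -> w'_wt n rh sh i k = w_wt n sh^-1 rh^-1 i (primed n k).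
Proof.
move=> rh0 sh0 hk; rewrite w_wt_primed ?invr_eq0 // /w_wt /w'_wt !exprz_inv opprK invfM !invr_expz opprK.
by rewrite mulrC.
Qed.

(* Conjugation by the operator G turns f_i for (r, s) into e_i for (s^-1, r^-1). *)
Section CoreF.
Context {K : fieldType} (n : nat) (rh sh x y : K).
Hypotheses (rh0 : rh != 0) (sh0 : sh != 0) (n2 : (2 <= n)%N).
Local Notation R := (Rrow n rh sh id x y).
Local Notation R' := (Rrow n sh^-1 rh^-1 id x y).
Local Notation pr := (primed n).
Local Notation F := (Frow n rh sh id).
Local Notation E' := (Erow n sh^-1 rh^-1 id).

Let rs := rh ^+ 2 * sh ^+ 2.
(** Rescaling of the basis. The powers of rs on the second half are chosen so that g_k g_k' turns
    t_k into its value for (s^-1, r^-1), see [t_sym], and so that the coefficients -(rs)^-1 of the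
    f_i are absorbed, see [yf_G]. *)
Let g k : K := if (k <= n)%N then 1 else rs ^+ (k - n).
(** The tensor factors have to be exchanged because 1 (x) f + f (x) w' has its group-like element in
    the second factor, e (x) 1 + w (x) e in the first. *)
Let G (lam : nat -> nat -> K) k l := g k * g l * lam (pr l) (pr k).
Let c i : K := if i == 0%N then rs ^- n else if i == n then rs else -1.

Let rs0 : rs != 0. Proof. by rewrite mulf_neq0 ?expf_neq0. Qed.
Let g0 k : g k != 0.
Proof. by rewrite /g; case: ifP => _; rewrite ?oner_eq0 ?expf_neq0. Qed.
Let ri0 : rh^-1 != 0. Proof. by rewrite invr_eq0. Qed.
Let si0 : sh^-1 != 0. Proof. by rewrite invr_eq0. Qed.

Let qq_sym : qq sh^-1 rh^-1 = qq rh sh.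
Proof. by rewrite /qq; field; nonzero. Qed.
Let xi_sym : xi n sh^-1 rh^-1 = xi n rh sh.
Proof. by rewrite /xi !exprz_inv mulrC mulNr opprK. Qed.

(** Passing to (s^-1, r^-1) makes the two possible values s and r^-1 trade places, so it is enough
    that the condition choosing between them is reversed on the dual pair. *)
Let asc_sym l k : in_range n k -> in_range n l -> l != k -> l != pr k ->
  a_scal n rh sh l k = a_scal n sh^-1 rh^-1 (pr k) (pr l).
Proof.
move=> hk hl h1 h2; rewrite (a_scalE n rh0 sh0) (a_scalE n si0 ri0).
have Ek : (pr k + k = (2 * n).+1)%N by move: hk; rewrite /in_range /primed; lia.
have El : (pr l + l = (2 * n).+1)%N by move: hl; rewrite /in_range /primed; lia.
have pk := primedK hk; have pl := primedK hl.
suff -> : a_scal_cond n l k = ~~ a_scal_cond n (pr k) (pr l).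
  by case: (a_scal_cond n _ _) => /=; field; nonzero.
move: hk hl; rewrite /in_range /a_scal_cond ?pk ?pl => hk hl.
case: (leqP l n) => ?; case: (leqP k n) => ?; apply/idP/idP; lia.
Qed.

Let gg k : in_range n k -> g k * g (pr k) = rs ^+ (if k <= n then n.+1 - k else k - n)%N.
Proof.
move=> hk; rewrite /g.
have -> : (pr k <= n)%N = ~~ (k <= n)%N by move: hk; rewrite /in_range /primed; lia.
case: (leqP k n) => h /=; rewrite ?mul1r ?mulr1 //.
by congr (_ ^+ _); rewrite /primed; lia.
Qed.

Let t_sym k : in_range n k -> tt_ n sh^-1 rh^-1 k = tt_ n rh sh k * (g k * g (pr k)).
Proof.
move=> hk; rewrite gg // /tt_ /rs; case: (leqP k n) => h.
  have -> : 2 * (Posz k - Posz n - 1) = - Posz (2 * (n.+1 - k))%N by lia.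
  rewrite exprz_inv opprK -exprnN -exprnP exprMn -!exprM mulrCA mulVf ?mulr1 //.
  exact: expf_neq0.
have -> : 2 * (Posz n - Posz k) = - Posz (2 * (k - n))%N by lia.
rewrite exprz_inv opprK -exprnN -exprnP exprMn -!exprM mulNr mulrA mulVf ?mul1r //.
exact: expf_neq0.
Qed.

Let bco_sym i k : in_range n i -> in_range n k ->
  b_hom n rh sh id x y i k * (g i * g (pr i))
  = g k * g (pr k) * b_hom n sh^-1 rh^-1 id x y i k.
Proof.
move=> hi hk; rewrite /b_hom qq_sym xi_sym !t_sym //.
have t0 := tt_neq0 n rh0 sh0 k; have g1 := g0 k; have g2 := g0 (pr k).
case: (i =P k) => [->|ik]; first by ring.
case: (i =P pr k) => [->|ik'] /=.
  rewrite primedK //.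
  by case: ifP => _; field; nonzero.
by case: ifP => _; field; nonzero.
Qed.

Lemma Rrow_sym lam k l : in_range n k -> in_range n l -> R (G lam) k l = G (R' lam) k l.
Proof.
move=> hk hl; case: (l =P pr k) => [->|/eqP lk].
  rewrite Rrow_id_dual /G primedK // Rrow_id_dual mulr_sumr.
  apply: eq_big_nat => i hi; rewrite primedK // [in RHS]mulrA -bco_sym //; ring.
have hk' : in_range n (pr k) by exact: primed_in_range.
have hl' : in_range n (pr l) by exact: primed_in_range.
have Ek : (pr k + k = (2 * n).+1)%N by move: hk; rewrite /in_range /primed; lia.
have El : (pr l + l = (2 * n).+1)%N by move: hl; rewrite /in_range /primed; lia.
have lk' : pr k != pr (pr l) by rewrite primedK // eq_sym.
case: (ltngtP k l) => h; last first.
- by move: h => <-; rewrite Rrow_id_diag // /G Rrow_id_diag // qq_sym xi_sym; ring.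
- rewrite Rrow_id_gt // /G Rrow_id_gt ?qq_sym ?xi_sym ?(asc_sym hk hl) //; try nat_lia.
  by ring.
- rewrite Rrow_id_lt // /G Rrow_id_lt ?qq_sym ?xi_sym ?(asc_sym hk hl) //; try nat_lia.
  by ring.
Qed.

Let yf_G i k : (i <= n)%N -> in_range n k ->
  f_coef n rh sh i k * g (f_idx n k) = c i * g k * e_coef n i (pr k).
Proof.
move=> hi hk; rewrite /f_coef /c /e_coef.
have Ek : (pr k + k = (2 * n).+1)%N by move: hk; rewrite /in_range /primed; lia.
move: hk; rewrite /in_range => hk.
case: (i =P 0%N) => [_|i0].
  have -> : (pr k == 1%N) = (k == 2 * n)%N by apply/eqP/eqP; lia.
  case: eqP => [->|_]; last by rewrite mulr0 mul0r.
  rewrite /f_idx eqxx /g; decide_nat.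
  have -> : (2 * n - n = n)%N by lia.
  by rewrite mulVf ?expf_neq0 //= mulr1.
case: (i =P n) => [_|iN].
  have -> : (pr k == n.+1) = (k == n) by apply/eqP/eqP; lia.
  case: (k =P n) => [->|_]; last by rewrite mulr0 mul0r.
  rewrite /f_idx /g; decide_nat.
  by rewrite subSnn expr1 /=; ring.
have -> : (pr k == i.+1) = (k == pr i.+1) by apply/eqP/eqP; rewrite /primed; lia.
have -> : (pr k == pr i) = (k == i) by apply/eqP/eqP; rewrite /primed; lia.
have EJ : (pr i.+1 + i.+1 = (2 * n).+1)%N by rewrite /primed; lia.
case: (k =P i) => [->|ki].
  rewrite (_ : (i == pr i.+1) = false) /=; last by lia.
  rewrite /f_idx /g; decide_nat. by ring.
case: (k =P pr i.+1) => [->|kJ] /=; last by rewrite mulr0 subrr mul0r mulr0.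
rewrite /f_idx /g; decide_nat.
have -> : ((pr i.+1).+1 - n = (pr i.+1 - n).+1)%N by lia.
rewrite (exprS _ (pr i.+1 - n)) /rs /=; set X := _ ^+ (_ - _). by field; nonzero.
Qed.

Let pr_sc k : in_range n k -> pr (f_idx n k) = e_idx n (pr k).
Proof.
rewrite /in_range /f_idx /e_idx => hk.
have -> : (pr k == 1%N) = (k == 2 * n)%N by apply/eqP/eqP; rewrite /primed; lia.
by case: eqP => ?; rewrite /primed; lia.
Qed.

Let Fop_G i x1 y1 lam k l : (i <= n)%N -> in_range n k -> in_range n l ->
  F i x1 y1 (G lam) k l = c i * G (E' i y1 x1 lam) k l.
Proof.
move=> hi hk hl; rewrite /Frow /Erow /G !pr_sc //.
transitivity (spec i x1 * (f_coef n rh sh i k * g (f_idx n k)) * w'_wt n rh sh i l * g l * lam (pr l) (e_idx n (pr k))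
  + spec i y1 * (f_coef n rh sh i l * g (f_idx n l)) * g k * lam (e_idx n (pr l)) (pr k)); first by ring.
rewrite !yf_G // w'_wt_sym //; ring.
Qed.

Lemma Rrow_Frow_field i lam k l : (i <= n)%N -> in_range n k -> in_range n l ->
  R (F i x y lam) k l = F i y x (R lam) k l.
Proof.
move=> hi hk hl.
(* [mu] is the preimage of [lam] under [G], on indices in range. *)
pose mu a b := (g (pr a))^-1 * (g (pr b))^-1 * lam (pr b) (pr a).
have e a b : in_range n a -> in_range n b -> lam a b = G mu a b.
  move=> ha hb; rewrite /G /mu !primedK // ; have ga := g0 a; have gb := g0 b.
  by field; nonzero.
transitivity (R (F i x y (G mu)) k l).
  by apply: eq_Rrow => // a b ha hb; exact: eq_Frow.
transitivity (R (G (fun a b => c i * E' i y x mu a b)) k l).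
  by apply: eq_Rrow => // a b ha hb; rewrite Fop_G // /G; ring.
transitivity (F i y x (G (R' mu)) k l); last first.
  apply: eq_Frow => // a b ha hb; rewrite -Rrow_sym //.
  by apply: eq_Rrow => // a' b' ha' hb'; rewrite e.
rewrite Rrow_sym // Fop_G // /G Rrow_scale; [|exact: primed_in_range..].
rewrite Rrow_Erow_field //; try exact: primed_in_range.
by ring.
Qed.
End CoreF.

(** * Transport along ring morphisms and extension to integral domains *)

Section Morph.
Context {K : fieldType} (n : nat) (rh sh : K).

Section RM.
Context {A B : comNzRingType} (phi : K -> A) (psi : {rmorphism A -> B}).
Let psil (lam : nat -> nat -> A) a b := psi (lam a b).

Lemma rmorph_Rrow x y lam k l :
  psi (Rrow n rh sh phi x y lam k l)
  = Rrow n rh sh (fun c => psi (phi c)) (psi x) (psi y) (psil lam) k l.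
Proof.
rewrite /Rrow; case: ifP => _.
  rewrite rmorph_sum; apply: eq_bigr => i _; rewrite rmorphM; congr (_ * _).
  by rewrite /b_hom; case: ifP => _; [|case: ifP => _];
    rewrite !(rmorphM, rmorphB, rmorph_nat).
case: ifP => _; first by rewrite !(rmorphM, rmorphB).
by case: ifP => _; rewrite !(rmorphM, rmorphB, rmorphD).
Qed.

Lemma rmorph_spec i x : psi (spec i x) = spec i (psi x).
Proof. by rewrite /spec; case: ifP; rewrite ?rmorph1. Qed.

Lemma rmorph_Erow i x y lam k l :
  psi (Erow n rh sh phi i x y lam k l)
  = Erow n rh sh (fun c => psi (phi c)) i (psi x) (psi y) (psil lam) k l.
Proof. by rewrite /Erow !(rmorphM, rmorphD) !rmorph_spec. Qed.

Lemma rmorph_Frow i x y lam k l :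
  psi (Frow n rh sh phi i x y lam k l)
  = Frow n rh sh (fun c => psi (phi c)) i (psi x) (psi y) (psil lam) k l.
Proof. by rewrite /Frow !(rmorphM, rmorphD) !rmorph_spec. Qed.
End RM.

Section FM.
Context {L : fieldType} (phi : {rmorphism K -> L}).
Local Notation rh' := (phi rh).
Local Notation sh' := (phi sh).

Lemma map_qq : phi (qq rh sh) = qq rh' sh'.
Proof. by rewrite /qq rmorphM fmorphV !rmorphXn. Qed.
Lemma map_xi : phi (xi n rh sh) = xi n rh' sh'.
Proof. by rewrite /xi rmorphM !fmorphXz. Qed.
Lemma map_tt i : phi (tt_ n rh sh i) = tt_ n rh' sh' i.
Proof. by rewrite /tt_; case: ifP => _; rewrite ?rmorphN fmorphXz. Qed.
Lemma map_a_scal i j : phi (a_scal n rh sh i j) = a_scal n rh' sh' i j.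
Proof. by rewrite /a_scal !rmorphM fmorphV fmorphXz rmorphM. Qed.
Lemma map_e_coef i k : phi (e_coef n i k) = e_coef n i k.
Proof. by rewrite /e_coef; do 2?case: ifP => _; rewrite ?rmorphB !rmorph_nat. Qed.
Lemma map_w_wt i k : phi (w_wt n rh sh i k) = w_wt n rh' sh' i k.
Proof. by rewrite /w_wt rmorphM !fmorphXz. Qed.
Lemma map_w'_wt i k : phi (w'_wt n rh sh i k) = w'_wt n rh' sh' i k.
Proof. by rewrite /w'_wt rmorphM !fmorphXz. Qed.
Lemma map_f_coef i k : phi (f_coef n rh sh i k) = f_coef n rh' sh' i k.
Proof.
rewrite /f_coef; do 2?case: ifP => _; rewrite ?rmorphB ?rmorphM ?fmorphV ?rmorphM ?rmorphXn ?rmorph_nat //.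
Qed.

Lemma Rrow_map x y lam k l :
  Rrow n rh sh phi x y lam k l = Rrow n rh' sh' id x y lam k l.
Proof.
rewrite /Rrow !rmorphB !rmorph1 map_qq map_xi map_a_scal; case: ifP => // _.
apply: eq_bigr => i _; congr (_ * _).
rewrite /b_hom rmorphB rmorph1 map_qq map_xi !fmorph_div !map_tt.
by rewrite (rmorphM phi (xi n rh sh) (tt_ n rh sh i)) map_xi map_tt.
Qed.
Lemma Erow_map i x y lam k l :
  Erow n rh sh phi i x y lam k l = Erow n rh' sh' id i x y lam k l.
Proof. by rewrite /Erow !map_e_coef map_w_wt. Qed.
Lemma Frow_map i x y lam k l :
  Frow n rh sh phi i x y lam k l = Frow n rh' sh' id i x y lam k l.
Proof. by rewrite /Frow !map_f_coef map_w'_wt. Qed.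
End FM.
End Morph.

Section Domain.
Context {K : fieldType} (n : nat) (rh sh : K).
Hypotheses (rh0 : rh != 0) (sh0 : sh != 0) (n2 : (2 <= n)%N).
Context {A : idomainType} (phi : {rmorphism K -> A}) (x y : A).
Local Notation R := (Rrow n rh sh phi x y).
Local Notation E := (Erow n rh sh phi).
Local Notation F := (Frow n rh sh phi).

Let psi : {rmorphism K -> {fraction A}} := (@tofrac A : {rmorphism A -> _}) \o phi.
Let prh : psi rh != 0. Proof. by rewrite fmorph_eq0. Qed.
Let psh : psi sh != 0. Proof. by rewrite fmorph_eq0. Qed.

(** The entry checks live in one field that contains both the scalars and the parameters. The
    fraction field of [A] is such a field, and [A] embeds into it. *)
Lemma Rrow_Erow i lam k l : (i <= n)%N -> in_range n k -> in_range n l ->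
  R (E i y x lam) k l = E i x y (R lam) k l.
Proof.
move=> hi hk hl; apply/eqP; rewrite -tofrac_eq; apply/eqP.
rewrite rmorph_Rrow rmorph_Erow /= -/psi.
rewrite (Rrow_map n rh sh psi) (Erow_map n rh sh psi).
transitivity (Rrow n (psi rh) (psi sh) id (tofrac x) (tofrac y)
  (Erow n (psi rh) (psi sh) id i (tofrac y) (tofrac x) (fun a b => tofrac (lam a b))) k l).
  by apply: eq_Rrow => // a b ha hb; rewrite rmorph_Erow -(Erow_map n rh sh psi).
rewrite Rrow_Erow_field //; apply: eq_Erow => // a b ha hb.
by rewrite rmorph_Rrow -(Rrow_map n rh sh psi).
Qed.

Lemma Rrow_Frow i lam k l : (i <= n)%N -> in_range n k -> in_range n l ->
  R (F i x y lam) k l = F i y x (R lam) k l.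
Proof.
move=> hi hk hl; apply/eqP; rewrite -tofrac_eq; apply/eqP.
rewrite rmorph_Rrow rmorph_Frow /= -/psi.
rewrite (Rrow_map n rh sh psi) (Frow_map n rh sh psi).
transitivity (Rrow n (psi rh) (psi sh) id (tofrac x) (tofrac y)
  (Frow n (psi rh) (psi sh) id i (tofrac x) (tofrac y) (fun a b => tofrac (lam a b))) k l).
  by apply: eq_Rrow => // a b ha hb; rewrite rmorph_Frow -(Frow_map n rh sh psi).
rewrite Rrow_Frow_field //; apply: eq_Frow => // a b ha hb.
by rewrite rmorph_Rrow -(Rrow_map n rh sh psi).
Qed.
End Domain.

(** * The Yang-Baxter equation *)

Section Three.
Context {K : fieldType} (n : nat) (rh sh : K).
Context {A : comNzRingType} (phi : {rmorphism K -> A}).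
Local Notation R := (Rrow n rh sh phi).
Local Notation E := (Erow n rh sh phi).
Local Notation F := (Frow n rh sh phi).
Local Notation xe i k := (phi (e_coef n i k)).
Local Notation yf i k := (phi (f_coef n rh sh i k)).
Local Notation wv i k := (phi (w_wt n rh sh i k)).
Local Notation wv' i k := (phi (w'_wt n rh sh i k)).
Local Notation pd := (e_idx n).
Local Notation sc := (f_idx n).
Implicit Type lam mu : nat -> nat -> nat -> A.

Definition Rrow12 (x y : A) lam (i j k : nat) : A := R x y (fun a b => lam a b k) i j.
Definition Rrow23 (x y : A) lam (i j k : nat) : A := R x y (lam i) j k.

Definition Erow3 i (x y z : A) lam (a b c : nat) : A :=
  spec i x * xe i a * lam (pd a) b c
  + spec i y * wv i a * xe i b * lam a (pd b) c
  + spec i z * (wv i a * wv i b * xe i c) * lam a b (pd c).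
(** Meant for i > 0, where the f_i carry no spectral parameter. *)
Definition Frow3 i lam (a b c : nat) : A :=
  yf i a * wv' i b * wv' i c * lam (sc a) b c
  + yf i b * wv' i c * lam a (sc b) c + yf i c * lam a b (sc c).

(** On functionals operators compose backwards: the outermost one acts first on V(u) (x) V(v) (x)
    V(w). Up to the powers of v and w of the homogeneous form this is R_12(v/w) R_23(u/w) R_12(u/v)
    in braid form. *)
Definition ybe_lhs u v w lam := Rrow12 u v (Rrow23 u w (Rrow12 v w lam)).
Definition ybe_rhs u v w lam := Rrow23 v w (Rrow12 u w (Rrow23 u v lam)).

Lemma Rrow_diag x y f k : in_range n k ->
  R x y f k k = (x - phi (qq rh sh) * y) * (x - phi (xi n rh sh) * y) * f k k.
Proof.
move=> hk; rewrite /Rrow eqxx ifN //; apply/eqP; move: hk; rewrite /in_range /primed; lia.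
Qed.

Lemma Rrow_gt x y f k l : (l < k)%N -> l != primed n k ->
  R x y f k l = phi (1 - qq rh sh) * (y * (x - phi (xi n rh sh) * y)) * f k l
    + phi (a_scal n rh sh l k) * ((x - y) * (x - phi (xi n rh sh) * y)) * f l k.
Proof. by move=> lk /negbTE ne; rewrite /Rrow ne lk gtn_eqF. Qed.

Lemma Rrow_lt x y f k l : (k < l)%N -> l != primed n k ->
  R x y f k l = phi (1 - qq rh sh) * (x * (x - phi (xi n rh sh) * y)) * f k l
    + phi (a_scal n rh sh l k) * ((x - y) * (x - phi (xi n rh sh) * y)) * f l k.
Proof. by move=> lk /negbTE ne; rewrite /Rrow ne ltnNge (ltnW lk) ltn_eqF. Qed.

Lemma Rrow_lin x y (f g : nat -> nat -> A) k l c d :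
  R x y (fun a b => c * f a b + d * g a b) k l = c * R x y f k l + d * R x y g k l.
Proof.
rewrite /Rrow; case: ifP => _; last by case: ifP => _; ring.
by rewrite !mulr_sumr -big_split; apply: eq_bigr => i _ /=; ring.
Qed.

(** R preserves weights, and the condition on [h] makes [h k * h l] depend on the weight of v_k v_l
    only. This handles the group-like factors of the coproducts. *)
Lemma Rrow_weight (h : nat -> A) x y (f : nat -> nat -> A) k l :
  (forall m, in_range n m -> h m * h (primed n m) = 1) -> in_range n k -> in_range n l ->
  R x y (fun a b => h a * h b * f a b) k l = h k * h l * R x y f k l.
Proof.
move=> hh hk hl; rewrite /Rrow; case: eqP => [->|_].
  rewrite hh // mul1r; apply: eq_big_nat => i hi.
  by rewrite [h _ * h _]mulrC hh // mul1r.
by case: eqP => [->|_]; ring.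
Qed.

Section Intertwine.
Hypotheses (rh0 : rh != 0) (sh0 : sh != 0).
Hypothesis RE : forall i x y f k l, (i <= n)%N -> in_range n k -> in_range n l ->
  R x y (E i y x f) k l = E i x y (R x y f) k l.
Hypothesis RF : forall i x y f k l, (i <= n)%N -> in_range n k -> in_range n l ->
  R x y (F i x y f) k l = F i y x (R x y f) k l.

Let wv_dual i m : in_range n m -> wv i m * wv i (primed n m) = 1.
Proof. by move=> hm; rewrite w_wt_primed // -rmorphM mulfV ?rmorph1 // w_wt_neq0. Qed.
Let wv'_dual i m : in_range n m -> wv' i m * wv' i (primed n m) = 1.
Proof. by move=> hm; rewrite w'_wt_primed // -rmorphM mulfV ?rmorph1 // w'_wt_neq0. Qed.

Definition eq_on3 lam mu := forall a b c, in_range n a -> in_range n b -> in_range n c ->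
  lam a b c = mu a b c.

Lemma Rrow12_ext x y lam mu : eq_on3 lam mu -> eq_on3 (Rrow12 x y lam) (Rrow12 x y mu).
Proof. by move=> e a b c ha hb hc; apply: eq_Rrow => // *; exact: e. Qed.
Lemma Rrow23_ext x y lam mu : eq_on3 lam mu -> eq_on3 (Rrow23 x y lam) (Rrow23 x y mu).
Proof. by move=> e a b c ha hb hc; apply: eq_Rrow => // *; exact: e. Qed.

(** The iterated coproduct is split as Delta(e) (x) 1 + (w (x) w) (x) e: [RE] treats the first part,
    [Rrow_weight] the second. *)
Lemma Rrow12_Erow3 i x y z lam : (i <= n)%N ->
  eq_on3 (Rrow12 x y (Erow3 i y x z lam)) (Erow3 i x y z (Rrow12 x y lam)).
Proof.
move=> hi a b c ha hb hc; rewrite /Rrow12.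
transitivity (R x y (fun p q => 1 * E i y x (fun p q => lam p q c) p q
   + (spec i z * xe i c) * (wv i p * wv i q * lam p q (pd c))) a b).
  by apply: eq_Rrow => // p q _ _; rewrite /Erow3 /Erow; ring.
rewrite Rrow_lin RE // (@Rrow_weight (fun k => wv i k)) //; last exact: wv_dual.
by rewrite /Erow3 /Erow; ring.
Qed.

(** Here the split is e (x) 1 (x) 1 + w (x) Delta(e), so [RE] and linearity suffice. *)
Lemma Rrow23_Erow3 i x y z lam : (i <= n)%N ->
  eq_on3 (Rrow23 x y (Erow3 i z y x lam)) (Erow3 i z x y (Rrow23 x y lam)).
Proof.
move=> hi a b c ha hb hc; rewrite /Rrow23.
transitivity (R x y (fun p q => (spec i z * xe i a) * lam (pd a) p q
   + wv i a * E i y x (lam a) p q) b c).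
  by apply: eq_Rrow => // p q _ _; rewrite /Erow3 /Erow; ring.
by rewrite Rrow_lin RE // /Erow3 /Erow; ring.
Qed.

Lemma Frow_pos i x y f k l : (0 < i)%N ->
  F i x y f k l = yf i k * wv' i l * f (sc k) l + yf i l * f k (sc l).
Proof. by case: i => // i _; rewrite /Frow /spec /= !mul1r. Qed.

Lemma Rrow12_Frow3 i x y lam : (0 < i <= n)%N ->
  eq_on3 (Rrow12 x y (Frow3 i lam)) (Frow3 i (Rrow12 x y lam)).
Proof.
move=> /andP[i0 hi] a b c ha hb hc; rewrite /Rrow12.
transitivity (R x y (fun p q => wv' i c * F i x y (fun p q => lam p q c) p q
   + yf i c * lam p q (sc c)) a b).
  by apply: eq_Rrow => // p q _ _; rewrite /Frow3 Frow_pos //; ring.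
by rewrite Rrow_lin RF // /Frow3 Frow_pos //; ring.
Qed.

Lemma Rrow23_Frow3 i x y lam : (0 < i <= n)%N ->
  eq_on3 (Rrow23 x y (Frow3 i lam)) (Frow3 i (Rrow23 x y lam)).
Proof.
move=> /andP[i0 hi] a b c ha hb hc; rewrite /Rrow23.
transitivity (R x y (fun p q => yf i a * (wv' i p * wv' i q * lam (sc a) p q)
   + 1 * F i x y (lam a) p q) b c).
  by apply: eq_Rrow => // p q _ _; rewrite /Frow3 Frow_pos //; ring.
rewrite Rrow_lin RF // (@Rrow_weight (fun k => wv' i k)) //; last exact: wv'_dual.
by rewrite /Frow3 Frow_pos //; ring.
Qed.

Lemma eq_on3_trans lam mu nu : eq_on3 lam mu -> eq_on3 mu nu -> eq_on3 lam nu.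
Proof. by move=> e e' a b c ha hb hc; rewrite e // e'. Qed.

Lemma ybe_lhs_Erow3 i u v w lam : (i <= n)%N ->
  eq_on3 (ybe_lhs u v w (Erow3 i w v u lam)) (Erow3 i u v w (ybe_lhs u v w lam)).
Proof.
move=> hi; rewrite /ybe_lhs.
apply: eq_on3_trans (Rrow12_Erow3 _ _ _ _ hi); apply: Rrow12_ext.
apply: eq_on3_trans (Rrow23_Erow3 _ _ _ _ hi); apply: Rrow23_ext.
exact: Rrow12_Erow3.
Qed.
Lemma ybe_rhs_Erow3 i u v w lam : (i <= n)%N ->
  eq_on3 (ybe_rhs u v w (Erow3 i w v u lam)) (Erow3 i u v w (ybe_rhs u v w lam)).
Proof.
move=> hi; rewrite /ybe_rhs.
apply: eq_on3_trans (Rrow23_Erow3 _ _ _ _ hi); apply: Rrow23_ext.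
apply: eq_on3_trans (Rrow12_Erow3 _ _ _ _ hi); apply: Rrow12_ext.
exact: Rrow23_Erow3.
Qed.
Lemma ybe_lhs_Frow3 i u v w lam : (0 < i <= n)%N ->
  eq_on3 (ybe_lhs u v w (Frow3 i lam)) (Frow3 i (ybe_lhs u v w lam)).
Proof.
move=> hi; rewrite /ybe_lhs.
apply: eq_on3_trans (Rrow12_Frow3 _ _ _ hi); apply: Rrow12_ext.
apply: eq_on3_trans (Rrow23_Frow3 _ _ _ hi); apply: Rrow23_ext.
exact: Rrow12_Frow3.
Qed.
Lemma ybe_rhs_Frow3 i u v w lam : (0 < i <= n)%N ->
  eq_on3 (ybe_rhs u v w (Frow3 i lam)) (Frow3 i (ybe_rhs u v w lam)).
Proof.
move=> hi; rewrite /ybe_rhs.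
apply: eq_on3_trans (Rrow23_Frow3 _ _ _ hi); apply: Rrow23_ext.
apply: eq_on3_trans (Rrow12_Frow3 _ _ _ hi); apply: Rrow12_ext.
exact: Rrow23_Frow3.
Qed.
End Intertwine.
End Three.

(** * The difference of the two sides on the base vectors *)

Section Base.
Context {K : fieldType} (n : nat) (rh sh : K).
Context {A : comNzRingType} (phi : {rmorphism K -> A}).
Hypotheses (rh0 : rh != 0) (sh0 : sh != 0) (n2 : (2 <= n)%N).
Local Notation r12 := (Rrow12 n rh sh phi).
Local Notation r23 := (Rrow23 n rh sh phi).
Local Notation q := (phi (qq rh sh)).
Local Notation xi := (phi (xi n rh sh)).
Local Notation P := (phi (a_scal n rh sh 1 2)).
Local Notation Q := (phi (a_scal n rh sh 2 1)).

Definition ybe_diff u v w lam a b c : A :=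
  ybe_lhs n rh sh phi u v w lam a b c - ybe_rhs n rh sh phi u v w lam a b c.

Lemma ybe_diff_base u v w lam :
  [/\ ybe_diff u v w lam 1 1 1 = 0, ybe_diff u v w lam 2 1 1 = 0 & ybe_diff u v w lam 1 2 1 = 0].
Proof.
have h1 : in_range n 1 by rewrite /in_range; lia.
have h12 : (2 != primed n 1)%N by rewrite /primed; lia.
have h21 : (1 != primed n 2)%N by rewrite /primed; lia.
have e11 x y f k : r12 x y f 1 1 k = (x - q * y) * (x - xi * y) * f 1%N 1%N k.
  by rewrite /Rrow12 Rrow_diag.
have e12 x y f k : r12 x y f 1 2 k = (1 - q) * (x * (x - xi * y)) * f 1%N 2%N k
   + Q * ((x - y) * (x - xi * y)) * f 2%N 1%N k.
  by rewrite /Rrow12 Rrow_lt // rmorphB rmorph1.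
have e21 x y f k : r12 x y f 2 1 k = (1 - q) * (y * (x - xi * y)) * f 2%N 1%N k
   + P * ((x - y) * (x - xi * y)) * f 1%N 2%N k.
  by rewrite /Rrow12 Rrow_gt // rmorphB rmorph1.
have f11 x y f k : r23 x y f k 1 1 = (x - q * y) * (x - xi * y) * f k 1%N 1%N.
  by rewrite /Rrow23 Rrow_diag.
have f12 x y f k : r23 x y f k 1 2 = (1 - q) * (x * (x - xi * y)) * f k 1%N 2%N
   + Q * ((x - y) * (x - xi * y)) * f k 2%N 1%N.
  by rewrite /Rrow23 Rrow_lt // rmorphB rmorph1.
have f21 x y f k : r23 x y f k 2 1 = (1 - q) * (y * (x - xi * y)) * f k 2%N 1%N
   + P * ((x - y) * (x - xi * y)) * f k 1%N 2%N.
  by rewrite /Rrow23 Rrow_gt // rmorphB rmorph1.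
(* Beyond the shape of the rows, the six-vertex identities need just this relation: of a_12 and a_21
   one carries s and the other r^-1. *)
have PQ : q = P * Q.
  rewrite -rmorphM !(a_scalE n rh0 sh0) /a_scal_cond /primed.
  have -> : (2 <= n)%N by [].
  have -> : (1 <= n)%N by lia.
  have -> : (1 < (2 * n).+1 - 2)%N by lia.
  have -> : (2 < (2 * n).+1 - 1)%N = true by lia.
  have -> : ((2 * n).+1 - 1 < 2)%N = false by lia.
  by congr (phi _).
by split; rewrite /ybe_diff /ybe_lhs /ybe_rhs !(e11,e12,e21,f11,f12,f21) PQ; ring.
Qed.

(** Linearity over the ring of parameters separates the three summands of e_0, which carry different
    parameters. *)
Lemma ybe_diff_lin u v w f g c d : eq_on3 n (ybe_diff u v w (fun i j k => c * f i j k + d * g i j k))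
   (fun i j k => c * ybe_diff u v w f i j k + d * ybe_diff u v w g i j k).
Proof.
have l12 x y f1 f2 : eq_on3 n (r12 x y (fun i j k => c * f1 i j k + d * f2 i j k))
   (fun i j k => c * r12 x y f1 i j k + d * r12 x y f2 i j k).
  by move=> i j k *; rewrite /Rrow12 Rrow_lin.
have l23 x y f1 f2 : eq_on3 n (r23 x y (fun i j k => c * f1 i j k + d * f2 i j k))
   (fun i j k => c * r23 x y f1 i j k + d * r23 x y f2 i j k).
  by move=> i j k *; rewrite /Rrow23 Rrow_lin.
have h1 : eq_on3 n (ybe_lhs n rh sh phi u v w (fun i j k => c * f i j k + d * g i j k))
   (fun i j k => c * ybe_lhs n rh sh phi u v w f i j k + d * ybe_lhs n rh sh phi u v w g i j k).
  apply: eq_on3_trans (l12 _ _ _ _); apply: Rrow12_ext.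
  by apply: eq_on3_trans (l23 _ _ _ _); apply: Rrow23_ext.
have h2 : eq_on3 n (ybe_rhs n rh sh phi u v w (fun i j k => c * f i j k + d * g i j k))
   (fun i j k => c * ybe_rhs n rh sh phi u v w f i j k + d * ybe_rhs n rh sh phi u v w g i j k).
  apply: eq_on3_trans (l23 _ _ _ _); apply: Rrow23_ext.
  by apply: eq_on3_trans (l12 _ _ _ _); apply: Rrow12_ext.
by move=> i j k hi hj hk; rewrite /ybe_diff h1 // h2 //; ring.
Qed.
Lemma Erow3_sub i x y z (f g : nat -> nat -> nat -> A) a b c :
  Erow3 n rh sh phi i x y z (fun a b c => f a b c - g a b c) a b c
  = Erow3 n rh sh phi i x y z f a b c - Erow3 n rh sh phi i x y z g a b c.
Proof. by rewrite /Erow3; ring. Qed.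
Lemma Frow3_sub i (f g : nat -> nat -> nat -> A) a b c :
  Frow3 n rh sh phi i (fun a b c => f a b c - g a b c) a b c
  = Frow3 n rh sh phi i f a b c - Frow3 n rh sh phi i g a b c.
Proof. by rewrite /Frow3; ring. Qed.
End Base.

(* In the application mu, muv, muw are the coefficients of D f, v D f and w D f at a
   fixed monomial w^m v^l, so that muv and muw only involve earlier coefficients. *)
Section Cyclic.
Context {K : fieldType} (n : nat) (rh sh : K).
Hypotheses (rh0 : rh != 0) (sh0 : sh != 0) (n2 : (2 <= n)%N).
Context {C : idomainType} (chi : {rmorphism K -> C}) (u0 : C).
Hypothesis u00 : u0 != 0.
Local Notation fn := (nat -> nat -> nat -> C).
Implicit Type f : fn.
Variables mu muv muw : fn -> fn.
Definition e0_first f a b c := chi (e_coef n 0 a) * f (e_idx n a) b c.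
Definition e0_second f a b c := chi (w_wt n rh sh 0 a) * chi (e_coef n 0 b) * f a (e_idx n b) c.
Definition e0_third f a b c := chi (w_wt n rh sh 0 a) * chi (w_wt n rh sh 0 b) * chi (e_coef n 0 c)
  * f a b (e_idx n c).
Hypothesis mu_E : forall i f a b c, (0 < i <= n)%N -> in_range n a -> in_range n b -> in_range n c ->
  mu (Erow3 n rh sh chi i 1 1 1 f) a b c =
  chi (e_coef n i a) * mu f (e_idx n a) b c
  + chi (w_wt n rh sh i a) * chi (e_coef n i b) * mu f a (e_idx n b) c
  + chi (w_wt n rh sh i a) * chi (w_wt n rh sh i b) * chi (e_coef n i c) * mu f a b (e_idx n c).
Hypothesis mu_F : forall i f a b c, (0 < i <= n)%N -> in_range n a -> in_range n b -> in_range n c ->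
  mu (Frow3 n rh sh chi i f) a b c =
  chi (f_coef n rh sh i a) * chi (w'_wt n rh sh i b) * chi (w'_wt n rh sh i c) * mu f (f_idx n a) b c
  + chi (f_coef n rh sh i b) * chi (w'_wt n rh sh i c) * mu f a (f_idx n b) c
  + chi (f_coef n rh sh i c) * mu f a b (f_idx n c).
Hypothesis mu_E0 : forall f a b c, in_range n a -> in_range n b -> in_range n c ->
  muw (e0_first f) a b c + muv (e0_second f) a b c + u0 * mu (e0_third f) a b c
  = u0 * (chi (e_coef n 0 a) * mu f (e_idx n a) b c)
    + chi (w_wt n rh sh 0 a) * chi (e_coef n 0 b) * muv f a (e_idx n b) c
    + chi (w_wt n rh sh 0 a) * chi (w_wt n rh sh 0 b) * chi (e_coef n 0 c)
      * muw f a b (e_idx n c).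
Hypothesis IHw : forall f a b c, in_range n a -> in_range n b -> in_range n c -> muw f a b c = 0.
Hypothesis IHv : forall f a b c, in_range n a -> in_range n b -> in_range n c -> muv f a b c = 0.
Let Z a b c := forall f, mu f a b c = 0.
Hypotheses (Z111 : Z 1 1 1) (Z121 : Z 1 2 1) (Z2N1 : Z 2 (2 * n) 1).

Let inr1 : in_range n 1. Proof. by rewrite /in_range; lia. Qed.
Let inr2 : in_range n 2. Proof. by rewrite /in_range; lia. Qed.
Let inrN : in_range n (2 * n). Proof. by rewrite /in_range; lia. Qed.
(** The label of the edge between v_(k+1) and v_k: e_(lab k) takes v_(k+1) to a multiple of v_k, and
    f_(lab k) goes back. *)
Let lab k := if (k <= n)%N then k else (2 * n - k)%N.
Let pdS k : (0 < k)%N -> e_idx n k.+1 = k.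
Proof. by rewrite /e_idx; case: eqP; lia. Qed.
Let xe_lab k : (0 < k < 2 * n)%N -> e_coef n (lab k) k.+1 = 1 :> K \/ e_coef n (lab k) k.+1 = -1 :> K.
Proof.
move=> hk; rewrite /e_coef /lab; case: (leqP k n) => h.
  rewrite (_ : (k == 0)%N = false); last by lia.
  case: (k =P n) => [->|kn]; first by rewrite eqxx; left.
  rewrite eqxx (_ : (k.+1 == primed n k) = false) ?subr0; first by left.
  by rewrite /primed; lia.
rewrite (_ : (2 * n - k == 0)%N = false); last by lia.
rewrite (_ : (2 * n - k == n)%N = false); last by lia.
rewrite (_ : (k.+1 == (2 * n - k).+1) = false); last by lia.
rewrite (_ : (k.+1 == primed n (2 * n - k)) = true) ?sub0r; first by right.
by rewrite /primed; lia.
Qed.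
Let xe1 i : (0 < i)%N -> (i <= n)%N -> e_coef n i 1 = 0 :> K.
Proof.
move=> i0 hi; rewrite /e_coef (_ : (i == 0)%N = false); last by lia.
case: (i =P n) => [_|ne]; first by rewrite (_ : (1 == n.+1)%N = false) //; lia.
rewrite (_ : (1 == i.+1)%N = false); last by lia.
by rewrite (_ : (1 == primed n i)%N = false) ?subr0 // /primed; lia.
Qed.
Let lab_ok k : (0 < k < 2 * n)%N -> (0 < lab k <= n)%N.
Proof. by rewrite /lab; case: ifP; lia. Qed.

(** The step across the e_0 edge. Terms with the parameter v or w are earlier coefficients and
    vanish; on the source side the remaining term is a value at v_1 v_b v_c, zero by assumption.
    What is left is e_0 on the first factor, taking v_1 to v_2n with the nonzero factor [u0]. *)
Let ZA b c : in_range n b -> in_range n c -> Z 1 b c -> Z (2 * n) b c.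
Proof.
move=> hb hc z f.
have := mu_E0 f inr1 hb hc.
rewrite IHw // IHv // z IHv ?e_idx_in_range // IHw ?e_idx_in_range //.
rewrite !mulr0 !addr0 /e_coef /= rmorph1 mul1r => /esym/eqP.
by rewrite mulf_eq0 (negPf u00) /= /e_idx /= => /eqP.
Qed.

(** Descent of the first index from 2n, reached by [ZA], along the e_i. Each relation also contains
    terms with the second or third index lowered: the last two hypotheses dispose of them, and an
    index 1 is killed by every e_i with i > 0. *)
Lemma vanish_along_e b c : in_range n b -> in_range n c -> Z 1 b c ->
  ((1 < b)%N -> forall a, in_range n a -> Z a b.-1 c) ->
  ((1 < c)%N -> forall a, in_range n a -> Z a b c.-1) ->
  forall a, in_range n a -> Z a b c.
Proof.
move=> hb hc z1 hbc hcc.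
suff h d : (d < 2 * n)%N -> Z (2 * n - d) b c.
  move=> a; rewrite /in_range => ha; have := h (2 * n - a)%N.
  by rewrite subKn; [apply; lia|lia].
elim: d => [|d IH] hd; first by rewrite subn0; exact: ZA.
have {}IH := IH (ltnW hd).
set k := (2 * n - d.+1)%N; have hk : (0 < k < 2 * n)%N by rewrite /k; lia.
have ek : (2 * n - d = k.+1)%N by rewrite /k; lia.
rewrite ek in IH; have hl := lab_ok hk; move=> f.
have hk1 : in_range n k.+1 by rewrite /in_range; lia.
have := mu_E f hl hk1 hb hc; rewrite IH => /esym; rewrite pdS; last by lia.
have hb0 : chi (e_coef n (lab k) b) * mu f k.+1 (e_idx n b) c = 0.
  case: (b =P 1%N) => [->|b1]; first by rewrite xe1 ?rmorph0 ?mul0r //; lia.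
  have b2 : (1 < b)%N by move: hb; rewrite /in_range; lia.
  rewrite (_ : e_idx n b = b.-1); last by rewrite /e_idx; case: eqP.
  by rewrite (hbc b2 _ hk1) mulr0.
have hc0 : chi (e_coef n (lab k) c) * mu f k.+1 b (e_idx n c) = 0.
  case: (c =P 1%N) => [->|c1]; first by rewrite xe1 ?rmorph0 ?mul0r //; lia.
  have c2 : (1 < c)%N by move: hc; rewrite /in_range; lia.
  rewrite (_ : e_idx n c = c.-1); last by rewrite /e_idx; case: eqP.
  by rewrite (hcc c2 _ hk1) mulr0.
rewrite -(mulrA _ _ (mu f k.+1 (e_idx n b) c)) hb0 -(mulrA _ _ (mu f k.+1 b (e_idx n c))) hc0.
rewrite !mulr0 !addr0 => /eqP; rewrite mulf_eq0 fmorph_eq0.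
case: (xe_lab hk) => ->; first by rewrite oner_eq0 => /eqP.
by rewrite oppr_eq0 oner_eq0 => /eqP.
Qed.

Let yf_lab k : (0 < k < 2 * n)%N -> f_coef n rh sh (lab k) k != 0.
Proof.
move=> hk; rewrite /f_coef /lab; case: (leqP k n) => h.
  rewrite (_ : (k == 0)%N = false); last by lia.
  case: (k =P n) => [_|kn]; first by rewrite oner_eq0.
  rewrite eqxx (_ : (k == primed n k.+1) = false) ?mulr0 ?subr0 ?oner_eq0 //.
  by rewrite /primed; lia.
rewrite (_ : (2 * n - k == 0)%N = false); last by lia.
rewrite (_ : (2 * n - k == n)%N = false); last by lia.
rewrite (_ : (k == (2 * n - k))%N = false); last by lia.
rewrite (_ : (k == primed n (2 * n - k).+1) = true); last by rewrite /primed; lia.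
by rewrite sub0r oppr_eq0 mulr1 invr_eq0 mulf_neq0 ?expf_neq0.
Qed.
Let yf1 i : (1 < i <= n)%N -> f_coef n rh sh i 1 = 0.
Proof.
move=> hi; rewrite /f_coef (_ : (i == 0)%N = false); last by lia.
rewrite (_ : (1 == n)%N = false); last by lia.
rewrite (_ : (1 == i)%N = false); last by lia.
rewrite (_ : (1 == primed n i.+1)%N = false) ?mulr0 ?subr0 ?if_same //.
by rewrite /primed; lia.
Qed.
Let scS k : (k < 2 * n)%N -> f_idx n k = k.+1.
Proof. by rewrite /f_idx; case: eqP; lia. Qed.

(** f_(lab b) takes v_b to v_(b+1) in the second factor and must kill the third factor v_1. It does
    so unless lab b is 1, which excludes b = 1 and b = 2n - 1. *)
Lemma vanish_step_second b : (1 < b < 2 * n - 1)%N -> (forall a, in_range n a -> Z a b 1) ->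
  forall a, in_range n a -> Z a b.+1 1.
Proof.
move=> hb P a ha f.
have hl : (1 < lab b <= n)%N by rewrite /lab; case: ifP; lia.
have hl' : (0 < lab b <= n)%N by lia.
have hbi : in_range n b by rewrite /in_range; lia.
have := mu_F f hl' ha hbi inr1; rewrite P // => /esym.
rewrite (P _ (f_idx_in_range ha)) (yf1 hl) rmorph0 !mul0r mulr0 addr0 add0r scS; last by lia.
move=> /eqP; rewrite -rmorphM mulf_eq0 fmorph_eq0.
by rewrite mulf_eq0 (negPf (yf_lab _)) ?(negPf (w'_wt_neq0 _ rh0 sh0 _ _)) /= => [/eqP|]; [|lia].
Qed.

(** Once all first and second indices are covered for c, the terms of f_(lab c) in those factors
    vanish by hypothesis and the term with v_(c+1) is isolated. *)
Lemma vanish_step_third c : (0 < c < 2 * n)%N ->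
  (forall a b, in_range n a -> in_range n b -> Z a b c) ->
  forall a b, in_range n a -> in_range n b -> Z a b c.+1.
Proof.
move=> hc P a b ha hb f.
have hci : in_range n c by rewrite /in_range; lia.
have := mu_F f (lab_ok hc) ha hb hci; rewrite P // => /esym.
rewrite (P _ _ (f_idx_in_range ha) hb) (P _ _ ha (f_idx_in_range hb)) !mulr0 !add0r scS; last by lia.
by move=> /eqP; rewrite mulf_eq0 fmorph_eq0 (negPf (yf_lab hc)) /= => /eqP.
Qed.

Lemma vanish_everywhere a b c : in_range n a -> in_range n b -> in_range n c -> Z a b c.
Proof.
have P11 : forall a, in_range n a -> Z a 1 1.
  by apply: vanish_along_e => //.
have P21 : forall a, in_range n a -> Z a 2 1.
  by apply: vanish_along_e => //.
have Pb1 : forall d, (d.+2 < 2 * n)%N -> forall a, in_range n a -> Z a d.+2 1.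
  by elim=> [|d IH] hd //; apply: vanish_step_second; [lia|apply: IH; lia].
(* The excluded edge from 2n - 1 to 2n. The relation for e_1 at v_2 v_2n v_1 derives v_1 v_2n v_1
   from [Z2N1], because its other term has second index 2n - 1; then the descent applies. *)
have PN1 : forall a, in_range n a -> Z a (2 * n) 1.
  have hN1 : forall a, in_range n a -> Z a (2 * n).-1 1.
    have -> : (2 * n).-1 = (2 * n - 3).+2 by lia.
    by apply: Pb1; lia.
  apply: vanish_along_e => // f.
  have l1 : (0 < 1 <= n)%N by lia.
  have := mu_E f l1 inr2 inrN inr1; rewrite Z2N1 => /esym.
  rewrite pdS // (@xe1 1) //; [|lia..].
  rewrite (_ : e_idx n (2 * n) = (2 * n).-1); last by rewrite /e_idx; case: eqP; lia.
  rewrite (hN1 2) // rmorph0 !mulr0 mul0r !addr0.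
  move=> /eqP; rewrite mulf_eq0 fmorph_eq0.
  have /xe_lab : (0 < 1 < 2 * n)%N by lia.
  rewrite /lab (_ : (1 <= n)%N); last by lia.
  by case=> ->; rewrite ?oppr_eq0 oner_eq0 => /eqP.
have Pc1 a' b' : in_range n a' -> in_range n b' -> Z a' b' 1.
  move=> ha hb; case: (b' =P 1%N) => [->|b1]; first exact: P11.
  case: (b' =P (2 * n)%N) => [->|bN]; first exact: PN1.
  have -> : b' = (b' - 2).+2 by move: hb; rewrite /in_range; lia.
  by apply: Pb1 => //; move: hb; rewrite /in_range; lia.
move=> ha hb hc.
suff h d : (d < 2 * n)%N -> forall a b, in_range n a -> in_range n b -> Z a b d.+1.
  move: hc; rewrite /in_range => hc; have -> : c = c.-1.+1 by lia.
  by apply: h => //; lia.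
by elim: d => [|d IH] hd; [exact: Pc1|apply: vanish_step_third; [lia|apply: IH; lia]].
Qed.
End Cyclic.

(** * Induction on the coefficients in w and v *)

Section Leading.
Context {K : fieldType} (n : nat) (rh sh : K).
Hypotheses (rh0 : rh != 0) (sh0 : sh != 0) (n2 : (2 <= n)%N).
Context {C : idomainType} (chi : {rmorphism K -> C}) (u0 : C).
Hypothesis u00 : u0 != 0.
Local Notation A := {poly {poly C}}.
Local Notation fnA := (nat -> nat -> nat -> A).
Variable phi : {rmorphism K -> A}.
Hypothesis phiE : forall c, phi c = (chi c)%:P%:P.
Local Notation u := (u0%:P%:P : A).
Local Notation v := ('X%:P : A).
Local Notation w := ('X : A).
Variable D : fnA -> fnA.
Hypothesis D_ext : forall f g, eq_on3 n f g -> eq_on3 n (D f) (D g).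
Hypothesis D_lin : forall f g c d,
  eq_on3 n (D (fun i j k => c * f i j k + d * g i j k))
        (fun i j k => c * D f i j k + d * D g i j k).
Hypothesis D_E3 : forall i f, (i <= n)%N ->
  eq_on3 n (D (Erow3 n rh sh phi i w v u f)) (Erow3 n rh sh phi i u v w (D f)).
Hypothesis D_F3 : forall i f, (0 < i <= n)%N ->
  eq_on3 n (D (Frow3 n rh sh phi i f)) (Frow3 n rh sh phi i (D f)).
Hypothesis D_base : forall f,
  [/\ D f 1%N 1%N 1%N = 0, D f 2%N 1%N 1%N = 0 & D f 1%N 2%N 1%N = 0].

(** Test functionals constant in v and w; they include the delta functionals that pick out matrix
    entries. *)
Let cst (f : nat -> nat -> nat -> C) a b c : A := (f a b c)%:P%:P.
Let cf m l (p : A) : C := (p`_m)`_l.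
Let cfD3 m l p p' p'' : cf m l (p + p' + p'') = cf m l p + cf m l p' + cf m l p''.
Proof. by rewrite /cf !coefD. Qed.
Let cfC m l c p : cf m l (c%:P%:P * p) = c * cf m l p.
Proof. by rewrite /cf !coefCM. Qed.
Let cfphi m l c p : cf m l (phi c * p) = chi c * cf m l p.
Proof. by rewrite phiE cfC. Qed.
Let cfphi2 m l c d p : cf m l (phi c * phi d * p) = chi c * chi d * cf m l p.
Proof. by rewrite -mulrA !cfphi mulrA. Qed.
Let cfphi3 m l c d e p :
  cf m l (phi c * phi d * phi e * p) = chi c * chi d * chi e * cf m l p.
Proof. by rewrite -!mulrA !cfphi !mulrA. Qed.

Let mu m l (f : nat -> nat -> nat -> C) a b c := cf m l (D (cst f) a b c).
Let muw m l (f : nat -> nat -> nat -> C) a b c := cf m l (w * D (cst f) a b c).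
Let muv m l (f : nat -> nat -> nat -> C) a b c := cf m l (v * D (cst f) a b c).

Let mu_E m l i f a b c : (0 < i <= n)%N -> in_range n a -> in_range n b -> in_range n c ->
  mu m l (Erow3 n rh sh chi i 1 1 1 f) a b c =
  chi (e_coef n i a) * mu m l f (e_idx n a) b c
  + chi (w_wt n rh sh i a) * chi (e_coef n i b) * mu m l f a (e_idx n b) c
  + chi (w_wt n rh sh i a) * chi (w_wt n rh sh i b) * chi (e_coef n i c) * mu m l f a b (e_idx n c).
Proof.
move=> /andP[i0 hi] ha hb hc; rewrite /mu.
have spec1 (B : comNzRingType) (x : B) : spec i x = 1 by rewrite /spec gtn_eqF.
rewrite -cfphi -cfphi2 -cfphi3 -cfD3; congr (cf _ _ _).
transitivity (Erow3 n rh sh phi i u v w (D (cst f)) a b c).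
  rewrite -D_E3 //; apply: D_ext => // p q r _ _ _.
  by rewrite /cst /Erow3 !spec1 !mul1r !phiE !(polyCD, polyCM).
by rewrite /Erow3 !spec1 !mul1r.
Qed.

Let mu_F m l i f a b c : (0 < i <= n)%N -> in_range n a -> in_range n b -> in_range n c ->
  mu m l (Frow3 n rh sh chi i f) a b c =
  chi (f_coef n rh sh i a) * chi (w'_wt n rh sh i b) * chi (w'_wt n rh sh i c) * mu m l f (f_idx n a) b c
  + chi (f_coef n rh sh i b) * chi (w'_wt n rh sh i c) * mu m l f a (f_idx n b) c
  + chi (f_coef n rh sh i c) * mu m l f a b (f_idx n c).
Proof.
move=> hi ha hb hc; rewrite /mu.
rewrite -cfphi -cfphi2 -cfphi3 -cfD3; congr (cf _ _ _).
transitivity (Frow3 n rh sh phi i (D (cst f)) a b c); last by [].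
rewrite -D_F3 //; apply: D_ext => // p q r _ _ _.
by rewrite /cst /Frow3 !phiE !(polyCD, polyCM).
Qed.

(** The source side carries the parameters in the order w, v, u and the target side in the order u,
    v, w. Hence the term with the constant u is the third on one side and the first on the other. *)
Let mu_E0 m l f a b c : in_range n a -> in_range n b -> in_range n c ->
  muw m l (e0_first n chi f) a b c + muv m l (e0_second n rh sh chi f) a b c
    + u0 * mu m l (e0_third n rh sh chi f) a b c
  = u0 * (chi (e_coef n 0 a) * mu m l f (e_idx n a) b c)
    + chi (w_wt n rh sh 0 a) * chi (e_coef n 0 b) * muv m l f a (e_idx n b) c
    + chi (w_wt n rh sh 0 a) * chi (w_wt n rh sh 0 b) * chi (e_coef n 0 c)
      * muw m l f a b (e_idx n c).
Proof.
move=> ha hb hc; rewrite /mu /muv /muw.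
rewrite -cfphi -cfphi2 -cfphi3 -!cfC -!cfD3; congr (cf _ _ _).
transitivity (Erow3 n rh sh phi 0 u v w (D (cst f)) a b c); last first.
  by rewrite /Erow3 /spec /=; ring.
rewrite -D_E3 //.
transitivity (D (fun i j k => 1 * (w * cst (e0_first n chi f) i j k + v * cst (e0_second n rh sh chi f) i j k)
   + u * cst (e0_third n rh sh chi f) i j k) a b c).
  by rewrite D_lin // D_lin // mul1r.
apply: D_ext => // i j k _ _ _.
rewrite /cst /e0_first /e0_second /e0_third /Erow3 /spec /= !phiE !polyCM.
by ring.
Qed.

(** Multiplication by w or v shifts the index, so that [muw] and [muv] at (m, l) are the
    coefficients at (m - 1, l) and (m, l - 1), or zero at the boundary. *)
Let cfw m l p : cf m.+1 l (w * p) = cf m l p.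
Proof. by rewrite /cf coefXM. Qed.
Let cfw0 l p : cf 0 l (w * p) = 0.
Proof. by rewrite /cf coefXM /= coef0. Qed.
Let cfv m l p : cf m l.+1 (v * p) = cf m l p.
Proof. by rewrite /cf coefCM coefXM. Qed.
Let cfv0 m p : cf m 0 (v * p) = 0.
Proof. by rewrite /cf coefCM coefXM. Qed.

Lemma coefficient_vanish m l f a b c : in_range n a -> in_range n b -> in_range n c -> mu m l f a b c = 0.
Proof.
have step m' l' : (forall l f a b c, in_range n a -> in_range n b -> in_range n c -> muw m' l f a b c = 0) ->
    (forall f a b c, in_range n a -> in_range n b -> in_range n c -> muv m' l' f a b c = 0) ->
  forall f a b c, in_range n a -> in_range n b -> in_range n c -> mu m' l' f a b c = 0.
  move=> IHw IHv g a' b' c' ha hb hc.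
  apply: (@vanish_everywhere K n rh sh rh0 sh0 n2 C chi u0 u00 (mu m' l') (muv m' l') (muw m' l')) => //.
  - by move=> *; exact: mu_E.
  - by move=> *; exact: mu_F.
  - by move=> *; exact: mu_E0.
  - by move=> *; exact: IHw.
  - by move=> h; rewrite /mu; have [-> _ _] := D_base (cst h); rewrite /cf !coef0.
  - by move=> h; rewrite /mu; have [_ _ ->] := D_base (cst h); rewrite /cf !coef0.
  move=> h.
  have i1 : in_range n 1 by rewrite /in_range; lia.
  have i2 : in_range n 2 by rewrite /in_range; lia.
  have hN : in_range n (2 * n) by rewrite /in_range; lia.
  (* The vector v_2 v_2n v_1 comes from the e_0 relation at v_2 v_1 v_1, read at v^(l+1): the term
     in which e_0 takes the middle v_1 to v_2n carries the parameter v and so gives the coefficient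
     at v^l. For this reason [IHw] is required at every power of v. *)
  have := mu_E0 m' l'.+1 h i2 i1 i1.
  rewrite IHw // [muv _ _ _ 2 1 1]/muv [mu _ _ _ 2 1 1]/mu.
  have [_ -> _] := D_base (cst (e0_second n rh sh chi h)).
  have [_ -> _] := D_base (cst (e0_third n rh sh chi h)).
  rewrite IHw // /muv !cfv mulr0 {1 2}/cf !coef0 mulr0 !addr0.
  rewrite /e_coef /= rmorph0 mul0r mulr0 add0r rmorph1 mulr1 => /esym/eqP.
  by rewrite mulf_eq0 fmorph_eq0 (negPf (w_wt_neq0 _ rh0 sh0 _ _)) /= => /eqP.
elim: m l f a b c => [|m IHm].
  elim=> [|l IHl] f a b c; apply: step => *; rewrite /muw /muv ?cfw0 ?cfv0 ?cfv //.
  exact: IHl.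
elim=> [|l IHl] f a b c; apply: step => *; rewrite /muw /muv ?cfw ?cfv0 ?cfv //;
  solve [exact: IHm | exact: IHl].
Qed.

Lemma vanish_on_constants f a b c : in_range n a -> in_range n b -> in_range n c -> D (cst f) a b c = 0.
Proof.
move=> ha hb hc; apply/polyP => m; apply/polyP => l.
by rewrite !coef0; exact: coefficient_vanish.
Qed.
End Leading.

(** * Matrix entries of R *)

Section Entry.
Context {K : fieldType} (n : nat) (rh sh : K).
Local Notation N := (2 * n)%N.

Definition delta2 {A : pzRingType} (p q a b : nat) : A := ((a == p) && (b == q))%:R.

Lemma sum_delta_l {V : nmodType} (F : nat -> V) (a : nat) : in_range n a ->
  \sum_(1 <= j < N.+1) (F j *+ (a == j)) = F a.
Proof.
move=> /andP[a1 a2]; rewrite (bigD1_seq a) ?mem_index_iota ?iota_uniq ?a1 //=.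
rewrite eqxx mulr1n big1 ?addr0 // => j; rewrite eq_sym => /negbTE ->.
by rewrite mulr0n.
Qed.

Lemma tensE_entry (A : pzRingType) (i j k l : nat) (p q a b : 'I_N) :
  (E n A i j *t E n A k l) (mxtens_index (p, q)) (mxtens_index (a, b))
  = [&& p.+1 == i, a.+1 == j, q.+1 == k & b.+1 == l]%:R.
Proof. by rewrite tensmxE !mxE -natrM mulnb -!andbA. Qed.

Lemma b_hom_poly i j : bcoef n rh sh i j = b_hom n rh sh polyC 'X 1 i j.
Proof.
rewrite /bcoef /b_hom !mulr1; case: ifP => _; first by rewrite mul_polyC.
by case: ifP => _; rewrite -?mul_polyC ?mul1r.
Qed.

(** At a fixed entry each of the five sums has at most one nonzero term. Once these are isolated,
    the comparison follows the three cases of [Rrow]: dual, diagonal, and generic. *)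
Lemma Rhat_entry (p q k l : 'I_N) :
  Rhat n rh sh (mxtens_index (p, q)) (mxtens_index (k, l))
  = Rrow n rh sh polyC 'X 1 (delta2 p.+1 q.+1) k.+1 l.+1.
Proof.
have hP : in_range n p.+1 by rewrite /in_range ltn_ord.
have hQ : in_range n q.+1 by rewrite /in_range ltn_ord.
have hk : in_range n k.+1 by rewrite /in_range ltn_ord.
have hl : in_range n l.+1 by rewrite /in_range ltn_ord.
rewrite /Rhat !mxE !summxE.
set P := p.+1; set Q := q.+1; set k1 := k.+1; set l1 := l.+1.
have -> : \sum_(1 <= i < N.+1) (E n {poly K} i i *t E n {poly K} i i)
     (mxtens_index (p, q)) (mxtens_index (k, l)) = [&& k1 == P, Q == P & l1 == P]%:R.
  rewrite -[RHS](@sum_delta_l _ (fun i => [&& k1 == i, Q == i & l1 == i]%:R) P) //.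
  apply: eq_bigr => i _; rewrite tensE_entry -/P -/Q -/k1 -/l1.
  by case: (P == i); rewrite ?mulr1n ?mulr0n.
have -> : \sum_(1 <= i < N.+1) (\sum_(1 <= j < N.+1 | (j != i) && (j != primed n i))
     acoef n rh sh i j *: (E n {poly K} i j *t E n {poly K} j i))
     (mxtens_index (p, q)) (mxtens_index (k, l))
   = acoef n rh sh P Q *+ [&& Q != P, Q != primed n P, k1 == Q & l1 == P].
  rewrite -[RHS](@sum_delta_l _ (fun i => acoef n rh sh i Q *+ [&& Q != i, Q != primed n i, k1 == Q & l1 == i]) P) //.
  apply: eq_bigr => i _; rewrite summxE big_mkcond /=.
  rewrite -(@sum_delta_l _ (fun j => acoef n rh sh i j *+ [&& j != i, j != primed n i, k1 == j & l1 == i]) Q) // -sumrMnl.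
  apply: eq_bigr => j _; rewrite mxE tensE_entry -/P -/Q -/k1 -/l1.
  case: (j != i); case: (j != primed n i); case: (P == i); case: (k1 == j); case: (Q == j); case: (l1 == i);
   by rewrite /= ?mulr1n ?mulr0n ?mulr1 ?mulr0 ?mul0rn.
have -> : (\sum_(1 <= i < N.+1) (\sum_(1 <= j < N.+1 | (j < i)%N && (j != primed n i))
     (E n {poly K} i i *t E n {poly K} j j)) (mxtens_index (p, q)) (mxtens_index (k, l)))
   = [&& (Q < P)%N, Q != primed n P, k1 == P & l1 == Q]%:R.
  rewrite -[RHS](@sum_delta_l _ (fun i => [&& (Q < i)%N, Q != primed n i, k1 == i & l1 == Q]%:R) P) //.
  apply: eq_bigr => i _; rewrite summxE big_mkcond /=.
  rewrite -(@sum_delta_l _ (fun j => [&& (j < i)%N, j != primed n i, k1 == i & l1 == j]%:R) Q) // -sumrMnl.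
  apply: eq_bigr => j _; rewrite tensE_entry -/P -/Q -/k1 -/l1.
  case: (j < i)%N; case: (j != primed n i); case: (P == i); case: (k1 == i); case: (Q == j); case: (l1 == j);
   by rewrite /= ?mulr1n ?mulr0n ?mul0rn.
have -> : (\sum_(1 <= i < N.+1) (\sum_(1 <= j < N.+1 | (i < j)%N && (j != primed n i))
     (E n {poly K} i i *t E n {poly K} j j)) (mxtens_index (p, q)) (mxtens_index (k, l)))
   = [&& (P < Q)%N, Q != primed n P, k1 == P & l1 == Q]%:R.
  rewrite -[RHS](@sum_delta_l _ (fun i => [&& (i < Q)%N, Q != primed n i, k1 == i & l1 == Q]%:R) P) //.
  apply: eq_bigr => i _; rewrite summxE big_mkcond /=.
  rewrite -(@sum_delta_l _ (fun j => [&& (i < j)%N, j != primed n i, k1 == i & l1 == j]%:R) Q) // -sumrMnl.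
  apply: eq_bigr => j _; rewrite tensE_entry -/P -/Q -/k1 -/l1.
  case: (i < j)%N; case: (j != primed n i); case: (P == i); case: (k1 == i); case: (Q == j); case: (l1 == j);
   by rewrite /= ?mulr1n ?mulr0n ?mul0rn.
have -> : (\sum_(1 <= i < N.+1) (\sum_(1 <= j < N.+1)
     bcoef n rh sh i j *: (E n {poly K} (primed n i) j *t E n {poly K} i (primed n j)))
        (mxtens_index (p, q)) (mxtens_index (k, l)))
   = bcoef n rh sh Q k1 *+ ((P == primed n Q) && (l1 == primed n k1)).
  rewrite -[RHS](@sum_delta_l _ (fun i => bcoef n rh sh i k1 *+ ((P == primed n i) && (l1 == primed n k1))) Q) //.
  apply: eq_bigr => i _; rewrite summxE.
  rewrite -(@sum_delta_l _ (fun j => bcoef n rh sh i j *+ ((P == primed n i) && (l1 == primed n j))) k1) // -sumrMnl.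
  apply: eq_bigr => j _; rewrite mxE tensE_entry -/P -/Q -/k1 -/l1.
  case: (P == primed n i); case: (k1 == j); case: (Q == i); case: (l1 == primed n j);
   by rewrite /= ?mulr1n ?mulr0n ?mulr1 ?mulr0 ?mul0rn.
rewrite /Rrow; case: (l1 =P primed n k1) => [el|nl].
  have -> : \sum_(1 <= i < N.+1) b_hom n rh sh polyC 'X 1 i k1 * delta2 P Q (primed n i) i
      = b_hom n rh sh polyC 'X 1 Q k1 *+ (primed n Q == P).
    rewrite -[RHS](@sum_delta_l _ (fun i => b_hom n rh sh polyC 'X 1 i k1 *+ (primed n i == P)) Q) //.
    apply: eq_bigr => i _; rewrite /delta2 (eq_sym i) mulr_natr.
    by case: (_ == P); case: (Q == i).
  rewrite andbT (eq_sym P) -b_hom_poly el.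
  have ne1 : (k1 == primed n k1) = false.
    by apply/eqP; move: hk; rewrite /in_range -/k1 /primed; lia.
  have -> : [&& k1 == P, Q == P & primed n k1 == P] = false.
    case: (k1 =P P) => //= <-; rewrite (eq_sym (primed _ _)) ne1 andbF //.
  have -> : [&& Q != P, Q != primed n P, k1 == Q & primed n k1 == P] = false.
    case: (k1 =P Q) => [<-|]; last by rewrite !andbF.
    case: (primed n k1 =P P) => [<-|]; last by rewrite !andbF.
    by rewrite primedK // eqxx !andbF.
  have -> : [&& (Q < P)%N, Q != primed n P, k1 == P & primed n k1 == Q] = false.
    case: (k1 =P P) => [<-|]; last by rewrite !andbF.
    case: (primed n k1 =P Q) => [<-|]; last by rewrite !andbF.
    by rewrite eqxx !andbF.
  have -> : [&& (P < Q)%N, Q != primed n P, k1 == P & primed n k1 == Q] = false.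
    case: (k1 =P P) => [<-|]; last by rewrite !andbF.
    case: (primed n k1 =P Q) => [<-|]; last by rewrite !andbF.
    by rewrite eqxx !andbF.
  by rewrite !mulr0 !add0r.
rewrite andbF mulr0n addr0; case: (k1 =P l1) => [e|ne].
  rewrite -e /delta2.
  have -> : [&& Q != P, Q != primed n P, k1 == Q & k1 == P] = false.
    by case: (k1 =P Q) => [<-|]; case: (k1 =P P) => [<-|]; rewrite ?eqxx ?andbF.
  have -> : [&& (Q < P)%N, Q != primed n P, k1 == P & k1 == Q] = false.
    by case: (k1 =P Q) => [<-|]; case: (k1 =P P) => [<-|]; rewrite ?ltnn ?andbF.
  have -> : [&& (P < Q)%N, Q != primed n P, k1 == P & k1 == Q] = false.
    by case: (k1 =P Q) => [<-|]; case: (k1 =P P) => [<-|]; rewrite ?ltnn ?andbF.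
  rewrite !mulr0 mulr0n !addr0 !mulr1; congr (_ * _%:R).
  by case: (k1 =P P) => [<-|] //=; rewrite andbT eq_sym.
have -> : [&& k1 == P, Q == P & l1 == P] = false.
  by case: (k1 =P P) => [<-|] //=; rewrite (introF eqP (not_eq_sym ne)) andbF.
rewrite mulr0 add0r /delta2.
have -> : [&& Q != P, Q != primed n P, k1 == Q & l1 == P] = (l1 == P) && (k1 == Q).
  case: (k1 =P Q) => [eQ|]; last by rewrite !andbF.
  case: (l1 =P P) => [eP|]; last by rewrite !andbF.
  rewrite -eQ -eP (introF eqP ne) /= !andbT; apply/eqP => h; apply: nl.
  by rewrite h primedK // -eP.
have -> : [&& (Q < P)%N, Q != primed n P, k1 == P & l1 == Q] = (l1 < k1)%N && ((k1 == P) && (l1 == Q)).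
  case: (k1 =P P) => [eP|]; last by rewrite !andbF.
  case: (l1 =P Q) => [eQ|]; last by rewrite !andbF.
  by rewrite -eQ -eP (introN eqP nl).
have -> : [&& (P < Q)%N, Q != primed n P, k1 == P & l1 == Q] = (k1 < l1)%N && ((k1 == P) && (l1 == Q)).
  case: (k1 =P P) => [eP|]; last by rewrite !andbF.
  case: (l1 =P Q) => [eQ|]; last by rewrite !andbF.
  by rewrite -eQ -eP (introN eqP nl).
rewrite !mulr1.
have -> : acoef n rh sh P Q *+ ((l1 == P) && (k1 == Q)) = (a_scal n rh sh l1 k1)%:P *
    (('X - 1) * ('X - (xi n rh sh)%:P)) * ((l1 == P) && (k1 == Q))%:R.
  case: (l1 =P P) => [<-|] /=; last by rewrite mulr0n mulr0.
  case: (k1 =P Q) => [<-|] /=; last by rewrite mulr0n mulr0.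
  by rewrite mulr1n mulr1 mul_polyC.
rewrite -!mul_polyC.
by case: (ltngtP l1 k1) => h //=; rewrite ?mulr0; [ring|ring|case: ne].
Qed.
End Entry.

Definition delta3 {A : pzRingType} (p q r a b c : nat) : A :=
  [&& a == p, b == q & c == r]%:R.

(** * Yang-Baxter equation for independent variables and its specialisations *)

Section Functional.
Context {K : fieldType} (n : nat) (rh sh : K).
Hypotheses (rh0 : rh != 0) (sh0 : sh != 0) (n2 : (2 <= n)%N).

Section Poly.
Local Notation C := {poly K}.
Local Notation A := {poly {poly C}}.
Let phiA : {rmorphism K -> A} := polyC \o (polyC \o polyC).

(** The variable of the coefficient ring [{poly K}] serves as u and the two outer variables as v and
    w, as the coefficient induction requires. *)
Lemma ybe_poly f : eq_on3 n
  (ybe_lhs n rh sh phiA 'X%:P%:P 'X%:P 'X (fun a b c => (f a b c)%:P%:P))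
  (ybe_rhs n rh sh phiA 'X%:P%:P 'X%:P 'X (fun a b c => (f a b c)%:P%:P)).
Proof.
move=> a b c ha hb hc; apply/eqP; rewrite -subr_eq0; apply/eqP.
have hE (i : nat) (x y : A) g k l : (i <= n)%N -> in_range n k -> in_range n l ->
   Rrow n rh sh phiA x y (Erow n rh sh phiA i y x g) k l
   = Erow n rh sh phiA i x y (Rrow n rh sh phiA x y g) k l by exact: Rrow_Erow.
have hF (i : nat) (x y : A) g k l : (i <= n)%N -> in_range n k -> in_range n l ->
   Rrow n rh sh phiA x y (Frow n rh sh phiA i x y g) k l
   = Frow n rh sh phiA i y x (Rrow n rh sh phiA x y g) k l by exact: Rrow_Frow.
apply: (@vanish_on_constants K n rh sh rh0 sh0 n2 C polyC 'X (negbT (polyX_eq0 _)) phiA _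
  (ybe_diff n rh sh phiA 'X%:P%:P 'X%:P 'X)) => //.
- move=> g1 g2 e i j k hi hj hk; rewrite /ybe_diff; congr (_ - _).
    by apply: Rrow12_ext => //; apply: Rrow23_ext; apply: Rrow12_ext.
  by apply: Rrow23_ext => //; apply: Rrow12_ext; apply: Rrow23_ext.
- exact: ybe_diff_lin.
- move=> i g hi j k l hj hk hl; rewrite /ybe_diff ybe_lhs_Erow3 // ybe_rhs_Erow3 //.
  by rewrite -Erow3_sub.
- move=> i g hi j k l hj hk hl; rewrite /ybe_diff ybe_lhs_Frow3 // ybe_rhs_Frow3 //.
  by rewrite -Frow3_sub.
- exact: ybe_diff_base.
Qed.
End Poly.

Section Eval.
Context {L : comNzRingType} (phi : {rmorphism K -> L}) (x y z : L).
Local Notation A := {poly {poly {poly K}}}.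
Let phiA : {rmorphism K -> A} := polyC \o (polyC \o polyC).
Let psi1 : {rmorphism {poly K} -> L} := horner_morph (fun c => mulrC x (phi c)).
Let psi2 : {rmorphism {poly {poly K}} -> L} := horner_morph (fun c => mulrC y (psi1 c)).
Let psi : {rmorphism A -> L} := horner_morph (fun c => mulrC z (psi2 c)).

Let psi1C c : psi1 c%:P = phi c. Proof. exact: horner_morphC. Qed.
Let psi2C c : psi2 c%:P = psi1 c. Proof. exact: horner_morphC. Qed.
Let psiC c : psi c%:P = psi2 c. Proof. exact: horner_morphC. Qed.

(** Specialisation along [psi], which sends the innermost variable to [x], the next to [y] and the
    outermost to [z]. *)
Lemma ybe_eval p q r : eq_on3 n
  (ybe_lhs n rh sh phi x y z (delta3 p q r)) (ybe_rhs n rh sh phi x y z (delta3 p q r)).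
Proof.
have hphi : (fun c => psi (phiA c)) = phi.
  apply: boolp.funext => c.
  by rewrite -[RHS]psi1C -[RHS]psi2C -[RHS]psiC.
have hx : psi 'X%:P%:P = x by rewrite psiC psi2C; exact: horner_morphX.
have hy : psi 'X%:P = y by rewrite psiC; exact: horner_morphX.
have hz : psi 'X = z by exact: horner_morphX.
pose F : nat -> nat -> nat -> A := fun a b c => (delta3 p q r a b c)%:P%:P.
have hF a b c : psi (F a b c) = delta3 p q r a b c.
  by rewrite /F psiC psi2C /delta3 rmorph_nat.
have m12 u v f a b c : psi (Rrow12 n rh sh phiA u v f a b c)
   = Rrow12 n rh sh phi (psi u) (psi v) (fun a b c => psi (f a b c)) a b c.
  by rewrite /Rrow12 rmorph_Rrow hphi.
have m23 u v f a b c : psi (Rrow23 n rh sh phiA u v f a b c)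
   = Rrow23 n rh sh phi (psi u) (psi v) (fun a b c => psi (f a b c)) a b c.
  by rewrite /Rrow23 rmorph_Rrow hphi.
have e3 (f g : nat -> nat -> nat -> L) : (forall a b c, f a b c = g a b c) -> f = g.
  by move=> e; do 3!(apply: boolp.funext => ?); exact: e.
move=> a b c ha hb hc.
have := congr1 psi (ybe_poly (delta3 p q r) ha hb hc); rewrite -/(F) /ybe_lhs /ybe_rhs.
rewrite m12 (e3 _ _ (m23 _ _ _)) (e3 _ _ (m12 _ _ _)).
rewrite m23 (e3 _ _ (m12 _ _ _)) (e3 _ _ (m23 _ _ _)).
by rewrite hx hy hz (e3 _ _ hF).
Qed.
End Eval.
End Functional.

Lemma sum_mxtens {V : nmodType} m n (F : 'I_(m * n) -> V) :
  \sum_s F s = \sum_p \sum_q F (mxtens_index (p, q)).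
Proof.
rewrite pair_big /= (reindex (@mxtens_index m n)) /=; last first.
  by apply: onW_bij; exists (@mxtens_unindex m n);
    [exact: mxtens_indexK|exact: mxtens_unindexK].
by apply: eq_bigr => -[p q] _.
Qed.

(** * Matrices acting on rows of the triple tensor product *)

Section RowAction.
Context {L : comNzRingType} (n : nat).
Local Notation N := (2 * n)%N.
Implicit Type f : nat -> nat -> nat -> L.

Definition row3 f : 'rV[L]_(N * N * N) :=
  \row_s f (mxtens_unindex (mxtens_unindex s).1).1.+1
           (mxtens_unindex (mxtens_unindex s).1).2.+1 (mxtens_unindex s).2.+1.

Lemma row3E f (i j k : 'I_N) :
  row3 f 0 (mxtens_index (mxtens_index (i, j), k)) = f i.+1 j.+1 k.+1.
Proof. by rewrite mxE !mxtens_indexK. Qed.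

Lemma row3_eq (x : 'rV[L]_(N * N * N)) f :
  (forall i j k : 'I_N, x 0 (mxtens_index (mxtens_index (i, j), k)) = f i.+1 j.+1 k.+1) ->
  x = row3 f.
Proof.
move=> e; apply/rowP => s.
rewrite -(mxtens_unindexK s); case: (mxtens_unindex s) => t k.
rewrite -(mxtens_unindexK t); case: (mxtens_unindex t) => i j.
by rewrite e row3E.
Qed.

(* Right multiplication of row vectors by M is the operator T. *)
Definition represents (M : 'M[L]_(N * N)) (T : (nat -> nat -> L) -> nat -> nat -> L) :=
  forall (g : nat -> nat -> L) (k l : 'I_N),
  \sum_(p : 'I_N) \sum_(q : 'I_N) g p.+1 q.+1 * M (mxtens_index (p, q)) (mxtens_index (k, l))
  = T g k.+1 l.+1.

Lemma row3_on12 M T f : represents M T ->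
  row3 f *m on12 M = row3 (fun a b c => T (fun p q => f p q c) a b).
Proof.
move=> h; apply: row3_eq => i j k; rewrite mxE sum_mxtens sum_mxtens -h.
apply: eq_bigr => p _; apply: eq_bigr => q _.
rewrite (bigD1 k) //= big1 ?addr0 => [|c /negbTE ne].
  by rewrite row3E /on12 tensmxE mxE eqxx mulr1.
by rewrite /on12 tensmxE [X in _ * (_ * X)]mxE ne !mulr0.
Qed.

Lemma row3_on23 M T f : represents M T ->
  row3 f *m on23 M = row3 (fun a b c => T (f a) b c).
Proof.
move=> h; apply: row3_eq => i j k; rewrite mxE sum_mxtens sum_mxtens -h.
(* Both bracketings number the triples of indices in the same way, so the cast along [mulnA] keeps
   the underlying number. *)
have cast (a b c : 'I_N) : cast_ord (esym (mulnA N N N)) (mxtens_index (mxtens_index (a, b), c))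
    = mxtens_index (a, mxtens_index (b, c)).
  by apply: val_inj => /=; ring.
rewrite (bigD1 i) //= [X in _ + X]big1 ?addr0 => [|a /negbTE ne].
  apply: eq_bigr => p _; apply: eq_bigr => q _.
  by rewrite row3E /on23 castmxE !cast tensmxE mxE eqxx mul1r.
apply: big1 => b _; apply: big1 => c _.
by rewrite /on23 castmxE !cast tensmxE [X in _ * (X * _)]mxE ne mul0r mulr0.
Qed.

Lemma flip_rep : represents (@flip n L) (fun g a b => g b a).
Proof.
move=> g k l; rewrite (bigD1 l) //= [X in _ + X]big1 ?addr0 => [|p /negbTE ne].
  rewrite (bigD1 k) //= [X in _ + X]big1 ?addr0 => [|q /negbTE ne].
    by rewrite mxE !mxtens_indexK eqxx mulr1.
  by rewrite mxE !mxtens_indexK /= xpair_eqE ne andbF mulr0.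
apply: big1 => q _.
by rewrite mxE !mxtens_indexK /= xpair_eqE ne mulr0.
Qed.
End RowAction.

Section RhatRep.
Context {K : fieldType} (n : nat) (rh sh : K) {L : comNzRingType} (phi : {rmorphism K -> L}).
Local Notation N := (2 * n)%N.

Lemma Rrow_sum (I : Type) (s : seq I) (F : I -> nat -> nat -> L) x y k l :
  Rrow n rh sh phi x y (fun a b => \sum_(i <- s) F i a b) k l
  = \sum_(i <- s) Rrow n rh sh phi x y (F i) k l.
Proof.
elim: s => [|i s IH].
  rewrite big_nil.
  have -> : (fun a b => \sum_(i <- [::]) F i a b) = (fun _ _ => 0 * 0 + 0 * 0 : L).
    by apply/funext => a; apply/funext => b; rewrite big_nil !mul0r addr0.
  by rewrite Rrow_lin !mul0r addr0.
have -> : (fun a b => \sum_(i0 <- i :: s) F i0 a b)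
   = (fun a b => 1 * F i a b + 1 * (\sum_(i0 <- s) F i0 a b)).
  by apply/funext => a; apply/funext => b; rewrite big_cons !mul1r.
by rewrite Rrow_lin !mul1r IH big_cons.
Qed.

Lemma Rrow_delta (g : nat -> nat -> L) x y (k l : 'I_N) :
  Rrow n rh sh phi x y g k.+1 l.+1
  = \sum_(p : 'I_N) \sum_(q : 'I_N) g p.+1 q.+1 * Rrow n rh sh phi x y (delta2 p.+1 q.+1) k.+1 l.+1.
Proof.
have hk : in_range n k.+1 by rewrite /in_range ltn_ord.
have hl : in_range n l.+1 by rewrite /in_range ltn_ord.
transitivity (Rrow n rh sh phi x y
  (fun a b => \sum_(p : 'I_N) \sum_(q : 'I_N) g p.+1 q.+1 * delta2 p.+1 q.+1 a b) k.+1 l.+1).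
  apply: eq_Rrow => // a b; rewrite /in_range => ha hb.
  have ha' : (a.-1 < N)%N by lia.
  have hb' : (b.-1 < N)%N by lia.
  rewrite (bigD1 (Ordinal ha')) //= [X in _ + X]big1 ?addr0 => [|p /eqP ne].
    rewrite (bigD1 (Ordinal hb')) //= [X in _ + X]big1 ?addr0 => [|q /eqP ne].
      by rewrite !prednK /delta2 ?eqxx ?mulr1 //; lia.
    rewrite /delta2 (_ : (b == q.+1) = false) ?andbF ?mulr0 //.
    by apply/eqP => e; apply: ne; apply: val_inj => /=; lia.
  apply: big1 => q _.
  rewrite /delta2 (_ : (a == p.+1) = false) ?mulr0 //.
  by apply/eqP => e; apply: ne; apply: val_inj => /=; lia.
rewrite Rrow_sum; apply: eq_bigr => p _.
rewrite Rrow_sum; apply: eq_bigr => q _.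
have := @Rrow_lin K n rh sh L phi x y (delta2 p.+1 q.+1) (fun _ _ => 0) k.+1 l.+1 (g p.+1 q.+1) 0.
rewrite [X in _ = _ + X]mul0r addr0 => <-; congr (Rrow _ _ _ _ _ _ _ _ _).
by apply/funext => a; apply/funext => b; rewrite mul0r addr0.
Qed.

Lemma RhatAt_rep (x : L) : represents (RhatAt n rh sh phi x) (Rrow n rh sh phi x 1).
Proof.
move=> g k l; rewrite Rrow_delta; apply: eq_bigr => p _; apply: eq_bigr => q _.
congr (_ * _); rewrite mxE Rhat_entry.
pose psi : {rmorphism {poly K} -> L} := horner_morph (fun c => mulrC x (phi c)).
rewrite -[LHS]/(psi (Rrow n rh sh polyC 'X 1 (delta2 p.+1 q.+1) k.+1 l.+1)).
rewrite rmorph_Rrow rmorph1.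
have -> : psi 'X = x by exact: horner_morphX.
have -> : (fun c => psi c%:P) = phi by apply/funext => c; exact: horner_morphC.
congr (Rrow _ _ _ _ _ _ _ _ _); apply/funext => a; apply/funext => b.
by rewrite rmorph_nat.
Qed.
End RhatRep.

Lemma castmx_mulmx (L : pzSemiRingType) (m m' : nat) (e : m = m') (A B : 'M[L]_m) :
  castmx (e, e) (A *m B) = castmx (e, e) A *m castmx (e, e) B.
Proof. by case: _ / e. Qed.

Section YangBaxter.
Context {K : fieldType} (n : nat) (rh sh : K) {L : fieldType} (phi : {rmorphism K -> L}).
Hypotheses (rh0 : rh != 0) (sh0 : sh != 0) (n2 : (2 <= n)%N).
Local Notation N := (2 * n)%N.
Variables u v w : L.
Hypotheses (v0 : v != 0) (w0 : w != 0).

Lemma Rrow_hom x y g k l : y != 0 ->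
  Rrow n rh sh phi x y g k l = y ^+ 2 * Rrow n rh sh phi (x / y) 1 g k l.
Proof.
move=> y0; rewrite /Rrow; case: ifP => _.
  rewrite mulr_sumr; apply: eq_bigr => i _; rewrite mulrA; congr (_ * _).
  by rewrite /b_hom; case: ifP => _; [field|case: ifP => _; move: (phi (_ / _)) => c; field].
by case: ifP => _; [field|case: ifP => _; field].
Qed.

Local Notation R12' x := (Rrow12 n rh sh phi x 1).
Local Notation R23' x := (Rrow23 n rh sh phi x 1).

(** The scalar [k] records the squares of parameters already split off by the operators applied
    before. *)
Lemma scale12 x y k f g : y != 0 -> eq_on3 n f (fun a b c => k * g a b c) ->
  eq_on3 n (Rrow12 n rh sh phi x y f) (fun a b c => k * y ^+ 2 * R12' (x / y) g a b c).
Proof.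
move=> y0 e a b c ha hb hc; rewrite /Rrow12 -mulrA -Rrow_hom // -Rrow_scale.
by apply: eq_Rrow => // *; rewrite e.
Qed.

Lemma scale23 x y k f g : y != 0 -> eq_on3 n f (fun a b c => k * g a b c) ->
  eq_on3 n (Rrow23 n rh sh phi x y f) (fun a b c => k * y ^+ 2 * R23' (x / y) g a b c).
Proof.
move=> y0 e a b c ha hb hc; rewrite /Rrow23 -mulrA -Rrow_hom // -Rrow_scale.
by apply: eq_Rrow => // *; rewrite e.
Qed.

(** With R equal to R-hat composed with the flip, all flips can be pulled to the right end, where
    they compose to the reversal of the three factors. In front of it remains the braid form. *)
Lemma row3_lhs f :
  row3 n f *m (R12 n rh sh phi (v / w) *m R13 n rh sh phi (u / w) *m R23 n rh sh phi (u / v))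
  = row3 n (fun a b c => R12' (u / v) (R23' (u / w) (R12' (v / w) f)) c b a).
Proof.
have on12M (A B : 'M[L]_(N * N)) : on12 (A *m B) = on12 A *m on12 B.
  by rewrite /on12 tensmx_mul mulmx1.
have on23M (A B : 'M[L]_(N * N)) : on23 (A *m B) = on23 A *m on23 B.
  by rewrite /on23 -castmx_mulmx tensmx_mul mulmx1.
rewrite /R13 /R12 /R23 /Rmx !on12M !on23M !mulmxA.
rewrite !(row3_on12 _ (@RhatAt_rep K n rh sh L phi _), row3_on23 _ (@RhatAt_rep K n rh sh L phi _),
  row3_on12 _ (@flip_rep L n), row3_on23 _ (@flip_rep L n)).
by [].
Qed.

Lemma row3_rhs f :
  row3 n f *m (R23 n rh sh phi (u / v) *m R13 n rh sh phi (u / w) *m R12 n rh sh phi (v / w))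
  = row3 n (fun a b c => R23' (v / w) (R12' (u / w) (R23' (u / v) f)) c b a).
Proof.
have on12M (A B : 'M[L]_(N * N)) : on12 (A *m B) = on12 A *m on12 B.
  by rewrite /on12 tensmx_mul mulmx1.
have on23M (A B : 'M[L]_(N * N)) : on23 (A *m B) = on23 A *m on23 B.
  by rewrite /on23 -castmx_mulmx tensmx_mul mulmx1.
rewrite /R13 /R12 /R23 /Rmx !on12M !on23M !mulmxA.
rewrite !(row3_on12 _ (@RhatAt_rep K n rh sh L phi _), row3_on23 _ (@RhatAt_rep K n rh sh L phi _),
  row3_on12 _ (@flip_rep L n), row3_on23 _ (@flip_rep L n)).
by [].
Qed.

Lemma yang_baxter :
  R12 n rh sh phi (v / w) *m R13 n rh sh phi (u / w) *m R23 n rh sh phi (u / v)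
  = R23 n rh sh phi (u / v) *m R13 n rh sh phi (u / w) *m R12 n rh sh phi (v / w).
Proof.
apply/row_matrixP => s.
rewrite -(mxtens_unindexK s); case: (mxtens_unindex s) => t r.
rewrite -(mxtens_unindexK t); case: (mxtens_unindex t) => p q.
have row_rv (M : 'M[L]_(N * N * N)) : row (mxtens_index (mxtens_index (p, q), r)) M
    = row3 n (delta3 p.+1 q.+1 r.+1) *m M.
  rewrite rowE; congr (_ *m _); apply: row3_eq => i j k.
  rewrite mxE eqxx /= /delta3 !eqSS !val_eqE; congr (_%:R).
  by rewrite (can_eq (@mxtens_indexK _ _)) xpair_eqE (can_eq (@mxtens_indexK _ _)) xpair_eqE andbA.
rewrite !row_rv row3_lhs row3_rhs.
apply: row3_eq => i j k; rewrite row3E.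
have hi : in_range n i.+1 by rewrite /in_range ltn_ord.
have hj : in_range n j.+1 by rewrite /in_range ltn_ord.
have hk : in_range n k.+1 by rewrite /in_range ltn_ord.
have := @ybe_eval K n rh sh rh0 sh0 n2 L phi u v w p.+1 q.+1 r.+1 _ _ _ hk hj hi.
have fi : eq_on3 n (delta3 p.+1 q.+1 r.+1) (fun a b c => 1 * delta3 p.+1 q.+1 r.+1 a b c : L).
  by move=> *; rewrite mul1r.
rewrite /ybe_lhs /ybe_rhs.
(* Passing to the ratios of the parameters splits off the same nonzero scalar v^2 w^4 on both sides,
   which is then cancelled. *)
rewrite (@scale12 _ _ _ _ _ v0 (@scale23 _ _ _ _ _ w0 (@scale12 _ _ _ _ _ w0 fi))) //.
rewrite (@scale23 _ _ _ _ _ w0 (@scale12 _ _ _ _ _ w0 (@scale23 _ _ _ _ _ v0 fi))) // !mul1r.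
rewrite (_ : v ^+ 2 * w ^+ 2 * w ^+ 2 = w ^+ 2 * w ^+ 2 * v ^+ 2); last by ring.
by apply: mulfI; rewrite !mulf_neq0 ?expf_neq0.
Qed.
End YangBaxter.

(** * Linear extension and the presented algebra *)

Section Lin.
Context {K : fieldType}.

Section LinFun.
Context {V W : lmodType K} (f : V -> W) (lf : linear f).
Lemma lin_D x y : f (x + y) = f x + f y.
Proof. by have := lf 1 x y; rewrite !scale1r. Qed.
Lemma lin_0 : f 0 = 0.
Proof. by apply: (addrI (f 0)); rewrite -lin_D !addr0. Qed.
Lemma lin_Z c x : f (c *: x) = c *: f x.
Proof. by have := lf c x 0; rewrite !addr0 lin_0 addr0. Qed.
Lemma lin_sum I (s : seq I) (P : pred I) (F : I -> V) :
  f (\sum_(i <- s | P i) F i) = \sum_(i <- s | P i) f (F i).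
Proof. exact: (big_morph f lin_D lin_0). Qed.
End LinFun.

Lemma lin_zero (V W : lmodType K) : linear (fun _ : V => 0 : W).
Proof. by move=> c x y; rewrite scaler0 addr0. Qed.
Lemma lin_comp (U V W : lmodType K) (f : V -> W) (g : U -> V) :
  linear f -> linear g -> linear (fun x => f (g x)).
Proof. by move=> lf lg c x y; rewrite lg lf. Qed.
Lemma lin_add (V W : lmodType K) (f g : V -> W) :
  linear f -> linear g -> linear (fun x => f x + g x).
Proof. by move=> lf lg c x y; rewrite lf lg scalerDr addrACA. Qed.
Lemma lin_scale (V W : lmodType K) (f : V -> W) d :
  linear f -> linear (fun x => d *: f x).
Proof. by move=> lf c x y; rewrite lf scalerDr !scalerA mulrC. Qed.
Lemma lin_bigsum (V W : lmodType K) I (s : seq I) (F : I -> V -> W) :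
  (forall i, linear (F i)) -> linear (fun x => \sum_(i <- s) F i x).
Proof.
move=> lF c x y; rewrite scaler_sumr -big_split; apply: eq_bigr => i _.
exact: lF.
Qed.

Lemma malgUZ (X : choiceType) (c : K) (k : X) :
  << c *g k >> = c *: (<< k >> : {malg K[X]}).
Proof. by apply/malgP => k'; rewrite mcoeffZ !mcoeffU mulrnAr mulr1. Qed.

Section LinExt.
Context {X : choiceType} {W : lmodType K}.

Lemma linext_lin (f : X -> W) : linear (linext f).
Proof.
have lw (d : {fset X}) x : (msupp x `<=` d)%fset ->
    linext f x = \sum_(k <- d) x@_k *: f k.
  move=> le; rewrite /linext (big_fset_incl _ le) // => k _ kx.
  by rewrite mcoeff_outdom // scale0r.
move=> c x y; pose d := (msupp x `|` msupp y `|` msupp (c *: x + y))%fset.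
rewrite (lw d) ?(lw d x) ?(lw d y).
- rewrite scaler_sumr -big_split; apply: eq_bigr => k _.
  by rewrite mcoeffD mcoeffZ scalerDl scalerA.
- by rewrite /d; apply: fsubset_trans (fsubsetUl _ _); apply: fsubsetUr.
- by rewrite /d; apply: fsubset_trans (fsubsetUl _ _); apply: fsubsetUl.
- exact: fsubsetUr.
Qed.

Lemma linextU (f : X -> W) k : linext f << k >> = f k.
Proof. by rewrite /linext msuppU oner_eq0 big_seq_fset1 mcoeffUU scale1r. Qed.

Lemma lin_basis (f g : {malg K[X]} -> W) :
  linear f -> linear g -> (forall k, f << k >> = g << k >>) -> f =1 g.
Proof.
move=> lf lg e x; rewrite (monalgE x) !lin_sum //; apply: eq_bigr => k _.
by rewrite malgUZ !lin_Z // e.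
Qed.

End LinExt.

Lemma tensU (X Y Z : choiceType) (h : X -> Y -> Z) k l :
  tens (K := K) h << k >> << l >> = << h k l >>.
Proof. by rewrite /tens !linextU. Qed.

Lemma tens_linl (X Y Z : choiceType) (h : X -> Y -> Z) (y : {malg K[Y]}) :
  linear (fun x : {malg K[X]} => tens h x y).
Proof. exact: linext_lin. Qed.

Lemma tens_linr (X Y Z : choiceType) (h : X -> Y -> Z) (x : {malg K[X]}) :
  linear (fun y : {malg K[Y]} => tens h x y).
Proof.
rewrite /tens /linext; apply: lin_bigsum => k; apply: lin_scale.
exact: linext_lin.
Qed.
End Lin.

(** Scaling by [c] is multiplication by a multiple of the neutral monomial, which commutes with
    every monomial. *)
Lemma malgU_scaleAr (K : fieldType) (M : monomType) (m : M) (c : K) (x : {malg K[M]}) :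
  << m >> * (c *: x) = c *: (<< m >> * x).
Proof.
rewrite -!mul_malgC !mulrA; congr (_ * _).
by rewrite !malgM_def !fgmulUU mul1r mulr1 mulm1 mul1m.
Qed.

Section FreeAct.
Context {K : fieldType} {G : choiceType} {W : lmodType K} (T : G -> W -> W).
Hypothesis lT : forall g, linear (T g).
Local Notation act := (freeAct T).

Lemma foldr_lin (m : seq G) : linear (fun w => foldr T w m).
Proof. by elim: m => [|g m IH] //=; apply: lin_comp. Qed.

Lemma freeAct_linl w : linear (act^~ w).
Proof. exact: linext_lin. Qed.

Lemma freeAct_linr x : linear (act x).
Proof.
rewrite /freeAct /linext; apply: lin_bigsum => m; apply: lin_scale.
exact: foldr_lin.
Qed.

Lemma freeActU (m : {fmonom G}) w : act << m >> w = foldr T w m.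
Proof. by rewrite /freeAct linextU. Qed.

Lemma freeAct_gen g w : act (freeGen K g) w = T g w.
Proof. by rewrite /freeGen freeActU fmU. Qed.

Lemma freeAct1 w : act 1 w = w.
Proof. by have := freeActU (mone : {fmonom G}) w; rewrite fm1. Qed.

(** Linearity in both factors reduces this to two words, and a concatenated word acts by
    composition. *)
Lemma freeActM x y w : act (x * y) w = act x (act y w).
Proof.
move: x; apply: lin_basis => [c a b|c a b|m].
- by rewrite mulrDl -scalerAl freeAct_linl.
- exact: freeAct_linl.
move: y; apply: lin_basis => [c a b|c a b|m'].
- by rewrite mulrDr malgU_scaleAr freeAct_linl.
- by rewrite freeAct_linl freeAct_linr.
rewrite malgM_def fgmulUU mulr1 !freeActU fmM.
by rewrite foldr_cat.
Qed.
End FreeAct.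

Section PresAct.
Context {K : fieldType} {G : choiceType} (rel : freeAlg K G -> freeAlg K G -> Prop).
Context {W : lmodType K} (T : G -> W -> W).
Hypothesis lT : forall g, linear (T g).
Hypothesis relT : forall x y, rel x y -> forall w, freeAct T x w = freeAct T y w.

Lemma freeAct_relIdeal x : relIdeal rel x -> forall w, freeAct T x w = 0.
Proof.
elim=> [a b r|||] {x}.
- by move=> w; rewrite addrC -scaleN1r freeAct_linl (relT r) scaleN1r addNr.
- by move=> w; exact: (lin_0 (freeAct_linl T w)).
- by move=> a b _ ha _ hb w; rewrite (lin_D (freeAct_linl T w)) ha hb addr0.
- move=> a x b _ hx w.
  by rewrite !freeActM // hx (lin_0 (freeAct_linr lT a)).
Qed.

(** The representative picked by [presRepr] differs from [x] by an element of the ideal, and that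
    element acts by zero. *)
Lemma presAct_Pi x w : presAct T (presPi rel x) w = freeAct T x w.
Proof.
have := freeAct_relIdeal (presPiK rel x) w.
rewrite (lin_D (freeAct_linl T w)) -[- x]scaleN1r (lin_Z (freeAct_linl T w)) scaleN1r.
by move=> /eqP; rewrite subr_eq0 => /eqP.
Qed.

Lemma presAct_lin x : linear (presAct (rel := rel) T x).
Proof. exact: freeAct_linr. Qed.

Lemma presAct1 w : presAct T (1 : presAlg rel) w = w.
Proof. by rewrite -[1 : presAlg rel]/(presPi rel 1) presAct_Pi freeAct1. Qed.

Lemma presActM (x y : presAlg rel) w : presAct T (x * y) w = presAct T x (presAct T y w).
Proof.
rewrite -[x]presReprK -[y]presReprK; move: (presRepr x) (presRepr y) => {}x {}y.
by rewrite -[_ * _]/(presMul _ _) presPiM !presAct_Pi freeActM.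
Qed.

Lemma presActZ c (x : presAlg rel) w : presAct T (c *: x) w = c *: presAct T x w.
Proof.
rewrite -[x]presReprK; move: (presRepr x) => {}x.
by rewrite -[c *: _]/(presScale c _) presPiZ !presAct_Pi (lin_Z (freeAct_linl T w)).
Qed.
End PresAct.

(** * The representations on V(u) *)

Section Ip.
Variable n : nat.
Implicit Types x y z : 'rV[int]_n.
Lemma ipDl x y z : ip (x + y) z = ip x z + ip y z.
Proof. by rewrite /ip -big_split; apply: eq_bigr => i _; rewrite mxE mulrDl. Qed.
Lemma ipC x y : ip x y = ip y x.
Proof. by apply: eq_bigr => i _; rewrite mulrC. Qed.
Lemma ipNl x z : ip (- x) z = - ip x z.
Proof. by rewrite /ip -sumrN; apply: eq_bigr => i _; rewrite mxE mulNr. Qed.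
Lemma ipDr x y z : ip x (y + z) = ip x y + ip x z.
Proof. by rewrite ipC ipDl !(ipC _ x). Qed.
Lemma ipNr x z : ip x (- z) = - ip x z.
Proof. by rewrite ipC ipNl ipC. Qed.
Lemma ip_eps a b : (1 <= a <= n)%N -> ip (eps n a) (eps n b) = (a == b)%:R.
Proof.
move=> ha; have ha' : (a.-1 < n)%N by lia.
rewrite /ip (bigD1 (Ordinal ha')) //= big1 ?addr0 => [|i /eqP ne].
  by rewrite !mxE /= prednK ?eqxx ?mul1r //; lia.
rewrite !mxE (_ : (i.+1 == a) = false) ?mul0r //.
by apply/eqP => e; apply: ne; apply: val_inj => /=; lia.
Qed.

Hypothesis n2 : (2 <= n)%N.

Lemma ip_alpha_diag i : (i <= n)%N ->
  ip (alpha n i) (alpha n i) = if (i == 0)%N || (i == n) then 4 else 2.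
Proof.
move=> hi; rewrite /alpha; case: (i =P 0)%N => [_|i0] /=.
  by rewrite mulr2n !(ipNl, ipNr, ipDl, ipDr) !ip_eps //; lia.
case: (i =P n) => [_|iN].
  by rewrite mulr2n !(ipNl, ipNr, ipDl, ipDr) !ip_eps ?eqxx //; lia.
rewrite !(ipNl, ipNr, ipDl, ipDr) !ip_eps ?eqxx; lia.
Qed.

Lemma ip_alpha i j : (i <= n)%N -> (j <= n)%N -> i <> j ->
  ip (alpha n i) (alpha n j) = if (i == j.+1) || (j == i.+1) then
    (if [|| i == 0, j == 0, i == n | j == n]%N then -2 else -1) else 0.
Proof.
move=> hi hj ij; rewrite /alpha.
case: (i =P 0)%N => [?|i0] /=; case: (j =P 0)%N => [?|j0] /=; try lia;
  try (case: (i =P n) => [?|iN] /=); try (case: (j =P n) => [?|jN] /=); try lia;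
  rewrite ?mulr2n !(ipNl, ipNr, ipDl, ipDr) !ip_eps; try lia;
  repeat (case: eqP => ? /=); first [by [] | exfalso; lia].
Qed.

(** This and the next two lemmas bound the degree 1 - c_ij from below in the three situations that
    matter for Serre monomials: any pair of nodes, neighbours, and neighbours with alpha_i short and
    alpha_j long. *)
Lemma serreDeg_gt0 i j : (i <= n)%N -> (j <= n)%N -> i <> j -> (0 < serreDeg n i j)%N.
Proof.
move=> hi hj ij; rewrite /serreDeg /cartan ip_alpha // ip_alpha_diag //.
by case: (_ || _); case: ifP => _ //; case: ifP.
Qed.

Lemma serreDeg_adj i j : (i <= n)%N -> (j <= n)%N ->
  (i == j.+1) || (j == i.+1) -> (1 < serreDeg n i j)%N.
Proof.
move=> hi hj adj; have ij : i <> j by move: adj; lia.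
rewrite /serreDeg /cartan ip_alpha // ip_alpha_diag // adj.
case: (i =P 0)%N => //= i0; case: (i =P n) => [iN|iN] /=.
  by rewrite orbT.
by case: ifP.
Qed.

Lemma serreDeg_special i j : ((i == 1) && (j == 0))%N || ((i == n.-1) && (j == n)) ->
  (2 < serreDeg n i j)%N.
Proof.
move=> h; have adj : (i == j.+1) || (j == i.+1) by lia.
rewrite /serreDeg /cartan ip_alpha; try lia.
rewrite ip_alpha_diag; last by lia.
rewrite adj (_ : (i == 0)%N || (i == n) = false); last by lia.
by rewrite (_ : [|| _, _, _ | _] = true) //; lia.
Qed.
End Ip.

Lemma e_idx_f_idx n k : in_range n k -> e_idx n (f_idx n k) = k.
Proof.
rewrite /in_range /e_idx /f_idx => hk; case: (k =P (2 * n)%N) => ?; first by rewrite eqxx; lia.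
by rewrite (_ : (k.+1 == 1)%N = false) //; lia.
Qed.
Lemma f_idx_e_idx n k : in_range n k -> f_idx n (e_idx n k) = k.
Proof. by rewrite /in_range /e_idx /f_idx => hk; case: (k =P 1)%N => ?; case: eqP; lia. Qed.

(** * Labels along the cycle of basis vectors *)

Section Labels.
Context {K : fieldType} (n : nat) (rh sh : K).
Hypothesis n2 : (2 <= n)%N.
Local Notation xe i k := (e_coef n i k : K).
Local Notation yf i k := (f_coef n rh sh i k).
Local Notation pd := (e_idx n).
Local Notation sc := (f_idx n).

(* The i for which e_i v_k is nonzero. *)
Definition node k := if k == 1%N then 0%N else if (k <= n.+1)%N then k.-1 else ((2 * n).+1 - k)%N.

Lemma e_coef_nonzero i k : (i <= n)%N -> xe i k != 0 ->
  [\/ i = 0%N /\ k = 1%N, i = n /\ k = n.+1, (0 < i < n)%N /\ k = i.+1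
    | (0 < i < n)%N /\ k = primed n i].
Proof using n2.
move=> hi; rewrite /e_coef; case: (i =P 0)%N => [->|i0].
  by case: (k =P 1)%N => [->|]; rewrite ?eqxx //; constructor 1.
case: (i =P n) => [->|iN].
  by case: (k =P n.+1)%N => [->|]; rewrite ?eqxx //; constructor 2.
have h : (0 < i < n)%N by lia.
case: (k =P i.+1) => [->|_]; first by constructor 3.
by case: (k =P primed n i) => [->|_]; [constructor 4|rewrite subrr eqxx].
Qed.

Lemma f_coef_nonzero i k : (i <= n)%N -> yf i k != 0 ->
  [\/ i = 0%N /\ k = (2 * n)%N, i = n /\ k = n, (0 < i < n)%N /\ k = i
    | (0 < i < n)%N /\ k = primed n i.+1].
Proof using n2.
move=> hi; rewrite /f_coef; case: (i =P 0)%N => [->|i0].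
  by case: (k =P 2 * n)%N => [->|]; rewrite ?eqxx //; constructor 1.
case: (i =P n) => [->|iN].
  by case: (k =P n)%N => [->|]; rewrite ?eqxx //; constructor 2.
have h : (0 < i < n)%N by lia.
case: (k =P i) => [->|_]; first by constructor 3.
by case: (k =P primed n i.+1) => [->|_]; [constructor 4|rewrite mulr0 subrr eqxx].
Qed.

Lemma e_coef_node i k : (i <= n)%N -> xe i k != 0 -> i = node k.
Proof using n2.
move=> hi /e_coef_nonzero -/(_ hi); rewrite /node /primed.
by case=> -[h ->]; decide_nat; lia.
Qed.
Lemma f_coef_node i k : (i <= n)%N -> yf i k != 0 -> i = node (sc k).
Proof using n2.
move=> hi /f_coef_nonzero -/(_ hi); rewrite /node /primed /f_idx.
by case=> -[h ->]; decide_nat; lia.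
Qed.

(** For k = 1, ..., 2n the labels are 0, 1, ..., n, n-1, ..., 1, so consecutive ones are neighbours
    in the affine diagram. *)
Lemma node_e_idx k : in_range n k -> (node (pd k) == (node k).+1) || (node k == (node (pd k)).+1).
Proof using n2.
rewrite /in_range /e_idx /node => hk; case: (k =P 1)%N => k1; first by decide_nat.
by case: (k.-1 =P 1)%N => ?; case: (leqP k n.+1) => ?; case: (leqP k.-1 n.+1) => ?; lia.
Qed.

(* A walk along the cycle turns round only at the ends of the Dynkin diagram, where
   the Cartan entry is -2. *)
Lemma node_e_idx2 k : in_range n k -> node (pd (pd k)) = node k ->
  ((node k == 1) && (node (pd k) == 0))%N || ((node k == n.-1) && (node (pd k) == n)).
Proof using n2.
rewrite /in_range /e_idx /node => hk.
case: (k =P 1)%N => [k1|k1]; first by case: (n =P 2)%N => ?; decide_nat; lia.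
case: (k =P 2)%N => [k2|k2]; first by decide_nat; lia.
rewrite (_ : (k.-1 == 1)%N = false); last by lia.
by case: (k.-2 =P 1)%N => ?; case: (leqP k n.+1) => ?; case: (leqP k.-1 n.+1) => ?;
  case: (leqP k.-2 n.+1) => ?; lia.
Qed.

Lemma epsV_le k : (k <= n)%N -> epsV n k = eps n k.
Proof using n2. by rewrite /epsV => ->. Qed.
Lemma epsV_gt k : (n < k)%N -> epsV n k = - eps n (primed n k).
Proof using n2. by rewrite /epsV ltnNge => /negbTE ->. Qed.

Lemma epsV_e_idx i k : (i <= n)%N -> xe i k != 0 -> epsV n (pd k) = epsV n k + alpha n i.
Proof using n2.
move=> hi /e_coef_nonzero -/(_ hi) [] [h ->]; rewrite /e_idx /alpha.
- subst i; rewrite eqxx /= epsV_gt ?epsV_le; try lia.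
  rewrite (_ : primed n (2 * n) = 1%N) ?mulr2n; last by rewrite /primed; lia.
  by rewrite opprD addrA subrr add0r.
- subst i; decide_nat.
  have -> : epsV n n.+1 = - eps n n.
    by rewrite epsV_gt //; congr (- eps n _); rewrite /primed; lia.
  by rewrite epsV_le // mulr2n addrA addNr add0r.
- decide_nat.
  by rewrite !epsV_le; [rewrite addrC subrK|lia|lia].
have Ei : (primed n i + i = (2 * n).+1)%N by rewrite /primed; lia.
decide_nat.
rewrite !epsV_gt; try (rewrite /primed; lia).
rewrite (_ : primed n (primed n i) = i); last by rewrite primedK // /in_range; lia.
rewrite (_ : primed n (primed n i).-1 = i.+1); last by rewrite /primed; lia.
by rewrite addrA addNr add0r.
Qed.

(** Where f_i is nonzero, e_i leads back from the target, so the weight shift is the one of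
    [epsV_e_idx] read in reverse. *)
Lemma epsV_f_idx i k : (i <= n)%N -> yf i k != 0 -> epsV n (sc k) = epsV n k - alpha n i.
Proof using n2.
move=> hi hy; have h := f_coef_nonzero hi hy.
have hk : in_range n k by case: h => -[h ->]; rewrite /in_range /primed; lia.
have hx : xe i (sc k) != 0.
  rewrite /e_coef /f_idx; case: h => -[h ->].
  - by subst i; rewrite !eqxx oner_eq0.
  - by subst i; decide_nat; rewrite oner_eq0.
  - have Ei : (primed n i + i = (2 * n).+1)%N by rewrite /primed; lia.
    by decide_nat; rewrite subr0 oner_eq0.
  have Ei : (primed n i + i = (2 * n).+1)%N by rewrite /primed; lia.
  have Ei' : (primed n i.+1 + i.+1 = (2 * n).+1)%N by rewrite /primed; lia.
  by decide_nat; rewrite sub0r oppr_eq0 oner_eq0.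
by rewrite -[in RHS](e_idx_f_idx hk) (epsV_e_idx hi hx) addrK.
Qed.
End Labels.

Section Steps.
Context {n : nat}.
Implicit Types k : 'I_(2 * n).

(** Zero-based form of [e_idx]. The default of [insubd] is never taken, because [e_idx] stays in
    range. *)
Definition e_ord k : 'I_(2 * n) := insubd k (e_idx n k.+1).-1.
Definition f_ord k : 'I_(2 * n) := insubd k (f_idx n k.+1).-1.
Lemma ord_in_range k : in_range n k.+1.
Proof. by rewrite /in_range ltn_ord. Qed.
Lemma e_ordE k : (e_ord k).+1 = e_idx n k.+1.
Proof.
have := e_idx_in_range (ord_in_range k); rewrite /in_range /e_ord => h.
by rewrite val_insubd; case: ifP; lia.
Qed.
Lemma f_ordE k : (f_ord k).+1 = f_idx n k.+1.
Proof.
have := f_idx_in_range (ord_in_range k); rewrite /in_range /f_ord => h.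
by rewrite val_insubd; case: ifP; lia.
Qed.
Lemma f_ord_e_ord k : f_ord (e_ord k) = k.
Proof. by apply: val_inj; apply/eqP; rewrite -eqSS f_ordE e_ordE f_idx_e_idx ?ord_in_range. Qed.
Lemma e_ord_f_ord k : e_ord (f_ord k) = k.
Proof. by apply: val_inj; apply/eqP; rewrite -eqSS e_ordE f_ordE e_idx_f_idx ?ord_in_range. Qed.
End Steps.

(** * Generators acting on the basis of V(u) *)

Section Rho.
Context {K : fieldType} (n : nat) (rh sh a b : K).
Hypotheses (rh0 : rh != 0) (sh0 : sh != 0) (n2 : (2 <= n)%N).
Hypothesis (hab : a * b = (rh ^+ 2 * sh ^+ 2)^-1).
Local Notation N := (2 * n)%N.
Local Notation T := (@genop K n rh sh a b).
Implicit Types (k : 'I_N) (m : int).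

Definition basisV k m : @Vaff K n := << (k, m) >>.
Definition e_scal (i : nat) : K := if i == 0%N then a else 1.
Definition f_scal (i : nat) : K :=
  if i == 0%N then b else if i == n then (rh ^+ 2 * sh ^+ 2)^-1 else 1.

Lemma genop_lin g : linear (T g).
Proof. by case: g => [i|i|[]|[]] *; exact: linext_lin. Qed.

Lemma mxop_basis (M : 'M[K]_N) d k m :
  mxop M d (basisV k m) = \sum_i M i k *: basisV i (m + d).
Proof. by rewrite /mxop linextU; apply: eq_bigr => i _; rewrite malgUZ. Qed.

Lemma mxop_single (M : 'M[K]_N) d k m (p : 'I_N) c :
  (forall i, M i k = c * (i == p)%:R) -> mxop M d (basisV k m) = c *: basisV p (m + d).
Proof.
move=> h; rewrite mxop_basis (bigD1 p) //= big1 ?addr0 => [|i /negbTE ne].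
  by rewrite h eqxx mulr1.
by rewrite h ne mulr0 scale0r.
Qed.

Lemma mx_e_entry i (r k : 'I_N) : (i <= n)%N ->
  mx_e n a i r k = e_scal i * e_coef n i k.+1 * (r == e_ord k)%:R.
Proof using rh0 sh0 n2.
move=> hi; rewrite -(inj_eq val_inj) -eqSS e_ordE /mx_e /e_scal /e_coef.
case: (i =P 0)%N => [_|i0].
  rewrite !mxE; case: (k.+1 =P 1)%N => [->|_]; last by rewrite andbF !mulr0 mul0r.
  rewrite /e_idx eqxx andbT mulr1 (_ : primed n 1 = N) //; rewrite /primed; lia.
case: (i =P n) => [_|iN].
  rewrite !mxE (_ : primed n n = n.+1); last by rewrite /primed; lia.
  case: (k.+1 =P n.+1)%N => [->|_]; last by rewrite andbF !mulr0 mul0r.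
  by rewrite andbT !mul1r; congr (_%:R); congr (nat_of_bool (_ == _)); rewrite /e_idx; case: eqP; lia.
rewrite !mxE mul1r.
have e1 : primed n i.+1 = (primed n i).-1 by rewrite /primed; lia.
have e2 : (i.+1 == primed n i) = false by rewrite /primed; lia.
case: (k.+1 =P i.+1) => [->|_].
  by rewrite e2 andbF andbT !subr0 mul1r; congr (_%:R); congr (nat_of_bool (_ == _)); rewrite /e_idx; case: eqP; lia.
case: (k.+1 =P primed n i) => [->|_].
  rewrite !andbF andbT !sub0r mulN1r; congr (- (_%:R)).
  by congr (nat_of_bool (_ == _)); rewrite /e_idx e1; case: eqP => //; rewrite /primed; lia.
by rewrite !andbF subrr mul0r.
Qed.

Lemma mx_f_entry i (r k : 'I_N) : (i <= n)%N ->
  mx_f n rh sh b i r k = f_scal i * f_coef n rh sh i k.+1 * (r == f_ord k)%:R.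
Proof using rh0 sh0 n2.
move=> hi; rewrite -(inj_eq val_inj) -eqSS f_ordE /mx_f /f_scal /f_coef.
case: (i =P 0)%N => [_|i0].
  rewrite !mxE (_ : primed n 1 = N); last by rewrite /primed; lia.
  case: (k.+1 =P N)%N => [->|_]; last by rewrite andbF !mulr0 mul0r.
  by rewrite /f_idx eqxx andbT mulr1.
case: (i =P n) => [_|iN].
  rewrite !mxE (_ : primed n n = n.+1); last by rewrite /primed; lia.
  case: (k.+1 =P n)%N => [->|_]; last by rewrite andbF !mulr0 mul0r.
  by rewrite andbT mulr1; congr (_ * _%:R); congr (nat_of_bool (_ == _)); rewrite /f_idx; case: eqP; lia.
rewrite !mxE mul1r.
have e1 : primed n i = (primed n i.+1).+1 by rewrite /primed; lia.
have e2 : (i == primed n i.+1) = false by rewrite /primed; lia.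
case: (k.+1 =P i) => [->|_].
  rewrite e2 andbF andbT !mulr0 !subr0 mul1r; congr (_%:R).
  by congr (nat_of_bool (_ == _)); rewrite /f_idx; case: eqP; lia.
case: (k.+1 =P primed n i.+1) => [->|_].
  rewrite !andbF andbT !sub0r mulr1 mulNr; congr (- (_ * _%:R)).
  by congr (nat_of_bool (_ == _)); rewrite /f_idx e1; case: eqP => //; rewrite /primed; lia.
by rewrite !andbF !mulr0 subrr mul0r.
Qed.

Lemma genop_e (i : 'I_n.+1) k m :
  T (gen_e i) (basisV k m) = (e_scal i * e_coef n i k.+1) *: basisV (e_ord k) (m + (i == ord0)%:R).
Proof using rh0 sh0 n2. by apply: mxop_single => r; rewrite mx_e_entry // -ltnS. Qed.
Lemma genop_f (i : 'I_n.+1) k m :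
  T (gen_f i) (basisV k m) = (f_scal i * f_coef n rh sh i k.+1) *: basisV (f_ord k) (m - (i == ord0)%:R).
Proof using rh0 sh0 n2. by apply: mxop_single => r; rewrite mx_f_entry // -ltnS. Qed.

(** This is c = 1: gamma and gamma' act trivially, and the extra factor in w_0 and w'_0
    disappears. *)
Lemma rs_ab : rh ^+ 2 * sh ^+ 2 * (a * b) = 1.
Proof. by rewrite hab mulfV // mulf_neq0 ?expf_neq0. Qed.

Lemma val_wE i (k : nat) : val_w n rh sh a b i k = w_wt n rh sh i k.
Proof. by rewrite /val_w rs_ab if_same mul1r. Qed.
Lemma val_w'E i (k : nat) : val_w' n rh sh a b i k = w'_wt n rh sh i k.
Proof. by rewrite /val_w' rs_ab if_same mul1r. Qed.

Definition torus_val (y : torusGen n) k m : K :=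
  match y with
  | t_w i => w_wt n rh sh i k.+1
  | t_w' i => w'_wt n rh sh i k.+1
  | t_g | t_g' => 1
  | t_D => rr n rh 0 ^ m
  | t_D' => ss n sh 0 ^ m
  end.

Lemma rr_neq0 i : rr n rh i != 0. Proof. exact: expfz_neq0. Qed.
Lemma ss_neq0 i : ss n sh i != 0. Proof. exact: expfz_neq0. Qed.

Lemma torus_val_neq0 y k m : torus_val y k m != 0.
Proof.
case: y => [i|i||||] /=; rewrite ?oner_eq0 // ?w_wt_neq0 ?w'_wt_neq0 //.
  exact/expfz_neq0/rr_neq0.
exact/expfz_neq0/ss_neq0.
Qed.

Lemma diag_basis (d : 'I_N -> K) k m :
  mxop (diag_mx (\row_j d j)) 0 (basisV k m) = d k *: basisV k m.
Proof.
rewrite -[in RHS](addr0 m); apply: mxop_single => i.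
by rewrite !mxE mulr_natr; case: eqP => [->|].
Qed.

Lemma genop_t y k m : T (gen_t y) (basisV k m) = torus_val y k m *: basisV k m.
Proof.
case: y => [i|i||||]; rewrite /genop /torus_val.
- rewrite /torusop -val_wE; exact: (diag_basis (fun j : 'I_N => val_w n rh sh a b i j.+1)).
- rewrite /torusop -val_w'E; exact: (diag_basis (fun j : 'I_N => val_w' n rh sh a b i j.+1)).
- by rewrite -[in RHS](addr0 m); apply: mxop_single => i; rewrite rs_ab mxE mul1r.
- by rewrite -[in RHS](addr0 m); apply: mxop_single => i; rewrite rs_ab mxE mul1r.
- by rewrite /torusop /torusopV /degop /basisV linextU malgUZ.
- by rewrite /torusop /torusopV /degop /basisV linextU malgUZ.
Qed.

Lemma genop_tV y k m : T (gen_tV y) (basisV k m) = (torus_val y k m)^-1 *: basisV k m.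
Proof.
case: y => [i|i||||]; rewrite /genop /torus_val.
- rewrite /torusopV -val_wE; exact: (diag_basis (fun j : 'I_N => (val_w n rh sh a b i j.+1)^-1)).
- rewrite /torusopV -val_w'E; exact: (diag_basis (fun j : 'I_N => (val_w' n rh sh a b i j.+1)^-1)).
- by rewrite -[in RHS](addr0 m); apply: mxop_single => i; rewrite rs_ab mxE invr1 mul1r.
- by rewrite -[in RHS](addr0 m); apply: mxop_single => i; rewrite rs_ab mxE invr1 mul1r.
- by rewrite /torusop /torusopV /degop /basisV linextU malgUZ exprz_inv invr_expz.
- by rewrite /torusop /torusopV /degop /basisV linextU malgUZ exprz_inv invr_expz.
Qed.
End Rho.

(** * Scalar identities behind the defining relations *)

Section Scalars.
Context {K : fieldType} (n : nat) (rh sh : K).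
Hypotheses (rh0 : rh != 0) (sh0 : sh != 0) (n2 : (2 <= n)%N).
Local Notation xe i k := (e_coef n i k : K).
Local Notation yf i k := (f_coef n rh sh i k).
Local Notation wv := (w_wt n rh sh).
Local Notation wv' := (w'_wt n rh sh).
Local Notation Om := (Om n rh sh).
Local Notation pd := (e_idx n).
Local Notation sc := (f_idx n).

Lemma w_wt_e_idx i j k : (j <= n)%N -> xe j k != 0 -> wv i (pd k) = Om j i * wv i k.
Proof.
move=> hj hx; rewrite /w_wt /Defs.Om (epsV_e_idx n2 hj hx) dbrDl dbrDr opprD !expfzDr //.
by rewrite mulrACA mulrC.
Qed.
Lemma w'_wt_e_idx i j k : (j <= n)%N -> xe j k != 0 -> wv' i (pd k) = (Om i j)^-1 * wv' i k.
Proof.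
move=> hj hx; rewrite /w'_wt /Defs.Om (epsV_e_idx n2 hj hx) dbrDl dbrDr opprD !expfzDr //.
by rewrite invfM !invr_expz opprK mulrACA mulrC.
Qed.
Lemma w_wt_f_idx i j k : (j <= n)%N -> yf j k != 0 -> wv i (sc k) = (Om j i)^-1 * wv i k.
Proof.
move=> hj hx; rewrite /w_wt /Defs.Om (epsV_f_idx n2 hj hx) dbrDl dbrDr dbrNl dbrNr opprD !expfzDr //.
by rewrite invfM !invr_expz mulrACA mulrC.
Qed.
Lemma w'_wt_f_idx i j k : (j <= n)%N -> yf j k != 0 -> wv' i (sc k) = Om i j * wv' i k.
Proof.
move=> hj hx; rewrite /w'_wt /Defs.Om (epsV_f_idx n2 hj hx) dbrDl dbrDr dbrNl dbrNr opprD !expfzDr //.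
by rewrite opprK mulrACA mulrC.
Qed.

Lemma alpha_theta :
  alpha n 0 + \sum_(i < n.+1 | i != ord0) alpha n i *+ theta_mult n i = 0.
Proof.
rewrite big_mkcond big_ord_recl eqxx /= add0r.
(* With eps_(n+1) = 0 the last summand also has the form 2 eps_i - 2 eps_(i+1), and the sum
   telescopes. *)
rewrite (eq_bigr (fun i : 'I_n => (- (eps n i.+2 *+ 2)) - (- (eps n i.+1 *+ 2)))).
  rewrite -(big_mkord xpredT (fun i => - (eps n i.+2 *+ 2) - - (eps n i.+1 *+ 2))).
  rewrite (telescope_sumr (fun i => - (eps n i.+1 *+ 2))) //.
  suff -> : eps n n.+1 = 0 by rewrite mul0rn oppr0 sub0r opprK /alpha eqxx addNr.
  by apply/rowP => i; rewrite !mxE eqSS (ltn_eqF (ltn_ord i)).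
move=> i _; rewrite /= /bump leq0n add1n /alpha /theta_mult /=.
case: eqP => [->|_]; last by rewrite mulrnBl opprK addrC.
suff -> : eps n n.+1 = 0 by rewrite mul0rn oppr0 sub0r opprK mulr1n.
by apply/rowP => j; rewrite !mxE eqSS (ltn_eqF (ltn_ord j)).
Qed.

(** The weights are multiplicative in the root, so the product is the value at alpha_0 + theta = 0.
    This is why w_0 w_theta acts by 1, as gamma does. *)
Lemma theta_prod (W : 'rV[int]_n -> K) : W 0 = 1 -> {morph W : x y / x + y >-> x * y} ->
  W (alpha n 0) * \prod_(i < n.+1 | i != ord0) W (alpha n i) ^+ theta_mult n i = 1.
Proof.
move=> W0 WD; have WM x m : W (x *+ m) = W x ^+ m.
  by elim: m => [|m IH]; rewrite ?mulr0n // mulrS WD IH exprS.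
rewrite -[RHS]W0 -alpha_theta WD (big_morph W WD W0); congr (_ * _).
by apply: eq_bigr => i _; rewrite WM.
Qed.

Lemma w_wt_theta k :
  wv 0 k * \prod_(i < n.+1 | i != ord0) wv i k ^+ theta_mult n i = 1.
Proof.
apply: (@theta_prod (fun x => rh ^ dbr (epsV n k) x * sh ^ (- dbr x (epsV n k)))).
  by rewrite dbr0r dbr0l oppr0 !expr0z mulr1.
by move=> x y; rewrite dbrDl dbrDr opprD !expfzDr // mulrACA.
Qed.

Lemma w'_wt_theta k :
  wv' 0 k * \prod_(i < n.+1 | i != ord0) wv' i k ^+ theta_mult n i = 1.
Proof.
apply: (@theta_prod (fun x => rh ^ (- dbr x (epsV n k)) * sh ^ dbr (epsV n k) x)).
  by rewrite dbr0r dbr0l oppr0 !expr0z mulr1.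
by move=> x y; rewrite dbrDl dbrDr opprD !expfzDr // mulrACA.
Qed.

(** If e_i f_j survived on v_k, both would run along the same edge of the cycle, which carries a
    single label. *)
Lemma e_coef_f_coef_neq i j k : (i <= n)%N -> (j <= n)%N -> i <> j -> xe i (sc k) * yf j k = 0.
Proof.
move=> hi hj ij; apply/eqP; rewrite mulf_eq0; apply/norP => -[/(e_coef_node n2 hi) h1 h2].
by apply: ij; rewrite h1 (f_coef_node n2 hj h2).
Qed.
Lemma f_coef_e_coef_neq i j k : in_range n k -> (i <= n)%N -> (j <= n)%N -> i <> j ->
  yf j (pd k) * xe i k = 0.
Proof.
move=> hk hi hj ij; apply/eqP; rewrite mulf_eq0; apply/norP => -[h1 h2].
by apply: ij; rewrite (e_coef_node n2 hi h2) (f_coef_node n2 hj h1) f_idx_e_idx.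
Qed.
End Scalars.

Section Serre.
Context {K : fieldType} {W : lmodType K} (n i j : nat) (A B : W -> W).
Hypotheses (lA : linear A) (lB : linear B) (n2 : (2 <= n)%N).
Hypotheses (hi : (i <= n)%N) (hj : (j <= n)%N) (ij : i <> j).
Let adj := (i == j.+1) || (j == i.+1).
Let special := ((i == 1) && (j == 0))%N || ((i == n.-1) && (j == n)).
Hypothesis AA : forall w, A (A w) = 0.
Hypothesis AB : ~~ adj -> forall w, A (B w) = 0.
Hypothesis BA : ~~ adj -> forall w, B (A w) = 0.
Hypothesis ABA : ~~ special -> forall w, A (B (A w)) = 0.

(** Since A A = 0, only p and q at most 1 matter. For non-neighbours A B and B A vanish already; for
    neighbours the degree bound forces p = q = 1, hence A B A; in the special case the degree is at
    least 3, out of reach. *)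
Lemma serre_monomial p q w : (p + q = serreDeg n i j)%N ->
  iter p A (B (iter q A w)) = 0.
Proof.
have it0 m : iter m A 0 = 0 by elim: m => //= m ->; exact: lin_0 lA.
case: (leqP 2 q) => hq.
  case: q hq => [|[|q]] // _ _ /=; rewrite AA (lin_0 lB); exact: it0.
case: (leqP 2 p) => hp.
  by case: p hp => [|[|p]] // _ _; rewrite -addn2 iterD /= AA it0.
case: (boolP adj) => hadj; last first.
  have d0 := serreDeg_gt0 n2 hi hj ij.
  case: q hq => [|[|q]] //= _; last by move=> _; rewrite BA // it0.
  by case: p hp => [|[|p]] //= _; [lia|rewrite AB].
move=> pq; have d1 := serreDeg_adj n2 hi hj hadj.
case: (boolP special) => hsp; first by have := serreDeg_special n2 hsp; lia.
have -> : p = 1%N by lia.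
have -> : q = 1%N by lia.
exact: ABA.
Qed.
End Serre.

Ltac field_inv := rewrite /= ?exprVn ?invrK; field; nonzero.

Section EF.
Context {K : fieldType} (n : nat) (rh sh : K).
Hypotheses (rh0 : rh != 0) (sh0 : sh != 0) (n2 : (2 <= n)%N).
Local Notation xe i k := (e_coef n i k : K).
Local Notation yf i k := (f_coef n rh sh i k).
Local Notation wv := (w_wt n rh sh).
Local Notation wv' := (w'_wt n rh sh).
Local Notation pd := (e_idx n).
Local Notation sc := (f_idx n).

(** Scalar form on v_k of the commutator relation for e_i and f_i. Outside the four vectors with
    index i, i+1, i', (i+1)' both sides are zero. *)
Lemma ef_mid i k : (0 < i < n)%N -> in_range n k ->
  (rh ^+ 2 - sh ^+ 2) * (yf i k * xe i (sc k) - xe i k * yf i (pd k)) = wv i k - wv' i k.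
Proof.
move=> hi hk; have hi' : (1 <= i < n)%N by lia.
rewrite w'_wt_sym // !w_wt_mid ?invr_eq0 //; last by move: hk; rewrite /in_range /primed; lia.
have Ek : (primed n k + k = (2 * n).+1)%N by move: hk; rewrite /in_range /primed; lia.
have Ei : (primed n i + i = (2 * n).+1)%N by rewrite /primed; lia.
have Ei' : (primed n i.+1 + i.+1 = (2 * n).+1)%N by rewrite /primed; lia.
move: hk; rewrite /in_range => hk.
rewrite /e_coef /f_coef /f_idx /e_idx.
case: (k =P i) => [?|k1].
  by subst k; case: (i =P 1)%N => ?; try (by exfalso; lia); decide_nat; field_inv.
case: (k =P i.+1) => [?|k2].
  by subst k; try (by exfalso; lia); decide_nat; field_inv.
case: (k =P primed n i.+1) => [e|k3].
  by case: (k =P 1)%N => ?; case: (k =P 2 * n)%N => ?; try (by exfalso; lia); decide_nat; field_inv.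
case: (k =P primed n i) => [e|k4].
  by case: (k =P 1)%N => ?; case: (k =P 2 * n)%N => ?; try (by exfalso; lia); decide_nat; field_inv.
decide_nat; case: (k =P 1)%N => ?; case: (k =P 2 * n)%N => ?; decide_nat;
by rewrite /= ?(mulr0, mul0r, subrr, subr0).
Qed.

Lemma ef_last k : in_range n k ->
  (rh ^+ 4 - sh ^+ 4) * ((rh ^+ 2 * sh ^+ 2)^-1 * (yf n k * xe n (sc k) - xe n k * yf n (pd k)))
  = wv n k - wv' n k.
Proof.
move=> hk.
rewrite w'_wt_sym // !w_wt_last ?invr_eq0 //; last by move: hk; rewrite /in_range /primed; lia.
have Ek : (primed n k + k = (2 * n).+1)%N by move: hk; rewrite /in_range /primed; lia.
move: hk; rewrite /in_range => hk.
rewrite /e_coef /f_coef /f_idx /e_idx.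
case: (k =P n) => [?|k1].
  by subst k; try (by exfalso; lia); decide_nat; field_inv.
case: (k =P n.+1) => [?|k2].
  by subst k; try (by exfalso; lia); decide_nat; field_inv.
by case: (k =P 1)%N => ?; case: (k =P 2 * n)%N => ?; case: (leqP k n) => ?; try (by exfalso; lia); decide_nat;
  field_inv.
Qed.

Lemma ef_first k : in_range n k ->
  (rh ^+ 4 - sh ^+ 4) * ((rh ^+ 2 * sh ^+ 2)^-1 * (yf 0 k * xe 0 (sc k) - xe 0 k * yf 0 (pd k)))
  = wv 0 k - wv' 0 k.
Proof.
move=> hk.
rewrite w'_wt_sym // !w_wt_0 ?invr_eq0 //; last by move: hk; rewrite /in_range /primed; lia.
have Ek : (primed n k + k = (2 * n).+1)%N by move: hk; rewrite /in_range /primed; lia.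
move: hk; rewrite /in_range => hk.
rewrite /e_coef /f_coef /f_idx /e_idx.
case: (k =P 1)%N => [?|k1].
  by subst k; try (by exfalso; lia); decide_nat; field_inv.
case: (k =P 2 * n)%N => [?|k2].
  by try (by exfalso; lia); decide_nat; field_inv.
by case: (leqP k n) => ?; try (by exfalso; lia); decide_nat; field_inv.
Qed.
End EF.

(** * Verification of the defining relations *)

Section Relations.
Context {K : fieldType} (n : nat) (rh sh a b : K).
Hypotheses (rh0 : rh != 0) (sh0 : sh != 0) (n2 : (2 <= n)%N).
Hypotheses (hab : a * b = (rh ^+ 2 * sh ^+ 2)^-1).
Hypothesis rsi : forall i, (i <= n)%N -> rr n rh i != ss n sh i.
Local Notation N := (2 * n)%N.
Variables (W : lmodType K) (T : Ugen n -> W -> W) (basisV : 'I_N -> int -> W).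
Hypothesis lT : forall g, linear (T g).
Hypothesis bvP : forall f g : W -> W, linear f -> linear g ->
  (forall k m, f (basisV k m) = g (basisV k m)) -> f =1 g.
Hypothesis Te : forall (i : 'I_n.+1) k m,
  T (gen_e i) (basisV k m) = (e_scal a i * e_coef n i k.+1) *: basisV (e_ord k) (m + (i == ord0)%:R).
Hypothesis Tf : forall (i : 'I_n.+1) k m,
  T (gen_f i) (basisV k m) = (f_scal n rh sh b i * f_coef n rh sh i k.+1) *: basisV (f_ord k) (m - (i == ord0)%:R).
Hypothesis Tt : forall y k m, T (gen_t y) (basisV k m) = torus_val rh sh y k m *: basisV k m.
Hypothesis TtV : forall y k m, T (gen_tV y) (basisV k m) = (torus_val rh sh y k m)^-1 *: basisV k m.
Local Notation act := (freeAct T).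
Implicit Types (k : 'I_N) (m : int) (w : W).

Let actM x y w : act (x * y) w = act x (act y w).
Proof. exact: (freeActM lT). Qed.
Let actG g w : act (freeGen K g) w = T g w.
Proof. exact: freeAct_gen. Qed.
Let actZ c x w : act (c *: x) w = c *: act x w.
Proof. exact: (lin_Z (freeAct_linl T w)). Qed.
Let actZr c x w : act x (c *: w) = c *: act x w.
Proof. exact: (lin_Z (freeAct_linr lT x)). Qed.
Let actB x y w : act (x - y) w = act x w - act y w.
Proof. by rewrite (lin_D (freeAct_linl T w)) -[- y]scaleN1r actZ scaleN1r. Qed.
Let act1 w : act 1 w = w.
Proof. exact: freeAct1. Qed.
Let TZ g c w : T g (c *: w) = c *: T g w.
Proof. exact: (lin_Z (lT g)). Qed.

Lemma act_basis x y :
  (forall k m, act x (basisV k m) = act y (basisV k m)) -> forall w, act x w = act y w.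
Proof.
by move=> h; apply: bvP => //; exact: freeAct_linr.
Qed.

Lemma act_prod (I : finType) (P : pred I) (F : I -> freeAlg K (Ugen n)) (c : I -> K)
    (e : I -> nat) w :
  (forall i, act (F i) w = c i *: w) ->
  act (\prod_(i | P i) F i ^+ e i) w = (\prod_(i | P i) c i ^+ e i) *: w.
Proof.
move=> h; apply: (big_ind2 (fun x d => act x w = d *: w)).
- by rewrite act1 scale1r.
- move=> x c1 y c2 hx hy; rewrite actM hy actZr hx scalerA.
  by rewrite mulrC.
move=> i _; elim: (e i) => [|q IH]; first by rewrite !expr0 act1 scale1r.
rewrite !exprS actM IH actZr h scalerA.
by rewrite mulrC.
Qed.

Lemma act_exp x p w : act (x ^+ p) w = iter p (act x) w.
Proof. by elim: p => [|p IH]; rewrite ?act1 // exprS actM IH. Qed.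

Lemma ef_diag (i : nat) (k : nat) : (i <= n)%N -> in_range n k ->
  f_scal n rh sh b i * f_coef n rh sh i k * (e_scal a i * e_coef n i (f_idx n k))
  - e_scal a i * e_coef n i k * (f_scal n rh sh b i * f_coef n rh sh i (e_idx n k))
  = (rr n rh i - ss n sh i)^-1 * (w_wt n rh sh i k - w'_wt n rh sh i k).
Proof.
move=> hi hk; have nonzero : rr n rh i - ss n sh i != 0 by rewrite subr_eq0 rsi.
apply: (mulfI nonzero); rewrite mulVKf //.
move: nonzero; rewrite /rr /ss ip_alpha_diag // => _.
transitivity ((rh ^ (if (i == 0)%N || (i == n) then 4 else 2 : int)
   - sh ^ (if (i == 0)%N || (i == n) then 4 else 2 : int)) * (e_scal a i * f_scal n rh sh b i *
  (f_coef n rh sh i k * e_coef n i (f_idx n k) - e_coef n i k * f_coef n rh sh i (e_idx n k)))).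
  by congr (_ * _); ring.
rewrite /e_scal /f_scal; case: (i =P 0)%N => [->|i0] /=.
  by rewrite hab; exact: ef_first.
case: (i =P n) => [->|iN]; first by rewrite mul1r; exact: ef_last.
by rewrite !mul1r; apply: ef_mid => //; lia.
Qed.

Let actT := (TZ, Te, Tf, Tt, TtV, scalerA).

Let act2 g h w : act (freeGen K g * freeGen K h) w = T g (T h w).
Proof. by rewrite actM (actG g) (actG h). Qed.

Let act3 g h g3 w : act (freeGen K g * freeGen K h * freeGen K g3) w = T g (T h (T g3 w)).
Proof. by rewrite (actM (_ * _)) (actG g3) act2. Qed.

Let act_monomial g h p q w :
  act (freeGen K g ^+ p * freeGen K h * freeGen K g ^+ q) w
  = iter p (T g) (T h (iter q (T g) w)).
Proof.
rewrite (actM (_ * _)) (actM (_ ^+ p)) (act_exp _ p) (act_exp _ q) (actG h).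
have E r u : iter r (act (freeGen K g)) u = iter r (T g) u.
  by apply: eq_iter => u'; rewrite actG.
by rewrite !E.
Qed.

Lemma torus_comm y y' w : T (gen_t y) (T (gen_t y') w) = T (gen_t y') (T (gen_t y) w).
Proof.
move: w; apply: bvP => [||k m]; try exact: lin_comp.
by rewrite !actT mulrC.
Qed.

Lemma torus_e y (j : 'I_n.+1) c w :
  (forall k m, e_coef n j k.+1 != 0 :> K ->
     torus_val rh sh y (e_ord k) (m + (j == ord0)%:R) = c * torus_val rh sh y k m) ->
  T (gen_t y) (T (gen_e j) w) = c *: T (gen_e j) (T (gen_t y) w).
Proof.
move=> h; move: w; apply: bvP => [||k m]; try exact: lin_comp.
  by apply: lin_scale; exact: lin_comp.
rewrite !actT; case: (e_coef n j k.+1 =P 0 :> K) => [->|/eqP /h ->].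
  by rewrite !(mulr0, mul0r).
by congr (_ *: _); rewrite mulrC.
Qed.

Lemma torus_f y (j : 'I_n.+1) c w :
  (forall k m, f_coef n rh sh j k.+1 != 0 ->
     torus_val rh sh y (f_ord k) (m - (j == ord0)%:R) = c * torus_val rh sh y k m) ->
  T (gen_t y) (T (gen_f j) w) = c *: T (gen_f j) (T (gen_t y) w).
Proof.
move=> h; move: w; apply: bvP => [||k m]; try exact: lin_comp.
  by apply: lin_scale; exact: lin_comp.
rewrite !actT; case: (f_coef n rh sh j k.+1 =P 0) => [->|/eqP /h ->].
  by rewrite !(mulr0, mul0r).
by congr (_ *: _); rewrite mulrC.
Qed.

Lemma torusK y w : T (gen_t y) (T (gen_tV y) w) = w.
Proof.
move: w; apply: bvP => [||k m]; [exact: lin_comp|by []|].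
by rewrite !actT mulVf ?scale1r // torus_val_neq0.
Qed.
Lemma torusVK y w : T (gen_tV y) (T (gen_t y) w) = w.
Proof.
move: w; apply: bvP => [||k m]; [exact: lin_comp|by []|].
by rewrite !actT mulfV ?scale1r // torus_val_neq0.
Qed.

Lemma torus_one y w : (forall k m, torus_val rh sh y k m = 1) -> T (gen_t y) w = w.
Proof.
by move=> h; move: w; apply: bvP => // k m; rewrite Tt h scale1r.
Qed.

(** A product of two generators that survives on a basis vector names the labels of two consecutive
    edges. The vanishing needed for the Serre relations thus becomes a statement about labels. *)
Lemma ee_nonzero (i j : 'I_n.+1) k m : T (gen_e i) (T (gen_e j) (basisV k m)) <> 0 ->
  j = node n k.+1 :> nat /\ i = node n (e_idx n k.+1) :> nat.
Proof.
rewrite !actT e_ordE => h; split; apply/eqP; apply/negPn/negP => /eqP ne; apply: h.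
  case: (e_coef n j k.+1 =P 0 :> K) => [->|/eqP /(e_coef_node n2) -/(_ (ltn_ord j)) //].
  by rewrite mulr0 mul0r scale0r.
case: (e_coef n i (e_idx n k.+1) =P 0 :> K) => [->|/eqP /(e_coef_node n2) -/(_ (ltn_ord i)) //].
by rewrite !mulr0 scale0r.
Qed.

Lemma ff_nonzero (i j : 'I_n.+1) k m : T (gen_f i) (T (gen_f j) (basisV k m)) <> 0 ->
  j = node n (f_idx n k.+1) :> nat /\ i = node n (f_idx n (f_idx n k.+1)) :> nat.
Proof.
rewrite !actT f_ordE => h; split; apply/eqP; apply/negPn/negP => /eqP ne; apply: h.
  case: (f_coef n rh sh j k.+1 =P 0) => [->|/eqP /(f_coef_node n2) -/(_ (ltn_ord j)) //].
  by rewrite mulr0 mul0r scale0r.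
case: (f_coef n rh sh i (f_idx n k.+1) =P 0) => [->|/eqP /(f_coef_node n2) -/(_ (ltn_ord i)) //].
by rewrite !mulr0 scale0r.
Qed.

Lemma serre_e (i j : 'I_n.+1) p q w : i != j -> (p + q = serreDeg n i j)%N ->
  iter p (T (gen_e i)) (T (gen_e j) (iter q (T (gen_e i)) w)) = 0.
Proof.
move=> ij; apply: serre_monomial => //; try by rewrite -ltnS.
- by move/val_inj => e; rewrite e eqxx in ij.
- move=> {}w; move: w; apply: bvP => [||k m]; [exact: lin_comp|exact: lin_zero|].
  apply: contrapT => /ee_nonzero [h1 h2].
  by have := node_e_idx n2 (ord_in_range k); rewrite -h1 -h2; lia.
- move=> adj {}w; move: w; apply: bvP => [||k m]; [exact: lin_comp|exact: lin_zero|].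
  apply: contrapT => /ee_nonzero [h1 h2].
  by have := node_e_idx n2 (ord_in_range k); rewrite -h1 -h2; move: adj; lia.
- move=> adj {}w; move: w; apply: bvP => [||k m]; [exact: lin_comp|exact: lin_zero|].
  apply: contrapT => /ee_nonzero [h1 h2].
  by have := node_e_idx n2 (ord_in_range k); rewrite -h1 -h2; move: adj; lia.
move=> sp {}w; move: w; apply: bvP => [||k m]; [by do 2!apply: lin_comp|exact: lin_zero|].
apply: contrapT => h.
have [h1 h2] : i = node n k.+1 :> nat /\ j = node n (e_idx n k.+1) :> nat.
  by apply: (ee_nonzero (m := m)) => e; apply: h; rewrite e (lin_0 (lT _)).
have [h3 h4] : j = node n (e_ord k).+1 :> nat /\ i = node n (e_idx n (e_ord k).+1) :> nat.
  apply: (ee_nonzero (m := m + (i == ord0)%:R)) => e; apply: h.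
  by rewrite Te !TZ e scaler0.
(* A surviving e_i e_j e_i is a walk with labels i, j, i, which [node_e_idx2] allows in the special
   cases only. *)
rewrite e_ordE in h4; move: sp.
by have := node_e_idx2 n2 (ord_in_range k); rewrite -h4 -h1 -h2 => ->.
Qed.

(** The f_i run through the same edges backwards, so the label lemmas are applied at the end point
    of the walk and read along [e_idx]. *)
Lemma serre_f (i j : 'I_n.+1) p q w : i != j -> (p + q = serreDeg n i j)%N ->
  iter p (T (gen_f i)) (T (gen_f j) (iter q (T (gen_f i)) w)) = 0.
Proof.
move=> ij; apply: serre_monomial => //; try by rewrite -ltnS.
- by move/val_inj => e; rewrite e eqxx in ij.
- move=> {}w; move: w; apply: bvP => [||k m]; [exact: lin_comp|exact: lin_zero|].
  apply: contrapT => /ff_nonzero [h1 h2].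
  have := node_e_idx n2 (f_idx_in_range (f_idx_in_range (ord_in_range k))); rewrite e_idx_f_idx; last exact/f_idx_in_range/ord_in_range.
  by rewrite -h1 -h2; lia.
- move=> adj {}w; move: w; apply: bvP => [||k m]; [exact: lin_comp|exact: lin_zero|].
  apply: contrapT => /ff_nonzero [h1 h2].
  have := node_e_idx n2 (f_idx_in_range (f_idx_in_range (ord_in_range k))); rewrite e_idx_f_idx; last exact/f_idx_in_range/ord_in_range.
  by rewrite -h1 -h2; move: adj; lia.
- move=> adj {}w; move: w; apply: bvP => [||k m]; [exact: lin_comp|exact: lin_zero|].
  apply: contrapT => /ff_nonzero [h1 h2].
  have := node_e_idx n2 (f_idx_in_range (f_idx_in_range (ord_in_range k))); rewrite e_idx_f_idx; last exact/f_idx_in_range/ord_in_range.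
  by rewrite -h1 -h2; move: adj; lia.
move=> sp {}w; move: w; apply: bvP => [||k m]; [by do 2!apply: lin_comp|exact: lin_zero|].
apply: contrapT => h.
have [h1 h2] : i = node n (f_idx n k.+1) :> nat /\ j = node n (f_idx n (f_idx n k.+1)) :> nat.
  by apply: (ff_nonzero (m := m)) => e; apply: h; rewrite e (lin_0 (lT _)).
have [h3 h4] : j = node n (f_idx n (f_ord k).+1) :> nat /\ i = node n (f_idx n (f_idx n (f_ord k).+1)) :> nat.
  apply: (ff_nonzero (m := m - (i == ord0)%:R)) => e; apply: h.
  by rewrite Tf !TZ e scaler0.
rewrite f_ordE in h4; move: sp.
have := node_e_idx2 n2 (f_idx_in_range (f_idx_in_range (f_idx_in_range (ord_in_range k)))).
rewrite !e_idx_f_idx; try exact/f_idx_in_range/f_idx_in_range/ord_in_range; try exact/f_idx_in_range/ord_in_range.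
by rewrite -h4 -h1 -h2 => ->.
Qed.

Lemma Urel_act x y : Urel rh sh x y -> forall w, act x w = act y w.
Proof.
have tD (q : K) m d : q != 0 -> q ^ (m + d) = q ^ d * q ^ m.
  by move=> q0; rewrite expfzDr // mulrC.
(* Both gamma and gamma' act as the identity, which makes their centrality immediate. *)
have one_g w : T (gen_t t_g) w = w by apply: torus_one.
have one_g' w : T (gen_t t_g') w = w by apply: torus_one.
case=> {x y}.
- by move=> y w; rewrite [LHS]act2 act1 torusK.
- by move=> y w; rewrite [LHS]act2 act1 torusVK.
- by move=> y y' w; rewrite [LHS]act2 [RHS]act2 torus_comm.
- move=> i w; rewrite [LHS]act3 [RHS]actZ [in RHS]actG (torus_e (c := rr n rh i ^+ (i == ord0))) ?torusK //.
  move=> k m _ /=; case: eqP => [->|_]; last by rewrite addr0 expr0 mul1r.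
  exact/tD/rr_neq0.
- move=> i w; rewrite [LHS]act3 [RHS]actZ [in RHS]actG (torus_f (c := rr n rh i ^- (i == ord0))) ?torusK //.
  move=> k m _ /=; case: eqP => [->|_]; last by rewrite subr0 expr0 invr1 mul1r.
  exact/tD/rr_neq0.
- move=> i w; rewrite [LHS]act3 [RHS]actZ [in RHS]actG (torus_e (c := ss n sh i ^+ (i == ord0))) ?torusK //.
  move=> k m _ /=; case: eqP => [->|_]; last by rewrite addr0 expr0 mul1r.
  exact/tD/ss_neq0.
- move=> i w; rewrite [LHS]act3 [RHS]actZ [in RHS]actG (torus_f (c := ss n sh i ^- (i == ord0))) ?torusK //.
  move=> k m _ /=; case: eqP => [->|_]; last by rewrite subr0 expr0 invr1 mul1r.
  exact/tD/ss_neq0.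
- apply: act_basis => k m; rewrite [LHS]actG one_g [RHS]actM [RHS]actG.
  rewrite (@act_prod _ _ _ (fun i : 'I_n.+1 => w_wt n rh sh i k.+1)) => [|i]; last by rewrite actG Tt.
  by rewrite TZ Tt scalerA mulrC /= w_wt_theta // scale1r.
- apply: act_basis => k m; rewrite [LHS]actG one_g' [RHS]actM [RHS]actG.
  rewrite (@act_prod _ _ _ (fun i : 'I_n.+1 => w'_wt n rh sh i k.+1)) => [|i]; last by rewrite actG Tt.
  by rewrite TZ Tt scalerA mulrC /= w'_wt_theta // scale1r.
- by move=> g w; rewrite [LHS]act2 [RHS]act2 !one_g.
- by move=> g w; rewrite [LHS]act2 [RHS]act2 !one_g'.
- move=> i j w; rewrite [LHS]act2 [RHS]actZ [in RHS]act2; apply: torus_e => k m h /=.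
  by rewrite e_ordE (w_wt_e_idx rh0 sh0 n2 _ (ltn_ord j) h).
- move=> i j w; rewrite [LHS]act2 [RHS]actZ [in RHS]act2; apply: torus_f => k m h /=.
  by rewrite f_ordE (w_wt_f_idx rh0 sh0 n2 _ (ltn_ord j) h).
- move=> i j w; rewrite [LHS]act2 [RHS]actZ [in RHS]act2; apply: torus_e => k m h /=.
  by rewrite e_ordE (w'_wt_e_idx rh0 sh0 n2 _ (ltn_ord j) h).
- move=> i j w; rewrite [LHS]act2 [RHS]actZ [in RHS]act2; apply: torus_f => k m h /=.
  by rewrite f_ordE (w'_wt_f_idx rh0 sh0 n2 _ (ltn_ord j) h).
- move=> i j; apply: act_basis => k m; rewrite [LHS]actB [X in X - _]act2 [X in _ - X]act2 [RHS]actZ [in RHS]actZ [in RHS]actB [X in _ *: (_ *: (X - _))]actG [X in _ *: (_ *: (_ - X))]actG !actT e_ordE f_ordE.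
  (* For i different from j both products vanish on every basis vector. For i = j both return to v_k
     with the same power of u, and [ef_diag] compares the scalars. *)
  case: (i =P j) => [<-|/eqP ij]; last first.
    have nij : (i : nat) <> j by move/val_inj => e; rewrite e eqxx in ij.
    have hi := ltn_ord i; have hj := ltn_ord j.
    have -> : f_scal n rh sh b j * f_coef n rh sh j k.+1 * (e_scal a i * e_coef n i (f_idx n k.+1)) = 0.
      transitivity (f_scal n rh sh b j * e_scal a i * (e_coef n i (f_idx n k.+1) * f_coef n rh sh j k.+1)); first by ring.
      by rewrite (e_coef_f_coef_neq _ _ n2) ?mulr0.
    have -> : e_scal a i * e_coef n i k.+1 * (f_scal n rh sh b j * f_coef n rh sh j (e_idx n k.+1)) = 0.
      transitivity (f_scal n rh sh b j * e_scal a i * (f_coef n rh sh j (e_idx n k.+1) * e_coef n i k.+1)); first by ring.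
      by rewrite (f_coef_e_coef_neq _ _ n2) ?mulr0 ?ord_in_range.
    by rewrite mul0r !scale0r subrr.
  rewrite mul1r e_ord_f_ord f_ord_e_ord addrK subrK -!scalerBl scalerA.
  by rewrite (ef_diag (ltn_ord i)) ?ord_in_range.
- move=> i j ij w; rewrite (big_morph (act^~ w) (lin_D (freeAct_linl T w)) (lin_0 (freeAct_linl T w))).
  rewrite (lin_0 (freeAct_linl T w)) big1 // => k _.
  by rewrite actZ act_monomial serre_e ?scaler0 // subnK // -ltnS.
- move=> i j ij w; rewrite (big_morph (act^~ w) (lin_D (freeAct_linl T w)) (lin_0 (freeAct_linl T w))).
  rewrite (lin_0 (freeAct_linl T w)) big1 // => k _.
  by rewrite actZ act_monomial serre_f ?scaler0 // subnKC // -ltnS.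
Qed.
End Relations.

(** * The intertwining property *)

Section Theta.
Context {K : fieldType} (n : nat) (rh sh : K).
Hypotheses (rh0 : rh != 0) (sh0 : sh != 0) (n2 : (2 <= n)%N).
Local Notation N := (2 * n)%N.
Variables (W : lmodType K) (b2 : 'I_N -> 'I_N -> int -> int -> W).
Implicit Types (i j k l p q : 'I_N) (c d : int) (r : {poly K}).

(* v_i (x) v_j u^c v^d r(u/v) *)
Definition laurent c d i j r : W := \sum_(e < size r) r`_e *: b2 i j (c + e%:Z) (d - e%:Z).

Lemma laurent_wide s c d i j r : (size r <= s)%N ->
  laurent c d i j r = \sum_(e < s) r`_e *: b2 i j (c + e%:Z) (d - e%:Z).
Proof.
move=> le; rewrite /laurent (big_ord_widen _ (fun e => r`_e *: b2 i j (c + e%:Z) (d - e%:Z)) le).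
rewrite big_mkcond; apply: eq_bigr => e _; case: ltnP => // h.
by rewrite nth_default // scale0r.
Qed.

Lemma laurent_lin c d i j : linear (laurent c d i j).
Proof.
move=> x r r'; pose s := maxn (size r) (size r').
rewrite !(@laurent_wide s) ?leq_maxl ?leq_maxr //.
  by rewrite scaler_sumr -big_split; apply: eq_bigr => e _; rewrite coefD coefZ scalerDl scalerA.
apply: leq_trans (size_polyD _ _) _; rewrite geq_max leq_maxr andbT.
exact: leq_trans (size_scale_leq _ _) (leq_maxl _ _).
Qed.

Lemma laurent_X c d i j r : laurent c d i j ('X * r) = laurent (c + 1) (d - 1) i j r.
Proof.
rewrite mulrC (@laurent_wide (size r).+1).
  rewrite big_ord_recl coefMX eqxx scale0r add0r; apply: eq_bigr => e _.
  by rewrite lift0 coefMX /=; congr (_ *: b2 _ _ _ _); lia.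
by apply: leq_trans (size_polyMleq _ _) _; rewrite size_polyX addn2.
Qed.

Lemma laurent_delta c d p q r :
  \sum_(i : 'I_N) \sum_(j : 'I_N) laurent c d i j (delta2 i.+1 j.+1 p.+1 q.+1 * r) = laurent c d p q r.
Proof.
have T0 i j : laurent c d i j 0 = 0 by exact: (lin_0 (laurent_lin c d i j)).
rewrite (bigD1 p) //= [X in _ + X]big1 ?addr0 => [|i /negbTE ne].
  rewrite (bigD1 q) //= [X in _ + X]big1 ?addr0 => [|j /negbTE ne].
    by rewrite /delta2 !eqxx mul1r.
  have -> : delta2 p.+1 j.+1 p.+1 q.+1 = 0 :> {poly K}; last by rewrite mul0r T0.
  rewrite /delta2 !eqSS; case: eqP => // _; case: eqP => // /val_inj e.
  by rewrite e eqxx in ne.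
apply: big1 => j _.
have -> : delta2 i.+1 j.+1 p.+1 q.+1 = 0 :> {poly K}; last by rewrite mul0r T0.
by rewrite /delta2 !eqSS; case: eqP => // /val_inj e; rewrite e eqxx in ne.
Qed.

Local Notation R := (Rrow n rh sh polyC 'X 1).
Local Notation P p q k l := (R (delta2 (p : 'I_N).+1 (q : 'I_N).+1) (k : 'I_N).+1 (l : 'I_N).+1).
Local Notation wv := (w_wt n rh sh).
Local Notation wv' := (w'_wt n rh sh).

Definition Rhat_image k l c d : W := \sum_(i : 'I_N) \sum_(j : 'I_N) laurent c d i j (P i j k l).

Lemma laurent_Rrow (g : 'I_N -> 'I_N -> nat -> nat -> {poly K}) c d k l :
  \sum_(i : 'I_N) \sum_(j : 'I_N) laurent c d i j (R (g i j) k.+1 l.+1)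
  = \sum_(p : 'I_N) \sum_(q : 'I_N) \sum_(i : 'I_N) \sum_(j : 'I_N) laurent c d i j (g i j p.+1 q.+1 * P p q k l).
Proof.
transitivity (\sum_(i : 'I_N) \sum_(j : 'I_N) \sum_(p : 'I_N) \sum_(q : 'I_N) laurent c d i j (g i j p.+1 q.+1 * P p q k l)).
  apply: eq_bigr => i _; apply: eq_bigr => j _.
  rewrite (@Rrow_delta K n rh sh _ polyC) (lin_sum (laurent_lin c d i j)); apply: eq_bigr => p _.
  by rewrite (lin_sum (laurent_lin c d i j)).
rewrite pair_big [RHS]pair_big; under eq_bigr do rewrite pair_big.
under [RHS]eq_bigr do rewrite pair_big.
exact: exchange_big.
Qed.

Lemma spec_laurent m c d i j r :
  laurent c d i j (spec m 'X * r) = laurent (c + (m == 0)%N%:R) (d - (m == 0)%N%:R) i j r.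
Proof. by rewrite /spec; case: (m == 0)%N; rewrite ?laurent_X // addr0 subr0 mul1r. Qed.

Lemma spec1 m : spec m (1 : {poly K}) = 1.
Proof. by rewrite /spec if_same. Qed.

(** R is taken at the parameters X and 1, while e_0 carries u or v. Once u^c v^(d + dm) is factored
    out, v becomes 1 and u becomes X, so the identity is [Rrow_Erow] applied to the functional of
    each entry. *)
Lemma Rhat_image_E m k l c d (dm := (m == 0)%N%:R : int) : (m <= n)%N ->
  e_coef n m k.+1 *: Rhat_image (e_ord k) l (c + dm) d + (wv m k.+1 * e_coef n m l.+1) *: Rhat_image k (e_ord l) c (d + dm)
  = \sum_(p : 'I_N) \sum_(q : 'I_N) (e_coef n m p.+1 *: laurent c (d + dm) (e_ord p) q (P p q k l)
      + (wv m p.+1 * e_coef n m q.+1) *: laurent (c + dm) d p (e_ord q) (P p q k l)).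
Proof.
move=> hm.
have TX i j r : laurent (c + dm) d i j r = laurent c (d + dm) i j (spec m 'X * r).
  by rewrite spec_laurent addrK.
transitivity (\sum_(i : 'I_N) \sum_(j : 'I_N) laurent c (d + dm) i j
    (Erow n rh sh polyC m 'X 1 (R (delta2 i.+1 j.+1)) k.+1 l.+1)).
  rewrite /Rhat_image !scaler_sumr -big_split; apply: eq_bigr => i _ /=.
  rewrite !scaler_sumr -big_split; apply: eq_bigr => j _ /=.
  rewrite TX -!(lin_Z (laurent_lin _ _ _ _)) -(lin_D (laurent_lin _ _ _ _)).
  rewrite /Erow spec1 !e_ordE -!mul_polyC (polyCM (w_wt _ _ _ _ _)); congr (laurent _ _ _ _ (_ + _)); ring.
transitivity (\sum_(i : 'I_N) \sum_(j : 'I_N) laurent c (d + dm) i j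
    (R (Erow n rh sh polyC m 1 'X (delta2 i.+1 j.+1)) k.+1 l.+1)).
  apply: eq_bigr => i _; apply: eq_bigr => j _.
  by rewrite (@Rrow_Erow K n rh sh rh0 sh0 n2 _ polyC) ?ord_in_range.
rewrite laurent_Rrow; apply: eq_bigr => p _; apply: eq_bigr => q _.
rewrite TX -!(lin_Z (laurent_lin _ _ _ _)) -!laurent_delta -big_split; apply: eq_bigr => i _ /=.
rewrite -big_split; apply: eq_bigr => j _ /=.
rewrite -(lin_D (laurent_lin _ _ _ _)); congr (laurent _ _ _ _ _).
rewrite /Erow spec1 !e_ordE -!mul_polyC (polyCM (w_wt _ _ _ _ _)).
have aux (x1 v x2 s d1 d2 r : {poly K}) :
  (1 * x1 * d1 + s * v * x2 * d2) * r = d1 * (x1 * r) + d2 * (v * x2 * (s * r)) by ring.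
exact: aux.
Qed.

Lemma Rhat_image_F m k l c d (dm := (m == 0)%N%:R : int) : (m <= n)%N ->
  (f_coef n rh sh m k.+1 * wv' m l.+1) *: Rhat_image (f_ord k) l (c - dm) d
    + f_coef n rh sh m l.+1 *: Rhat_image k (f_ord l) c (d - dm)
  = \sum_(p : 'I_N) \sum_(q : 'I_N) ((f_coef n rh sh m p.+1 * wv' m q.+1) *: laurent c (d - dm) (f_ord p) q (P p q k l)
      + f_coef n rh sh m q.+1 *: laurent (c - dm) d p (f_ord q) (P p q k l)).
Proof.
move=> hm.
have TX i j r : laurent c (d - dm) i j r = laurent (c - dm) d i j (spec m 'X * r).
  by rewrite spec_laurent subrK.
transitivity (\sum_(i : 'I_N) \sum_(j : 'I_N) laurent (c - dm) d i j
    (Frow n rh sh polyC m 1 'X (R (delta2 i.+1 j.+1)) k.+1 l.+1)).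
  rewrite /Rhat_image !scaler_sumr -big_split; apply: eq_bigr => i _ /=.
  rewrite !scaler_sumr -big_split; apply: eq_bigr => j _ /=.
  rewrite TX -!(lin_Z (laurent_lin _ _ _ _)) -(lin_D (laurent_lin _ _ _ _)).
  rewrite /Frow spec1 !f_ordE -!mul_polyC (polyCM (f_coef _ _ _ _ _)); congr (laurent _ _ _ _ (_ + _)); ring.
transitivity (\sum_(i : 'I_N) \sum_(j : 'I_N) laurent (c - dm) d i j
    (R (Frow n rh sh polyC m 'X 1 (delta2 i.+1 j.+1)) k.+1 l.+1)).
  apply: eq_bigr => i _; apply: eq_bigr => j _.
  by rewrite (@Rrow_Frow K n rh sh rh0 sh0 n2 _ polyC) ?ord_in_range.
rewrite laurent_Rrow; apply: eq_bigr => p _; apply: eq_bigr => q _.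
rewrite TX -!(lin_Z (laurent_lin _ _ _ _)) -!laurent_delta -big_split; apply: eq_bigr => i _ /=.
rewrite -big_split; apply: eq_bigr => j _ /=.
rewrite -(lin_D (laurent_lin _ _ _ _)); congr (laurent _ _ _ _ _).
rewrite /Frow spec1 !f_ordE -!mul_polyC (polyCM (f_coef _ _ _ _ _)).
have aux (x1 v x2 s d1 d2 r : {poly K}) :
  (s * x1 * v * d1 + 1 * x2 * d2) * r = d1 * (x1 * v * (s * r)) + d2 * (x2 * r) by ring.
exact: aux.
Qed.

(** An entry of R can be nonzero only between vectors of equal weight, and there the two products of
    values of [h] agree. *)
Lemma Rrow_delta_weight (h : nat -> K) p q k l :
  (forall m, in_range n m -> h m * h (primed n m) = 1) ->
  (h p.+1 * h q.+1) *: P p q k l = (h k.+1 * h l.+1) *: P p q k l.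
Proof.
move=> hh; rewrite -!mul_polyC (polyCM (h p.+1)) (polyCM (h k.+1)).
rewrite -(@Rrow_weight K n rh sh _ polyC (fun m => (h m)%:P)) ?ord_in_range //; last first.
  by move=> m hm; rewrite -polyCM hh.
transitivity (R (fun a b => ((h p.+1)%:P * (h q.+1)%:P) * delta2 p.+1 q.+1 a b + 0 * 0) k.+1 l.+1).
  by rewrite (@Rrow_lin K n rh sh _ polyC) mul0r addr0.
apply: eq_Rrow; try exact: ord_in_range; move=> a b _ _; rewrite mul0r addr0 /delta2.
by case: (a =P p.+1) => [->|]; rewrite ?mulr0 //; case: (b =P q.+1) => [->|]; rewrite ?mulr0.
Qed.
End Theta.

Section TensorBasis.
Context {K : fieldType} (n : nat).
Local Notation N := (2 * n)%N.
Implicit Types (i j k l : 'I_N) (c d : int) (A B C D : @Vaff K n -> @Vaff K n).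
Implicit Types (al be : K) (s t : int).

Definition basisVV k l c d : @V2aff K n := << ((k, l), (c, d)) >>.

Lemma basisVV_ext (W : lmodType K) (f g : @V2aff K n -> W) :
  linear f -> linear g -> (forall k l c d, f (basisVV k l c d) = g (basisVV k l c d)) -> f =1 g.
Proof. by move=> lf lg h; apply: lin_basis => // -[[k l] [c d]]; exact: h. Qed.

Lemma tensUV_lin A B : linear (tensUV A B). Proof. exact: linext_lin. Qed.
Lemma tensVU_lin A B : linear (tensVU A B). Proof. exact: linext_lin. Qed.

Lemma tensUV_b A B k l c d : tensUV A B (basisVV k l c d)
  = tens (fun x y => ((x.1, y.1), (x.2, y.2))) (A (basisV k c)) (B (basisV l d)).
Proof. exact: linextU. Qed.
Lemma tensVU_b A B k l c d : tensVU A B (basisVV k l c d)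
  = tens (fun x y => ((x.1, y.1), (y.2, x.2))) (A (basisV k d)) (B (basisV l c)).
Proof. exact: linextU. Qed.

Lemma tensUV_basis A B k k' l l' al be c d c' d' :
  A (basisV k c) = al *: basisV k' c' -> B (basisV l d) = be *: basisV l' d' ->
  tensUV A B (basisVV k l c d) = (al * be) *: basisVV k' l' c' d'.
Proof.
move=> hA hB; rewrite tensUV_b hA hB (lin_Z (tens_linl _ _)) (lin_Z (tens_linr _ _)).
by rewrite scalerA tensU.
Qed.
Lemma tensVU_basis A B k k' l l' al be c d c' d' :
  A (basisV k d) = al *: basisV k' d' -> B (basisV l c) = be *: basisV l' c' ->
  tensVU A B (basisVV k l c d) = (al * be) *: basisVV k' l' c' d'.
Proof.
move=> hA hB; rewrite tensVU_b hA hB (lin_Z (tens_linl _ _)) (lin_Z (tens_linr _ _)).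
by rewrite scalerA tensU.
Qed.

Lemma tensUV_id (x : @V2aff K n) : tensUV id id x = x.
Proof.
move: x; apply: basisVV_ext => //; first exact: tensUV_lin.
move=> k l c d; rewrite (tensUV_basis (al := 1) (be := 1) (k' := k) (l' := l) (c' := c) (d' := d)) ?scale1r //.
by rewrite mulr1 scale1r.
Qed.
Lemma tensVU_id (x : @V2aff K n) : tensVU id id x = x.
Proof.
move: x; apply: basisVV_ext => //; first exact: tensVU_lin.
move=> k l c d; rewrite (tensVU_basis (al := 1) (be := 1) (k' := k) (l' := l) (c' := c) (d' := d)) ?scale1r //.
by rewrite mulr1 scale1r.
Qed.

Lemma tensUVZ a A B x : tensUV (fun w => a *: A w) B x = a *: tensUV A B x.
Proof.
move: x; apply: basisVV_ext; [exact: tensUV_lin|by apply: lin_scale; exact: tensUV_lin|].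
by move=> k l c d; rewrite !tensUV_b (lin_Z (tens_linl _ _)).
Qed.
Lemma tensVUZ a A B x : tensVU (fun w => a *: A w) B x = a *: tensVU A B x.
Proof.
move: x; apply: basisVV_ext; [exact: tensVU_lin|by apply: lin_scale; exact: tensVU_lin|].
by move=> k l c d; rewrite !tensVU_b (lin_Z (tens_linl _ _)).
Qed.

Lemma tensUV_tens A B : linear A -> linear B -> forall x y,
  tensUV A B (tens (fun x y => ((x.1, y.1), (x.2, y.2))) x y)
  = tens (fun x y => ((x.1, y.1), (x.2, y.2))) (A x) (B y).
Proof.
move=> lA lB x y; move: x; apply: lin_basis => [||[k c]].
- exact: lin_comp (tensUV_lin A B) (tens_linl _ _).
- exact: lin_comp (tens_linl _ _) lA.
move: y; apply: lin_basis => [||[l d]].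
- exact: lin_comp (tensUV_lin A B) (tens_linr _ _).
- exact: lin_comp (tens_linr _ _) lB.
by rewrite tensU; exact: tensUV_b.
Qed.
Lemma tensVU_tens A B : linear A -> linear B -> forall x y,
  tensVU A B (tens (fun x y => ((x.1, y.1), (y.2, x.2))) x y)
  = tens (fun x y => ((x.1, y.1), (y.2, x.2))) (A x) (B y).
Proof.
move=> lA lB x y; move: x; apply: lin_basis => [||[k c]].
- exact: lin_comp (tensVU_lin A B) (tens_linl _ _).
- exact: lin_comp (tens_linl _ _) lA.
move: y; apply: lin_basis => [||[l d]].
- exact: lin_comp (tensVU_lin A B) (tens_linr _ _).
- exact: lin_comp (tens_linr _ _) lB.
by rewrite tensU; exact: tensVU_b.
Qed.

Lemma tensUV_comp A B C D x : linear A -> linear B ->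
  tensUV (fun w => A (C w)) (fun w => B (D w)) x = tensUV A B (tensUV C D x).
Proof.
move=> lA lB; move: x; apply: basisVV_ext; first exact: tensUV_lin.
  by apply: lin_comp; exact: tensUV_lin.
by move=> k l c d; rewrite !tensUV_b tensUV_tens.
Qed.
Lemma tensVU_comp A B C D x : linear A -> linear B ->
  tensVU (fun w => A (C w)) (fun w => B (D w)) x = tensVU A B (tensVU C D x).
Proof.
move=> lA lB; move: x; apply: basisVV_ext; first exact: tensVU_lin.
  by apply: lin_comp; exact: tensVU_lin.
by move=> k l c d; rewrite !tensVU_b tensVU_tens.
Qed.

(** The first factor carries the powers of v here, so the shift of [A] moves d and the shift of [B]
    moves c. *)
Lemma tensVU_laurent A B i j i' j' al be s t c d r :
  (forall m, A (basisV i m) = al *: basisV i' (m + s)) ->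
  (forall m, B (basisV j m) = be *: basisV j' (m + t)) ->
  tensVU A B (laurent basisVV c d i j r) = (al * be) *: laurent basisVV (c + t) (d + s) i' j' r.
Proof.
move=> hA hB; rewrite /laurent (lin_sum (tensVU_lin A B)) scaler_sumr; apply: eq_bigr => e _.
rewrite (lin_Z (tensVU_lin A B)) (tensVU_basis (hA _) (hB _)) !scalerA mulrC.
by rewrite (addrAC c) (addrAC d).
Qed.

(** u/v has total degree 0, so a degree operator scales all terms of r(u/v) by the same power of
    q. *)
Lemma tensVU_laurent_diag A i j (h : 'I_N -> K) (q : K) c d r : q != 0 ->
  (forall k m, A (basisV k m) = (h k * q ^ m) *: basisV k m) ->
  tensVU A A (laurent basisVV c d i j r) = (h i * h j * q ^ (c + d)) *: laurent basisVV c d i j r.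
Proof.
move=> q0 hA; rewrite /laurent (lin_sum (tensVU_lin A A)) scaler_sumr; apply: eq_bigr => e _.
have E : h i * q ^ (d - e%:Z) * (h j * q ^ (c + e%:Z)) = h i * h j * q ^ (c + d).
  by rewrite mulrACA -expfzDr //; congr (_ * _ ^ _); ring.
rewrite (lin_Z (tensVU_lin A A)) (tensVU_basis (hA _ _) (hA _ _)) E.
by rewrite !scalerA mulrC.
Qed.
End TensorBasis.

(** * The intertwining relation on basis vectors *)

Section AbstractIntertwiner.
Context {K : fieldType} (n : nat) (rh sh : K).
Hypotheses (rh0 : rh != 0) (sh0 : sh != 0) (n2 : (2 <= n)%N).
Local Notation N := (2 * n)%N.
Variables (W : lmodType K) (b2 : 'I_N -> 'I_N -> int -> int -> W) (Rh : W -> W).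
Hypothesis b2_ext : forall f g : W -> W, linear f -> linear g ->
  (forall k l c d, f (b2 k l c d) = g (b2 k l c d)) -> f =1 g.
Hypothesis lR : linear Rh.
Hypothesis Rh_b : forall k l c d, Rh (b2 k l c d) = Rhat_image rh sh b2 k l c d.
Variables (U1 U2 V1 V2 : W -> W).
Hypotheses (lU1 : linear U1) (lU2 : linear U2) (lV1 : linear V1) (lV2 : linear V2).
Implicit Types (i j k l : 'I_N) (c d : int).

Lemma intertwine_e (m : 'I_n.+1) (g : K) x (t := (m == 0 :> nat)%N%:R : int) :
  (forall k l c d, U1 (b2 k l c d) = (g * e_coef n m k.+1) *: b2 (e_ord k) l (c + t) d) ->
  (forall k l c d, U2 (b2 k l c d)
     = (g * (w_wt n rh sh m k.+1 * e_coef n m l.+1)) *: b2 k (e_ord l) c (d + t)) ->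
  (forall k l c d r, V1 (laurent b2 c d k l r) = (g * e_coef n m k.+1) *: laurent b2 c (d + t) (e_ord k) l r) ->
  (forall k l c d r, V2 (laurent b2 c d k l r)
     = (g * (w_wt n rh sh m k.+1 * e_coef n m l.+1)) *: laurent b2 (c + t) d k (e_ord l) r) ->
  Rh (U1 x + U2 x) = V1 (Rh x) + V2 (Rh x).
Proof.
move=> hU1 hU2 hV1 hV2; move: x; apply: b2_ext => [||k l c d].
- by apply: lin_comp lR _; exact: lin_add.
- by apply: lin_add; exact: lin_comp.
rewrite hU1 hU2 (lin_D lR) !(lin_Z lR) !Rh_b -(scalerA g (_ * _)) -(scalerA g (e_coef _ _ _)) -scalerDr.
rewrite (Rhat_image_E rh0 sh0 n2 b2 k l c d (ltn_ord m)).
rewrite {1 2}/Rhat_image (lin_sum lV1) (lin_sum lV2) -big_split scaler_sumr.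
apply: eq_bigr => p _; rewrite (lin_sum lV1) (lin_sum lV2) -big_split scaler_sumr.
by apply: eq_bigr => q _ /=; rewrite hV1 hV2 scalerDr !scalerA.
Qed.

Lemma intertwine_f (m : 'I_n.+1) (g : K) x (t := (m == 0 :> nat)%N%:R : int) :
  (forall k l c d, U1 (b2 k l c d) = (g * f_coef n rh sh m l.+1) *: b2 k (f_ord l) c (d - t)) ->
  (forall k l c d, U2 (b2 k l c d)
     = (g * (f_coef n rh sh m k.+1 * w'_wt n rh sh m l.+1)) *: b2 (f_ord k) l (c - t) d) ->
  (forall k l c d r, V1 (laurent b2 c d k l r)
     = (g * f_coef n rh sh m l.+1) *: laurent b2 (c - t) d k (f_ord l) r) ->
  (forall k l c d r, V2 (laurent b2 c d k l r)
     = (g * (f_coef n rh sh m k.+1 * w'_wt n rh sh m l.+1)) *: laurent b2 c (d - t) (f_ord k) l r) ->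
  Rh (U1 x + U2 x) = V1 (Rh x) + V2 (Rh x).
Proof.
move=> hU1 hU2 hV1 hV2; move: x; apply: b2_ext => [||k l c d].
- by apply: lin_comp lR _; exact: lin_add.
- by apply: lin_add; exact: lin_comp.
rewrite hU1 hU2 (lin_D lR) !(lin_Z lR) !Rh_b -(scalerA g (_ * _)) -(scalerA g (f_coef _ _ _ _ _)) -scalerDr addrC.
rewrite (Rhat_image_F rh0 sh0 n2 b2 k l c d (ltn_ord m)).
rewrite {1 2}/Rhat_image (lin_sum lV1) (lin_sum lV2) -big_split scaler_sumr.
apply: eq_bigr => p _; rewrite (lin_sum lV1) (lin_sum lV2) -big_split scaler_sumr.
by apply: eq_bigr => q _ /=; rewrite hV1 hV2 scalerDr !scalerA addrC.
Qed.

Lemma intertwine_torus (h : nat -> K) (q : K) x :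
  (forall m, in_range n m -> h m * h (primed n m) = 1) ->
  (forall k l c d, U1 (b2 k l c d) = (h k.+1 * h l.+1 * q ^ (c + d)) *: b2 k l c d) ->
  (forall k l c d r, V1 (laurent b2 c d k l r)
     = (h k.+1 * h l.+1 * q ^ (c + d)) *: laurent b2 c d k l r) ->
  Rh (U1 x) = V1 (Rh x).
Proof.
move=> hh hU1 hV1; move: x; apply: b2_ext => [||k l c d]; try exact: lin_comp.
rewrite hU1 (lin_Z lR) !Rh_b {2}/Rhat_image (lin_sum lV1) scaler_sumr.
apply: eq_bigr => i _; rewrite (lin_sum lV1) scaler_sumr; apply: eq_bigr => j _.
rewrite hV1 ![_ * q ^ _]mulrC -!(scalerA (q ^ _)); congr (_ *: _).
by rewrite -!(lin_Z (laurent_lin b2 c d i j)) Rrow_delta_weight.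
Qed.
End AbstractIntertwiner.

Section Intertwiner.
Context {K : fieldType} (n : nat) (rh sh : K).
Hypotheses (rh0 : rh != 0) (sh0 : sh != 0) (n2 : (2 <= n)%N).
Local Notation N := (2 * n)%N.
Local Notation Rh := (RhatUV rh sh).
Local Notation b2v := (@basisVV K n).
Implicit Types (i j k l : 'I_N) (c d : int) (x : @V2aff K n).

Lemma RhatUV_lin : linear (Rh : @V2aff K n -> V2aff n).
Proof. exact: linext_lin. Qed.

Lemma RhatUV_b k l c d : Rh (b2v k l c d) = Rhat_image rh sh b2v k l c d.
Proof.
rewrite /RhatUV linextU /Rhat_image; apply: eq_bigr => i _; apply: eq_bigr => j _.
by rewrite Rhat_entry /laurent; apply: eq_bigr => e _; exact: malgUZ.
Qed.

Lemma id_basisV k c : id (basisV k c) = (1 : K) *: basisV k (c + 0).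
Proof. by rewrite addr0 scale1r. Qed.

Variables (A B : @Vaff K n -> @Vaff K n).

Lemma RhatUV_e (m : 'I_n.+1) (g : K) x :
  (forall k c, A (basisV k c) = (g * e_coef n m k.+1) *: basisV (e_ord k) (c + (m == ord0)%:R)) ->
  (forall k c, B (basisV k c) = w_wt n rh sh m k.+1 *: basisV k (c + 0)) ->
  Rh (tensUV A id x + tensUV B A x) = tensVU A id (Rh x) + tensVU B A (Rh x).
Proof.
move=> hA hB.
apply: (intertwine_e rh0 sh0 n2 (@basisVV_ext _ _ _) RhatUV_lin RhatUV_b
  (tensUV_lin _ _) (tensUV_lin _ _) (tensVU_lin _ _) (tensVU_lin _ _) (m := m) (g := g)).
- by move=> k l c d; rewrite (tensUV_basis (B := id) (hA k c) (id_basisV l d)) mulr1 addr0.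
- by move=> k l c d; rewrite (tensUV_basis (hB k c) (hA l d)) mulrCA addr0.
- by move=> k l c d r; rewrite (tensVU_laurent (B := id) c d r (hA k) (id_basisV l)) mulr1 addr0.
- by move=> k l c d r; rewrite (tensVU_laurent c d r (hB k) (hA l)) mulrCA addr0.
Qed.

Lemma RhatUV_f (m : 'I_n.+1) (g : K) x :
  (forall k c, A (basisV k c) = (g * f_coef n rh sh m k.+1) *: basisV (f_ord k) (c - (m == ord0)%:R)) ->
  (forall k c, B (basisV k c) = w'_wt n rh sh m k.+1 *: basisV k (c + 0)) ->
  Rh (tensUV id A x + tensUV A B x) = tensVU id A (Rh x) + tensVU A B (Rh x).
Proof.
move=> hA hB.
apply: (intertwine_f rh0 sh0 n2 (@basisVV_ext _ _ _) RhatUV_lin RhatUV_b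
  (tensUV_lin _ _) (tensUV_lin _ _) (tensVU_lin _ _) (tensVU_lin _ _) (m := m) (g := g)).
- by move=> k l c d; rewrite (tensUV_basis (A := id) (id_basisV k c) (hA l d)) mul1r addr0.
- by move=> k l c d; rewrite (tensUV_basis (hA k c) (hB l d)) mulrA addr0.
- by move=> k l c d r; rewrite (tensVU_laurent (A := id) c d r (id_basisV k) (hA l)) mul1r addr0.
- by move=> k l c d r; rewrite (tensVU_laurent c d r (hA k) (hB l)) mulrA addr0.
Qed.

Lemma RhatUV_torus (h : nat -> K) (q : K) x : q != 0 ->
  (forall m, in_range n m -> h m * h (primed n m) = 1) ->
  (forall k c, A (basisV k c) = (h k.+1 * q ^ c) *: basisV k c) ->
  Rh (tensUV A A x) = tensVU A A (Rh x).
Proof.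
move=> q0 hh hA.
apply: (intertwine_torus (@basisVV_ext _ _ _) RhatUV_lin RhatUV_b
  (tensUV_lin _ _) (tensVU_lin _ _) (h := h) (q := q)) => //.
- move=> k l c d; rewrite (tensUV_basis (hA k c) (hA l d)).
  have -> : h k.+1 * q ^ c * (h l.+1 * q ^ d) = h k.+1 * h l.+1 * q ^ (c + d) by rewrite mulrACA -expfzDr.
  by [].
- by move=> k l c d r; rewrite (tensVU_laurent_diag (h := fun k => h k.+1) k l c d r q0 hA).
Qed.
End Intertwiner.

Section RhoIntertwiner.
Context {K : fieldType} (n : nat) (rh sh a b : K).
Hypotheses (rh0 : rh != 0) (sh0 : sh != 0) (n2 : (2 <= n)%N).
Hypotheses (hab : a * b = (rh ^+ 2 * sh ^+ 2)^-1).
Hypothesis rsi : forall i, (i <= n)%N -> rr n rh i != ss n sh i.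
Local Notation N := (2 * n)%N.
Local Notation T := (@genop K n rh sh a b).
Local Notation rho := (@rho K n rh sh a b).
Local Notation Rh := (RhatUV rh sh).

Lemma genop_Urel x y : Urel rh sh x y -> forall w, freeAct T x w = freeAct T y w.
Proof.
apply: (Urel_act rh0 sh0 n2 hab rsi (basisV := @basisV K n)).
- exact: genop_lin.
- by move=> f g lf lg h; apply: lin_basis => // -[k m]; exact: h.
- by move=> i k m; exact: genop_e.
- by move=> i k m; exact: genop_f.
- by move=> y0 k m; exact: genop_t.
- by move=> y0 k m; exact: genop_tV.
Qed.

Lemma rho_lin x : linear (rho x).
Proof. exact: (presAct_lin (genop_lin rh sh a b)). Qed.

Lemma rho_gen g : rho (Ugenerator rh sh g) = T g.
Proof.
apply/funext => w; rewrite -[RHS]freeAct_gen.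
exact: (presAct_Pi (genop_lin rh sh a b) genop_Urel).
Qed.

Lemma rho1 : rho 1 = id.
Proof. by apply/funext => w; exact: (presAct1 (genop_lin rh sh a b) genop_Urel). Qed.

Lemma rhoM x y : rho (x * y) = fun w => rho x (rho y w).
Proof. by apply/funext => w; exact: (presActM (genop_lin rh sh a b) genop_Urel). Qed.

Lemma rhoZ c x : rho (c *: x) = fun w => c *: rho x w.
Proof. by apply/funext => w; exact: (presActZ (genop_lin rh sh a b) genop_Urel). Qed.

(** Common form of the group-like generators: q is 1 for the weight operators and h is 1 for the
    degree operators. The condition on h is the one under which R commutes with the weight
    operator. *)
Lemma torus_shape y : exists h : nat -> K, exists2 q : K, q != 0 &
  (forall m, in_range n m -> h m * h (primed n m) = 1) /\
  (forall (k : 'I_N) c, torus_val rh sh y k c = h k.+1 * q ^ c).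
Proof.
have one : (1 : K) != 0 := oner_neq0 _.
case: y => [i|i||||] /=.
- exists (w_wt n rh sh i), 1 => //; split=> [m hm|k c]; last by rewrite exp1rz mulr1.
  by rewrite w_wt_primed // mulfV // w_wt_neq0.
- exists (w'_wt n rh sh i), 1 => //; split=> [m hm|k c]; last by rewrite exp1rz mulr1.
  by rewrite w'_wt_primed // mulfV // w'_wt_neq0.
- by exists (fun=> 1), 1 => //; split=> [m hm|k c]; rewrite ?exp1rz mulr1.
- by exists (fun=> 1), 1 => //; split=> [m hm|k c]; rewrite ?exp1rz mulr1.
- by exists (fun=> 1), (rr n rh 0); [exact: rr_neq0|split=> [m hm|k c]; rewrite ?mulr1 ?mul1r].
- by exists (fun=> 1), (ss n sh 0); [exact: ss_neq0|split=> [m hm|k c]; rewrite ?mulr1 ?mul1r].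
Qed.

(** With the operators as separate variables, the images under [rho] are substituted as a whole. *)
Lemma rhoUV1 (y y' : Urs n rh sh) A B x : rho y = A -> rho y' = B -> rhoUV a b [:: (y, y')] x = tensUV A B x.
Proof. by move=> <- <-; rewrite /rhoUV big_seq1. Qed.
Lemma rhoVU1 (y y' : Urs n rh sh) A B x : rho y = A -> rho y' = B -> rhoVU a b [:: (y, y')] x = tensVU A B x.
Proof. by move=> <- <-; rewrite /rhoVU big_seq1. Qed.
Lemma rhoUV2 (y y' z z' : Urs n rh sh) A B C D x : rho y = A -> rho y' = B -> rho z = C -> rho z' = D ->
  rhoUV a b [:: (y, y'); (z, z')] x = tensUV A B x + tensUV C D x.
Proof. by move=> <- <- <- <-; rewrite /rhoUV big_cons big_seq1. Qed.
Lemma rhoVU2 (y y' z z' : Urs n rh sh) A B C D x : rho y = A -> rho y' = B -> rho z = C -> rho z' = D ->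
  rhoVU a b [:: (y, y'); (z, z')] x = tensVU A B x + tensVU C D x.
Proof. by move=> <- <- <- <-; rewrite /rhoVU big_cons big_seq1. Qed.

Lemma RhatUV_gen g (x : V2aff n) : Rh (rhoUV a b (coproductGen rh sh g) x)
  = rhoVU a b (coproductGen rh sh g) (Rh x).
Proof.
pose X (g0 : Ugen n) := Ugenerator rh sh g0.
case: g => [i|i|y|y].
- rewrite -[coproductGen _ _ _]/[:: (X (gen_e i), 1); (X (gen_t (t_w i)), X (gen_e i))].
  rewrite (rhoUV2 x (rho_gen _) rho1 (rho_gen _) (rho_gen _)).
  rewrite (rhoVU2 (Rh x) (rho_gen _) rho1 (rho_gen _) (rho_gen _)).
  by apply: (RhatUV_e rh0 sh0 n2) => k c; [exact: genop_e|rewrite addr0; exact: genop_t].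
- rewrite -[coproductGen _ _ _]/[:: (1, X (gen_f i)); (X (gen_f i), X (gen_t (t_w' i)))].
  rewrite (rhoUV2 x rho1 (rho_gen _) (rho_gen _) (rho_gen _)).
  rewrite (rhoVU2 (Rh x) rho1 (rho_gen _) (rho_gen _) (rho_gen _)).
  by apply: (RhatUV_f rh0 sh0 n2) => k c; [exact: genop_f|rewrite addr0; exact: genop_t].
- rewrite -[coproductGen _ _ _]/[:: (X (gen_t y), X (gen_t y))].
  rewrite (rhoUV1 x (rho_gen _) (rho_gen _)) (rhoVU1 (Rh x) (rho_gen _) (rho_gen _)).
  have [h [q q0 [hh E]]] := torus_shape y.
  by apply: (@RhatUV_torus K n rh sh _ h q x q0 hh) => k c; rewrite -E; exact: genop_t.
rewrite -[coproductGen _ _ _]/[:: (X (gen_tV y), X (gen_tV y))].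
rewrite (rhoUV1 x (rho_gen _) (rho_gen _)) (rhoVU1 (Rh x) (rho_gen _) (rho_gen _)).
have [h [q q0 [hh E]]] := torus_shape y.
apply: (@RhatUV_torus K n rh sh _ (fun m => (h m)^-1) q^-1 x); rewrite ?invr_eq0 //.
  by move=> m hm; rewrite -invfM hh // invr1.
by move=> k c; rewrite exprz_inv -invr_expz -invfM -E; exact: genop_tV.
Qed.

Lemma tensUV_rhoZ c y1 y2 x : tensUV (rho (c *: y1)) (rho y2) x = c *: tensUV (rho y1) (rho y2) x.
Proof.
rewrite -tensUVZ; exact: (f_equal (fun A => tensUV A (rho y2) x) (rhoZ c y1)).
Qed.
Lemma tensVU_rhoZ c y1 y2 x : tensVU (rho (c *: y1)) (rho y2) x = c *: tensVU (rho y1) (rho y2) x.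
Proof.
rewrite -tensVUZ; exact: (f_equal (fun A => tensVU A (rho y2) x) (rhoZ c y1)).
Qed.

Lemma rhoUV_M (l l' : seq (Urs n rh sh * Urs n rh sh)) x :
  rhoUV a b [seq (y.1 * y'.1, y.2 * y'.2) | y <- l, y' <- l'] x = rhoUV a b l (rhoUV a b l' x).
Proof.
rewrite /rhoUV big_allpairs_dep /=; apply: eq_bigr => y _.
rewrite [RHS](lin_sum (tensUV_lin (rho y.1) (rho y.2))).
apply: eq_bigr => y' _.
transitivity (tensUV (fun w => rho y.1 (rho y'.1 w)) (fun w => rho y.2 (rho y'.2 w)) x).
  exact: (f_equal2 (fun A B => tensUV A B x) (rhoM _ _) (rhoM _ _)).
exact: (tensUV_comp _ _ _ (rho_lin _) (rho_lin _)).
Qed.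
Lemma rhoVU_M (l l' : seq (Urs n rh sh * Urs n rh sh)) x :
  rhoVU a b [seq (y.1 * y'.1, y.2 * y'.2) | y <- l, y' <- l'] x = rhoVU a b l (rhoVU a b l' x).
Proof.
rewrite /rhoVU big_allpairs_dep /=; apply: eq_bigr => y _.
rewrite [RHS](lin_sum (tensVU_lin (rho y.1) (rho y.2))).
apply: eq_bigr => y' _.
transitivity (tensVU (fun w => rho y.1 (rho y'.1 w)) (fun w => rho y.2 (rho y'.2 w)) x).
  exact: (f_equal2 (fun A B => tensVU A B x) (rhoM _ _) (rhoM _ _)).
exact: (tensVU_comp _ _ _ (rho_lin _) (rho_lin _)).
Qed.

(** Induction on how the formal sum was built. Both actions turn concatenation into sums and
    products of tensors into composition, so the relation spreads from the generators. *)
Lemma RhatUV_rho (x : Urs n rh sh) l : coproduct x l -> forall m : V2aff n,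
  Rh (rhoUV a b l m) = rhoVU a b l (Rh m).
Proof.
elim=> {x l} [g|||x x' l l' _ IH _ IH'|x x' l l' _ IH _ IH'] => [m||c x l _ IH m|m|m].
- exact: RhatUV_gen.
- move=> m; rewrite (rhoUV1 m rho1 rho1) (rhoVU1 (Rh m) rho1 rho1).
  by rewrite (tensUV_id m) (tensVU_id (Rh m)).
- transitivity (Rh (c *: rhoUV a b l m)).
    congr (Rh _); rewrite /rhoUV big_map scaler_sumr; apply: eq_bigr => y _.
    exact: tensUV_rhoZ.
  rewrite (lin_Z (RhatUV_lin rh sh)) IH /rhoVU big_map scaler_sumr; apply: eq_bigr => y _.
  by symmetry; exact: tensVU_rhoZ.
- transitivity (Rh (rhoUV a b l m) + Rh (rhoUV a b l' m)).
    by rewrite -[RHS](lin_D (RhatUV_lin rh sh)); congr (Rh _); exact: big_cat.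
  rewrite [X in X + _]IH [X in _ + X]IH'.
  by symmetry; exact: big_cat.
exact: (etrans (f_equal Rh (rhoUV_M l l' m)) (etrans (IH (rhoUV a b l' m))
  (etrans (f_equal (rhoVU a b l) (IH' m)) (esym (rhoVU_M l l' (Rh m)))))).
Qed.
End RhoIntertwiner.

Theorem theorem6p12 (RR : realType) (K : closedFieldType)
    (iota : {rmorphism {fraction {poly {poly RR[i]}}} -> K}) (rh sh : K)
    (hr : rh ^+ 2 = iota (tofrac 'X)) (hs : sh ^+ 2 = iota (tofrac ('X%:P)))
    (n : nat) (hn : (2 <= n)%N) :
  (forall a b : K, a != 0 -> b != 0 -> a * b = (rh ^+ 2 * sh ^+ 2)^-1 ->
     forall (x : Urs n rh sh) (l : seq (Urs n rh sh * Urs n rh sh)),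
       coproduct x l ->
     forall m : V2aff n,
       RhatUV rh sh (rhoUV a b l m) = rhoVU a b l (RhatUV rh sh m))
  /\
  (let L := {fraction {poly {poly {poly K}}}} in
   let phi (c : K) : L := tofrac c%:P%:P%:P in
   let u : L := tofrac 'X in
   let v : L := tofrac 'X%:P in
   let w : L := tofrac 'X%:P%:P in
   R12 n rh sh phi (v / w) *m R13 n rh sh phi (u / w) *m R23 n rh sh phi (u / v)
   = R23 n rh sh phi (u / v) *m R13 n rh sh phi (u / w)
       *m R12 n rh sh phi (v / w)).
Proof.
have rh0 : rh != 0.
  have : rh ^+ 2 != 0; last by rewrite expf_eq0.
  by rewrite hr fmorph_eq0 tofrac_eq0 polyX_eq0.
have sh0 : sh != 0.
  have : sh ^+ 2 != 0; last by rewrite expf_eq0.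
  by rewrite hs fmorph_eq0 tofrac_eq0 polyC_eq0 polyX_eq0.
(* r and s are independent: r^e is the power X^e of the outer variable and s^e is constant in it, so
   their coefficients at X^e are 1 and 0. This gives r_i different from s_i. *)
have neq e : (0 < e)%N -> rh ^+ (2 * e) != sh ^+ (2 * e).
  move=> e0; rewrite !exprM hr hs -!rmorphXn (inj_eq (fmorph_inj iota)) tofrac_eq.
  apply/eqP => /(congr1 (fun p : {poly {poly RR[i]}} => p`_e)).
  rewrite coefXn eqxx coefC (gtn_eqF e0) => /eqP; by rewrite oner_eq0.
have rsi i : (i <= n)%N -> rr n rh i != ss n sh i.
  move=> hi; rewrite /rr /ss ip_alpha_diag //; case: ifP => _.
    exact: (neq 2%N).
  exact: (neq 1%N).
split=> [a b _ _ hab x l hc m|]; first exact: (RhatUV_rho rh0 sh0 hn hab rsi hc).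
move=> L phi u v w.
(* The map [phi] equipped with its structure of ring morphism. *)
pose psi : {rmorphism K -> L} :=
  (@tofrac _ : {rmorphism _ -> L}) \o ((polyC : {rmorphism _ -> {poly {poly {poly K}}}})
    \o ((polyC : {rmorphism _ -> {poly {poly K}}}) \o (polyC : {rmorphism K -> _}))).
apply: (yang_baxter psi rh0 sh0 hn); by rewrite tofrac_eq0 ?polyC_eq0 polyX_eq0.
Qed.
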